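(* Suppose $\mu=0$. Then, as $n\to\infty$, \[ n^{-1/2}\operatorname{hull}\{S_0,S_1,\ldots,S_n\} \Rightarrow \Sigma^{1/2} h_1 \] in the sense of weak convergence on $(\mathcal{K}_2^0,\rho_H)$.
   Context: $Z$ is a random vector in $\mathbb{R}^2$ with $\mathbb{E}[\|Z\|^2]<\infty$; $Z_1,Z_2,\ldots$ are i.i.d. copies of $Z$; $S_0=0$, $S_n=\sum_{k=1}^n Z_k$. $\mu=\mathbb{E}Z$ and $\Sigma=\mathbb{E}[(Z-\mu)(Z-\mu)^\top]$; $\Sigma^{1/2}$ is its positive semidefinite symmetric square root. $b=(b(s))_{s\in[0,1]}$ is standard Brownian motion in $\mathbb{R}^2$ with $b(0)=0$, and $h_1=\operatorname{hull} b[0,1]$ is the convex hull of its path. $\mathcal{K}_2^0$ is the collection of compact convex subsets of $\mathbb{R}^2$ containing the origin, with the Hausdorff metric $\rho_H(A,B)=\max\{\sup_{x\in B}\rho(x,A),\sup_{y\in A}\rho(y,B)\}$, $\rho(x,A)=\inf_{y\in A}\|x-y\|$. *)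

(* Defs.v *)
From HB Require Import structures.
From mathcomp Require Import all_boot all_order all_algebra.
From mathcomp Require Import all_classical all_reals all_analysis.
Set Implicit Arguments. Unset Strict Implicit. Unset Printing Implicit Defensive.
Import Order.TTheory GRing.Theory Num.Def Num.Theory.
Import numFieldTopology.Exports numFieldNormedType.Exports.
Local Open Scope classical_set_scope.
Local Open Scope ring_scope.

Section Defs.
Context {R : realType}.

(* Points of R^2 are pairs; the topology/measurable structure on R*R is the
   product one (= Euclidean topology, Borel sigma-algebra of R^2). *)
Definition padd (x y : R * R) : R * R := (x.1 + y.1, x.2 + y.2).
Definition psub (x y : R * R) : R * R := (x.1 - y.1, x.2 - y.2).
Definition pscale (c : R) (x : R * R) : R * R := (c * x.1, c * x.2).
Definition enorm (x : R * R) : R := Num.sqrt (x.1 ^+ 2 + x.2 ^+ 2).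
Definition coord (x : R * R) (i : 'I_2) : R := if val i == 0%N then x.1 else x.2.
Definition mxapp (M : 'M[R]_2) (x : R * R) : R * R :=
  (\sum_(j < 2) M ord0 j * coord x j, \sum_(j < 2) M ord_max j * coord x j).

Definition convex2 (C : set (R * R)) : Prop :=
  forall x y t, C x -> C y -> 0 <= t <= 1 -> C (padd (pscale t x) (pscale (1 - t) y)).
Definition hull (A : set (R * R)) : set (R * R) :=
  [set x | forall C, convex2 C -> A `<=` C -> C x].

Definition dist_to (x : R * R) (A : set (R * R)) : R :=
  inf [set enorm (psub x y) | y in A].
Definition rhoH (A B : set (R * R)) : R :=
  maxr (sup [set dist_to x A | x in B]) (sup [set dist_to y B | y in A]).

Definition K20 (A : set (R * R)) : Prop := [/\ compact A, convex2 A & A (0, 0)].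

Definition bdd_cont_K20 (f : set (R * R) -> R) : Prop :=
  (exists M : R, forall A, K20 A -> `|f A| <= M) /\
  (forall A, K20 A -> forall e : R, 0 < e -> exists2 del : R, 0 < del &
     forall B, K20 B -> rhoH A B < del -> `|f A - f B| < e).

Definition weak_conv_K20 {d} {T : measurableType d} (P : probability T R)
  (X : nat -> T -> set (R * R)) {d'} {T' : measurableType d'}
  (Q : probability T' R) (Y : T' -> set (R * R)) : Prop :=
  [/\ (forall n w, K20 (X n w)), (forall w, K20 (Y w)) &
   forall f, bdd_cont_K20 f ->
     [/\ (forall n, measurable_fun setT (f \o X n)),
         measurable_fun setT (f \o Y) &
         ((\int[P]_w (f (X n w))%:E)%E @[n --> \oo] -->
           (\int[Q]_w (f (Y w))%:E)%E)]].

Definition iid_seq {d} {T : measurableType d} (P : probability T R)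
  (Z : nat -> T -> R * R) : Prop :=
  [/\ (forall k, measurable_fun setT (Z k)),
      (forall k (A : set (R * R)), measurable A ->
         P (Z k @^-1` A) = P (Z 0%N @^-1` A)) &
      (forall (I : seq nat) (A : nat -> set (R * R)), uniq I ->
         (forall i, measurable (A i)) ->
         P (\bigcap_(i in [set` I]) (Z i @^-1` A i)) =
         (\prod_(i <- I) P (Z i @^-1` A i))%E)].

Definition meanv {d} {T : measurableType d} (P : probability T R)
  (Z : T -> R * R) (i : 'I_2) : R :=
  fine (\int[P]_w (coord (Z w) i)%:E)%E.
Definition covmx {d} {T : measurableType d} (P : probability T R)
  (Z : T -> R * R) : 'M[R]_2 :=
  \matrix_(i, j) fine (\int[P]_w ((coord (Z w) i - meanv P Z i) *
                                   (coord (Z w) j - meanv P Z j))%:E)%E.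

Definition psd2 (M : 'M[R]_2) : Prop :=
  M^T = M /\ forall v : 'cV[R]_2, 0 <= (v^T *m M *m v) ord0 ord0.

Definition walk (Z : nat -> R * R) (n : nat) : R * R :=
  (\sum_(k < n) (Z k).1, \sum_(k < n) (Z k).2).

(* law of a centred Gaussian vector in R^2 with covariance h * I *)
Definition gauss2 (h : R) : set (R * R) -> \bar R :=
  (normal_prob 0 (Num.sqrt h) \x normal_prob 0 (Num.sqrt h))%E.

Definition std_BM2 {d} {T : measurableType d} (Q : probability T R)
  (b : R -> T -> R * R) : Prop :=
  [/\ (forall w, b 0 w = (0, 0)),
      (forall w, {within `[0, 1], continuous (fun t => b t w)}),
      (forall t, measurable_fun setT (b t)) &
      (forall (k : nat) (ts : nat -> R) (A : nat -> set (R * R)),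
         ts 0%N = 0 -> (forall i, (i < k)%N -> ts i < ts i.+1) -> ts k <= 1 ->
         (forall i, measurable (A i)) ->
         Q (\bigcap_(i in [set i | (i < k)%N])
              [set w | A i (psub (b (ts i.+1) w) (b (ts i) w))]) =
         (\prod_(i < k) gauss2 (ts i.+1 - ts i) (A i))%E)].

End Defs.

(* Main.v *)
Require Import Defs.
From HB Require Import structures.
From mathcomp Require Import all_boot all_order all_algebra.
From mathcomp Require Import all_classical all_reals all_analysis.
From mathcomp Require Import measurable_realfun ring lra zify.
Import Order.TTheory GRing.Theory Num.Def Num.Theory.
Import numFieldTopology.Exports numFieldNormedType.Exports.
Local Open Scope classical_set_scope.
Local Open Scope ring_scope.

Set Implicit Arguments.
Unset Strict Implicit.
Unset Printing Implicit Defensive.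

(** Lipschitz test functions suffice: a bounded continuous [f] on convex bodies
    is the increasing limit of the inf-convolutions
    [inf_A (f A + n rho_H(A, B))], and applying this to [f] and to [- f] gives
    both halves of the limit.

    For Lipschitz [f], replace the path by its values at [m] block ends.  For
    Brownian motion the error vanishes as [m] grows, by continuity of the path.
    For the walk, the hull moves by at most the largest oscillation within a
    block; Ottaviani's inequality bounds this by the tail of a block sum, which
    by the comparison below is nearly Gaussian, so that a fourth moment bounds
    the sum of the [m] tails by [O(1/m)] for all large [n].

    For fixed [m], the block sums are compared with the Brownian increments by
    Lindeberg's replacement of one step at a time, tested against products of
    smooth compactly supported bumps (cubic B-splines).  The bumps form a
    partition of unity, so a finite combination of such products approximates
    a continuous function of the [m] increments off an event of small
    probability. *)

(** * Convex hulls and the Hausdorff distance *)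

(** The walk has second moments only, and this shapes the estimates. Summed over [m] blocks,
    Chebyshev's inequality leaves a quantity of order 1: enough for the factor 1/2 in Ottaviani's
    inequality, but not for a vanishing total. The Gaussian fourth moment gains a factor of order
    [1/m] per block; it reaches the walk through a smooth cutoff of the block sum, with a comparison
    error of at most [1/(2 m^2)] once [n] is taken large after [m]. For the same reason Taylor
    remainders are kept as the minimum of a square and a cube: the square dominates, the cube tends
    to 0.

    For comparison with the walk the Brownian path is cut at the times [floor(j n / m) / n], so that
    each block has as many steps as its counterpart; these times then tend to [j / m].

    Product test functions reduce [m] joint increments to one block at a time, because their
    expectations factor. Measurability never concerns set-valued maps: a continuous function of the
    hull of finitely many random points is a limit of functions of rounded points, and the Brownian
    hull is a limit of such hulls. *)

Section Plane.
Context {R : realType}.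
Implicit Types (x y z : R * R) (A B C : set (R * R)).

Lemma enorm_ge0 x : 0 <= enorm x. Proof. exact: sqrtr_ge0. Qed.

Lemma sqr_enorm x : enorm x ^+ 2 = x.1 ^+ 2 + x.2 ^+ 2.
Proof. by rewrite sqr_sqrtr// addr_ge0// sqr_ge0. Qed.

Lemma enorm_le x c : 0 <= c -> x.1 ^+ 2 + x.2 ^+ 2 <= c ^+ 2 -> enorm x <= c.
Proof.
by move=> c0 h; rewrite -(@ler_pXn2r _ 2)// ?nnegrE ?enorm_ge0// sqr_enorm.
Qed.

Lemma dot_le_enorm x y : x.1 * y.1 + x.2 * y.2 <= enorm x * enorm y.
Proof.
rewrite (le_trans (ler_norm _))//.
rewrite -(@ler_pXn2r _ 2)// ?nnegrE ?mulr_ge0 ?enorm_ge0//.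
rewrite exprMn !sqr_enorm real_normK ?num_real// -subr_ge0.
(* Lagrange's identity: the defect in the Cauchy-Schwarz inequality is a square. *)
rewrite (_ : _ - _ = (x.1 * y.2 - x.2 * y.1) ^+ 2) ?sqr_ge0//; ring.
Qed.

Lemma enormD x y : enorm (x + y) <= enorm x + enorm y.
Proof.
apply: enorm_le; first by rewrite addr_ge0// enorm_ge0.
rewrite (sqrrD (enorm x)) !sqr_enorm.
rewrite [leLHS](_ : _ = x.1 ^+ 2 + x.2 ^+ 2 + (x.1 * y.1 + x.2 * y.2) *+ 2
  + (y.1 ^+ 2 + y.2 ^+ 2)); last by rewrite /=; ring.
by rewrite lerD2r lerD2l lerMn2r dot_le_enorm orbT.
Qed.

Lemma enormZ (c : R) x : enorm (c *: x) = `|c| * enorm x.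
Proof.
by rewrite /enorm /= !exprMn -mulrDr sqrtrM ?sqr_ge0// sqrtr_sqr.
Qed.

Lemma enorm0 : enorm (0 : R * R) = 0.
Proof. by rewrite /enorm /= expr0n /= addr0 sqrtr0. Qed.

Lemma enormN x : enorm (- x) = enorm x.
Proof. by rewrite -scaleN1r enormZ normrN1 mul1r. Qed.

Lemma enormC x y : enorm (x - y) = enorm (y - x).
Proof. by rewrite -enormN opprB. Qed.

Lemma enormDB x y z : enorm (x - z) <= enorm (x - y) + enorm (y - z).
Proof. by rewrite (le_trans _ (enormD _ _))// addrA subrK. Qed.

Lemma enorm_ge1 x : `|x.1| <= enorm x.
Proof.
rewrite -(@ler_pXn2r _ 2)// ?nnegrE ?enorm_ge0// sqr_enorm.
by rewrite real_normK ?num_real// lerDl sqr_ge0.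
Qed.

Lemma enorm_ge2 x : `|x.2| <= enorm x.
Proof.
rewrite -(@ler_pXn2r _ 2)// ?nnegrE ?enorm_ge0// sqr_enorm.
by rewrite real_normK ?num_real// lerDr sqr_ge0.
Qed.

Lemma enorm_le_add x : enorm x <= `|x.1| + `|x.2|.
Proof.
apply: enorm_le; first by rewrite addr_ge0.
by rewrite sqrrD !real_normK ?num_real// lerD2r lerDl mulrn_wge0// mulr_ge0.
Qed.

(** On [R * R] the norm [|x|] is the maximum norm, and it carries the topology. This comparison and
    the next one transfer compactness and continuity to [enorm]. *)
Lemma le_norm_enorm x : `|x| <= enorm x.
Proof. by rewrite prod_normE ge_max enorm_ge1 enorm_ge2. Qed.

Lemma enorm_le_norm x : enorm x <= 2 * `|x|.
Proof.
rewrite (le_trans (enorm_le_add x))// mulr_natl mulr2n.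
by apply: lerD; rewrite prod_normE le_max lexx ?orbT.
Qed.

Lemma convex2_hull A : convex2 (hull A).
Proof.
move=> x y t hx hy t01 C cC sAC.
exact: (cC _ _ t (hx C cC sAC) (hy C cC sAC) t01).
Qed.

Lemma sub_hull A : A `<=` hull A. Proof. by move=> x Ax C _ sAC; exact: sAC. Qed.

Lemma hull_sub A C : convex2 C -> A `<=` C -> hull A `<=` C.
Proof. by move=> cC sAC x hx; exact: hx. Qed.

(** Linear maps pull convex sets back and push them forward, which gives one inclusion each.
    Linearity is a pair of hypotheses so that the lemma serves both [pscale] and [mxapp]. *)
Lemma image_hull (f : R * R -> R * R) A :
  (forall x y, f (x + y) = f x + f y) -> (forall c x, f (c *: x) = c *: f x) ->
  f @` hull A = hull (f @` A).
Proof.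
move=> fD fZ; apply/seteqP; split.
  move=> _ [x hx <-]; apply: (hx (f @^-1` hull (f @` A))) => [u v t fu fv t01|u Au].
    rewrite /preimage/= -/(t *: u + (1 - t) *: v) fD !fZ.
    exact: (convex2_hull fu fv t01).
  by apply: sub_hull; exists u.
apply: hull_sub; last by move=> _ [x Ax <-]; exists x => //; exact: sub_hull.
move=> _ _ t [x hx <-] [y hy <-] t01.
exists (t *: x + (1 - t) *: y); first exact: (convex2_hull hx hy t01).
by rewrite fD !fZ.
Qed.

Lemma mxappD (M : 'M[R]_2) x y : mxapp M (x + y) = mxapp M x + mxapp M y.
Proof.
rewrite /mxapp !big_ord_recl !big_ord0 /Defs.coord.
by apply: injective_projections => /=; ring.
Qed.

Lemma mxappZ (M : 'M[R]_2) (c : R) x : mxapp M (c *: x) = c *: mxapp M x.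
Proof.
rewrite -[c *: x]/(pscale c x) -[c *: mxapp _ _]/(pscale c _).
rewrite /mxapp !big_ord_recl !big_ord0 /Defs.coord /pscale.
by apply: injective_projections => /=; ring.
Qed.

Lemma mxapp0 (M : 'M[R]_2) : mxapp M 0 = 0.
Proof. by rewrite -[in LHS](scale0r (0 : R * R)) mxappZ scale0r. Qed.

Lemma mxappB (M : 'M[R]_2) x y : mxapp M (x - y) = mxapp M x - mxapp M y.
Proof. by rewrite mxappD -scaleN1r mxappZ scaleN1r. Qed.

End Plane.

(** * Carathéodory's theorem in the plane and compactness of hulls *)

Section Caratheodory.
Context {R : realType}.
Implicit Types (x y z : R * R) (A B C K : set (R * R)).

Definition comb_pts n K : set (R * R) :=
  [set x | exists (l : 'I_n -> R) (p : 'I_n -> R * R),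
    [/\ forall i, 0 <= l i, \sum_i l i = 1, forall i, K (p i) &
        x = \sum_i l i *: p i]].

(** The matrix with rows [(1, p.1, p.2)] has more rows than columns, hence a nonzero vector in its
    left kernel. The entries of this vector sum to 0, so one of them is positive. *)
Lemma affine_dependency n (p : 'I_n.+4 -> R * R) :
  exists a : 'I_n.+4 -> R, [/\ exists i, 0 < a i, \sum_i a i = 0 &
    \sum_i a i *: p i = 0].
Proof.
pose M : 'M[R]_(n.+4, 3) :=
  \matrix_(i, j) (if j == 0 then 1 else if j == 1 then (p i).1 else (p i).2).
have kM0 : kermx M != 0.
  rewrite kermx_eq0 /row_free; apply/negP => /eqP rM.
  by have := rank_leq_col M; rewrite rM.
pose a := nz_row (kermx M).
have a0 : a != 0 by rewrite nz_row_eq0.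
have aM : a *m M = 0 by apply/sub_kermxP; exact: nz_row_sub.
have aMj j : \sum_i a 0 i * M i j = 0.
  by have /matrixP/(_ 0 j) := aM; rewrite !mxE.
have sa : \sum_i a 0 i = 0.
  by rewrite -[RHS](aMj 0); apply: eq_bigr => i _; rewrite mxE/= mulr1.
exists (fun i => a 0 i); split => //.
- apply: contrapT => /forallNP na.
  have a_le0 i : a 0 i <= 0 by rewrite leNgt; apply/negP/na.
  move/eqP : a0; apply; apply/rowP => i; rewrite mxE.
  have /eqP : \sum_i - a 0 i = 0 by rewrite sumrN sa oppr0.
  rewrite psumr_eq0; last by move=> j _; rewrite oppr_ge0.
  by move/allP/(_ i (mem_index_enum _))/implyP/(_ isT); rewrite oppr_eq0 => /eqP.
- apply: injective_projections.
    rewrite (big_morph fst (id1 := 0) (op1 := +%R))//= -[RHS](aMj 1).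
    by apply: eq_bigr => i _; rewrite mxE.
  rewrite (big_morph snd (id1 := 0) (op1 := +%R))//= -[RHS](aMj 2%:R).
  by apply: eq_bigr => i _; rewrite mxE.
Qed.

Lemma comb_pts_reduce n K : comb_pts n.+4 K `<=` comb_pts n.+3 K.
Proof.
move=> x [l [p [l0 l1 Kp ->]]].
have [a [[i1 ai1] sa sap]] := affine_dependency p.
(* Subtracting [t] times the dependency moves neither the point nor the total weight. The smallest
   ratio [l i / a i] over positive [a i] is the largest [t] that keeps all weights nonnegative, and
   it cancels the weight of [i0]. *)
pose i0 := [arg min_(i < i1 | 0 < a i) (l i / a i)]%O.
have [ai0 min0] : 0 < a i0 /\ forall j, 0 < a j -> l i0 / a i0 <= l j / a j.
  by rewrite /i0; case: arg_minP => // i ai h; split.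
pose t := l i0 / a i0.
have t0 : 0 <= t by rewrite divr_ge0// ltW.
pose l' i := l i - t * a i.
have l'0 i : 0 <= l' i.
  rewrite subr_ge0; have [ai|ai] := leP (a i) 0.
    by rewrite (le_trans _ (l0 i))// mulr_ge0_le0.
  by rewrite -ler_pdivlMr// min0.
have l'i0 : l' i0 = 0 by rewrite /l' /t divfK ?subrr// gt_eqF.
exists (l' \o lift i0), (p \o lift i0); split => //=.
- have : \sum_i l' i = 1 by rewrite sumrB -mulr_sumr sa mulr0 subr0.
  by rewrite (bigD1_ord i0)//= l'i0 add0r.
- transitivity (\sum_i l' i *: p i).
    under [RHS]eq_bigr do rewrite scalerBl -scalerA.
    by rewrite sumrB -scaler_sumr sap scaler0 subr0.
  by rewrite (bigD1_ord i0)//= l'i0 scale0r add0r.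
Qed.

Lemma comb_pts_convex K : convex2 (comb_pts 3 K).
Proof.
move=> _ _ t [l [p [l0 l1 Kp ->]]] [m [q [m0 m1 Kq ->]]] /andP[t0 t1].
(* The two triples, weighted by [t] and [1 - t], form a combination of six points; three reductions
   lead back to three. *)
do 3 apply: comb_pts_reduce.
exists (fun i : 'I_(3 + 3) => match fintype.split i with
  inl j => t * l j | inr j => (1 - t) * m j end),
  (fun i : 'I_(3 + 3) => match fintype.split i with inl j => p j | inr j => q j end).
split.
- by move=> i; case: splitP => j _; rewrite mulr_ge0// subr_ge0.
- rewrite [LHS](@big_split_ord _ _ _ 3 3)/=.
  under eq_bigr => i _ do rewrite (unsplitK (inl i)).
  under [X in _ + X]eq_bigr => i _ do rewrite (unsplitK (inr i)).
  by rewrite -!mulr_sumr l1 m1; ring.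
- by move=> i; case: splitP.
- rewrite [RHS](@big_split_ord _ _ _ 3 3)/=.
  under [X in _ = X + _]eq_bigr => i _ do rewrite (unsplitK (inl i)) -scalerA.
  under [X in _ = _ + X]eq_bigr => i _ do rewrite (unsplitK (inr i)) -scalerA.
  by rewrite -!scaler_sumr.
Qed.

(** The union of the segments from [A] to [B], written as an image of a product so that compactness
    is inherited. *)
Definition join_seg A B : set (R * R) :=
  (fun z : R * ((R * R) * (R * R)) => z.1 *: z.2.1 + (1 - z.1) *: z.2.2) @`
    (`[0, 1] `*` (A `*` B)).

Lemma compact_join_seg A B : compact A -> compact B -> compact (join_seg A B).
Proof.
move=> cA cB; apply: continuous_compact.
  apply: continuous_subspaceT => z.
  apply: cvgD; apply: cvgZ.
  - exact: cvg_fst.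
  - by apply: (cvg_comp snd fst); [exact: cvg_snd|exact: cvg_fst].
  - by apply: cvgB; [exact: cvg_cst|exact: cvg_fst].
  - by apply: (cvg_comp snd snd); exact: cvg_snd.
by apply: compact_setX; [exact: segment_compact|exact: compact_setX].
Qed.

Lemma join_seg_hull A B K : A `<=` hull K -> B `<=` hull K ->
  join_seg A B `<=` hull K.
Proof.
move=> hA hB _ [[t [x y]] /= [t01 [Ax By]] <-].
apply: convex2_hull; [exact: hA|exact: hB|].
by move: t01; rewrite /= in_itv.
Qed.

(** A combination of three points is two nested segments once the last two weights are renormalised
    by [1 - a]. Combined with Carathéodory's theorem this exhibits the hull as an iterated join. *)
Lemma hull_join_seg K : hull K = join_seg K (join_seg K K).
Proof.
apply/seteqP; split; last first.
  by do 2 (apply: join_seg_hull; first exact: sub_hull); exact: sub_hull.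
have Kcomb : K `<=` comb_pts 3 K.
  move=> x Kx; exists (fun i => (i == 0)%:R), (fun=> x); split => //.
  - by rewrite !big_ord_recl big_ord0/= !addr0.
  - by rewrite !big_ord_recl big_ord0/= scale1r !scale0r !addr0.
apply: (@subset_trans _ (comb_pts 3 K)).
  by apply: hull_sub => //; exact: comb_pts_convex.
move=> _ [l [p [l0 l1 Kp ->]]].
rewrite !big_ord_recl !big_ord0 !addr0 in l1 *.
set i0 := ord0; set i1 := lift _ _; set i2 := lift _ _.
have := l0 i0; have := l0 i1; have := l0 i2; rewrite -/i0 -/i1 -/i2 in l1.
move: l1; set a := l i0; set b := l i1; set c := l i2 => l1 c0 b0 a0.
(* For [a = 1] the renormalisation would divide by 0; all the weight then lies on the first
   point. *)
have [a1|a1] := eqVneq a 1.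
  have [-> ->] : b = 0 /\ c = 0 by split; lra.
  exists (1, (p i0, p i0)) => /=; last by rewrite a1 subrr !scale0r !addr0.
  split; first by rewrite /= in_itv/= ler01 lexx.
  split => //; exists (1, (p i0, p i0)) => /=.
    by split; [rewrite /= in_itv/= ler01 lexx|].
  by rewrite subrr scale0r addr0 scale1r.
have a1' : 0 < 1 - a by rewrite subr_gt0 lt_neqAle a1/=; lra.
exists (a, (p i0, (b / (1 - a)) *: p i1 + (1 - b / (1 - a)) *: p i2)) => /=.
  split; first by rewrite /= in_itv/= a0/=; lra.
  split => //; exists (b / (1 - a), (p i1, p i2)) => //.
  split => //=; rewrite in_itv/= divr_ge0// ?(ltW a1')//=.
  by rewrite ler_pdivrMr//; lra.
rewrite scalerDr !scalerA; congr (_ + (_ *: _ + _ *: _)).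
  by rewrite mulrC divfK// gt_eqF.
by rewrite mulrBr mulr1 mulrC divfK ?gt_eqF//; lra.
Qed.

Lemma compact_hull K : compact K -> compact (hull K).
Proof. by move=> cK; rewrite hull_join_seg; do 2 apply: compact_join_seg => //. Qed.

Lemma K20_hull K : compact K -> K (0, 0) -> K20 (hull K).
Proof.
move=> cK K0; split; [exact: compact_hull|exact: convex2_hull|exact: sub_hull].
Qed.

End Caratheodory.

(** * The Hausdorff distance as a metric on [K20] *)

Section HausdorffDistance.
Context {R : realType}.
Implicit Types (x y z : R * R) (A B C K : set (R * R)).

Lemma K20_bounded A : K20 A -> exists M, forall x, A x -> enorm x <= M.
Proof.
move=> [/compact_bounded[M [_ hM]] _ _].
exists (2 * (M + 1)) => x Ax; rewrite (le_trans (enorm_le_norm _))//.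
by rewrite ler_wpM2l//; apply: (hM (M + 1)) => //; rewrite ltrDl.
Qed.

Lemma K20_nonempty A : K20 A -> A !=set0. Proof. by move=> [_ _ A0]; exists (0, 0). Qed.

Lemma dist_to_le x A y : A y -> dist_to x A <= enorm (x - y).
Proof.
move=> Ay; apply: ge_inf; last by exists y.
by exists 0 => _ [z _ <-]; exact: enorm_ge0.
Qed.

Lemma dist_to_ge x A c : A !=set0 -> (forall y, A y -> c <= enorm (x - y)) ->
  c <= dist_to x A.
Proof.
move=> [y Ay] h; apply: lb_le_inf; first by exists (enorm (x - y)), y.
by move=> _ [z Az <-]; exact: h.
Qed.

Lemma dist_to_ge0 x A : A !=set0 -> 0 <= dist_to x A.
Proof. by move=> A0; apply: dist_to_ge => // y _; exact: enorm_ge0. Qed.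

Lemma dist_to_lip x y A : A !=set0 -> dist_to x A <= enorm (x - y) + dist_to y A.
Proof.
move=> A0; rewrite -lerBlDl; apply: dist_to_ge => // z Az.
rewrite lerBlDl (le_trans (dist_to_le _ Az))//; exact: enormDB.
Qed.

Let exc A B := sup [set dist_to x A | x in B].

(** Boundedness of [B] makes [exc] a genuine least upper bound, since [sup] of an unbounded set is 0
    by default. *)
Let le_exc A B x : K20 A -> K20 B -> B x -> dist_to x A <= exc A B.
Proof.
move=> [_ _ A0] /K20_bounded[M hM] Bx; apply: ub_le_sup; last by exists x.
exists M => _ [y By <-]; rewrite (le_trans (dist_to_le _ A0))//.
by rewrite -[(0, 0)]/(0 : R * R) subr0 hM.
Qed.

Let exc_le A B c : B !=set0 -> (forall x, B x -> dist_to x A <= c) -> exc A B <= c.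
Proof.
move=> [x Bx] h; apply: ge_sup; first by exists (dist_to x A), x.
by move=> _ [y By <-]; exact: h.
Qed.

Lemma rhoH_sym A B : rhoH A B = rhoH B A.
Proof. exact: maxC. Qed.

Lemma rhoH_le A B c : A !=set0 -> B !=set0 ->
  (forall x, A x -> exists2 y, B y & enorm (x - y) <= c) ->
  (forall y, B y -> exists2 x, A x & enorm (x - y) <= c) -> rhoH A B <= c.
Proof.
move=> A0 B0 hA hB; rewrite /rhoH ge_max; apply/andP; split; apply: exc_le => // x.
  by move=> /hB[y Ay xy]; rewrite (le_trans (dist_to_le _ Ay))// enormC.
by move=> /hA[y By xy]; rewrite (le_trans (dist_to_le _ By)).
Qed.

Lemma rhoH_ge0 A B : K20 A -> K20 B -> 0 <= rhoH A B.
Proof.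
move=> kA kB; rewrite /rhoH le_max; apply/orP; left.
have [_ _ B0] := kB; apply: le_trans (le_exc kA kB B0).
exact/dist_to_ge0/K20_nonempty.
Qed.

Lemma rhoH_xx A : K20 A -> rhoH A A = 0.
Proof.
move=> kA; apply/eqP; rewrite eq_le rhoH_ge0// andbT.
by apply: rhoH_le; try exact: K20_nonempty; move=> x Ax; exists x => //;
  rewrite subrr enorm0.
Qed.

Let exc_triangle A B C : K20 A -> K20 B -> K20 C ->
  exc A C <= exc A B + exc B C.
Proof.
move=> kA kB kC; apply: exc_le; first exact: K20_nonempty.
move=> x Cx; rewrite addrC; apply: (@le_trans _ _ (dist_to x B + exc A B)).
  rewrite -lerBlDr; apply: dist_to_ge; first exact: K20_nonempty.
  move=> y By; rewrite lerBlDr (le_trans (dist_to_lip x y (K20_nonempty kA)))//.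
  by rewrite lerD2l le_exc.
by rewrite lerD2r le_exc.
Qed.

Lemma rhoH_triangle A B C : K20 A -> K20 B -> K20 C ->
  rhoH A C <= rhoH A B + rhoH B C.
Proof.
move=> kA kB kC; rewrite [leLHS]/rhoH ge_max; apply/andP; split.
  rewrite (le_trans (exc_triangle kA kB kC))// lerD// /rhoH le_max lexx ?orbT//.
rewrite (le_trans (exc_triangle kC kB kA))// addrC lerD// /rhoH le_max lexx ?orbT//.
Qed.

(* The closed [c]-neighbourhood of a convex set is convex. *)
Lemma near_hull A B c : 0 <= c ->
  (forall x, A x -> exists2 y, B y & enorm (x - y) <= c) ->
  forall x, hull A x -> exists2 y, hull B y & enorm (x - y) <= c.
Proof.
move=> c0 h x hx.
apply: (hx [set x | exists2 y, hull B y & enorm (x - y) <= c]); last first.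
  by move=> z /h[y By zy]; exists y => //; exact: sub_hull.
move=> u v t [u' hu uu'] [v' hv vv'] t01.
exists (t *: u' + (1 - t) *: v'); first exact: (convex2_hull hu hv t01).
have /andP[t0 t1] := t01.
rewrite -[padd _ _]/(t *: u + (1 - t) *: v) opprD addrACA -!scalerBr.
rewrite (le_trans (enormD _ _))// !enormZ ger0_norm// ger0_norm ?subr_ge0//.
rewrite [leRHS](_ : c = t * c + (1 - t) * c); last ring.
by rewrite lerD// ler_wpM2l// subr_ge0.
Qed.

(** Taking hulls does not increase the distance, so that every later estimate compares generating
    points only. *)
Lemma rhoH_hull A B c : 0 <= c -> A !=set0 -> B !=set0 ->
  (forall x, A x -> exists2 y, B y & enorm (x - y) <= c) ->
  (forall y, B y -> exists2 x, A x & enorm (x - y) <= c) ->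
  rhoH (hull A) (hull B) <= c.
Proof.
move=> c0 [a Aa] [b Bb] hA hB; apply: rhoH_le.
- by exists a; exact: sub_hull.
- by exists b; exact: sub_hull.
- exact: near_hull.
- move=> y hy; have [|x hx xy] := near_hull c0 _ hy (B := A).
    by move=> z /hB[x Ax xz]; exists x => //; rewrite enormC.
  by exists x => //; rewrite enormC.
Qed.

End HausdorffDistance.

(** * Lipschitz envelopes of bounded continuous functions *)

Section LipschitzEnvelope.
Context {R : realType}.
Implicit Types (A B C K : set (R * R)) (f : set (R * R) -> R).

Definition lip_K20 (M L : R) f := (forall A, K20 A -> `|f A| <= M) /\
  (forall A B, K20 A -> K20 B -> `|f A - f B| <= L * rhoH A B).

(** The Pasch-Hausdorff envelope of [f] on the metric space [K20]. *)
Definition envelope f (n : nat) A :=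
  inf [set f B + n%:R * rhoH A B | B in K20].

Variables (f : set (R * R) -> R) (M : R).
Hypothesis fM : forall A, K20 A -> `|f A| <= M.

(** Keeps the infimum in [envelope] over a nonempty set. *)
Let K20_0 : K20 (set1 ((0, 0) : R * R)).
Proof.
split => //; first exact: compact_set1.
move=> x y t -> -> _; rewrite -[padd _ _]/(t *: 0 + (1 - t) *: (0 : R * R)).
by rewrite !scaler0 addr0.
Qed.

Lemma envelope_le n A B : K20 A -> K20 B ->
  envelope f n A <= f B + n%:R * rhoH A B.
Proof.
move=> kA kB; apply: ge_inf; last by exists B.
exists (- M) => _ [C kC <-]; have /ler_normlP[h _] := fM kC.
by rewrite (@le_trans _ _ (f C))// ?lerDl ?mulr_ge0 ?rhoH_ge0//; lra.
Qed.

Lemma envelope_ge n A c : (forall B, K20 B -> c <= f B + n%:R * rhoH A B) ->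
  c <= envelope f n A.
Proof.
move=> h; apply: lb_le_inf; last by move=> _ [C kC <-]; exact: h.
by eexists; exists (set1 ((0, 0) : R * R)).
Qed.

Lemma envelope_le_f n A : K20 A -> envelope f n A <= f A.
Proof. by move=> kA; rewrite (le_trans (envelope_le n kA kA))// rhoH_xx// mulr0 addr0. Qed.

Lemma envelope_bound n A : K20 A -> `|envelope f n A| <= M.
Proof.
move=> kA; rewrite ler_norml; apply/andP; split.
  apply: envelope_ge => B kB; have /ler_normlP[h _] := fM kB.
  by rewrite (@le_trans _ _ (f B))// ?lerDl ?mulr_ge0 ?rhoH_ge0//; lra.
have /ler_normlP[_ h] := fM kA; exact: le_trans (envelope_le_f n kA) h.
Qed.

Lemma envelope_lip n : lip_K20 M n%:R (envelope f n).
Proof.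
split; first by move=> A; exact: envelope_bound.
suff h A B : K20 A -> K20 B -> envelope f n A - envelope f n B <= n%:R * rhoH A B.
  move=> A B kA kB; rewrite ler_norml; apply/andP; split; last exact: h.
  by rewrite lerNl opprB rhoH_sym; exact: h.
move=> kA kB; rewrite lerBlDr -lerBlDl; apply: envelope_ge => C kC.
rewrite lerBlDl (le_trans (envelope_le n kA kC))//.
rewrite addrCA lerD2l -mulrDr ler_wpM2l//; exact: rhoH_triangle.
Qed.

Lemma envelope_cvg A : K20 A ->
  (forall e, 0 < e -> exists2 del, 0 < del &
     forall B, K20 B -> rhoH A B < del -> `|f A - f B| < e) ->
  envelope f n A @[n --> \oo] --> f A.
Proof.
move=> kA cf; apply/cvgrPdist_le => e e0.
have [del del0 h] := cf e e0.
near=> n; rewrite ler_norml; apply/andP; split.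
  by rewrite lerNl opprB (le_trans _ (ltW e0))// subr_le0 envelope_le_f.
rewrite lerBlDr -lerBlDl; apply: envelope_ge => B kB.
have [AB|AB] := ltP (rhoH A B) del.
  have := h _ kB AB; rewrite ltr_norml => /andP[_ fAB].
  rewrite (@le_trans _ _ (f B))// ?lerDl ?mulr_ge0 ?rhoH_ge0//; lra.
have /ler_normlP[h1 _] := fM kB; have /ler_normlP[_ h2] := fM kA.
(* Far from [A] the penalty alone exceeds the oscillation [2 * M] of [f], as soon as
   [n >= 2 * M / del]. *)
have : 2 * M <= n%:R * rhoH A B.
  rewrite (@le_trans _ _ (n%:R * del))//; last by rewrite ler_wpM2l.
  by rewrite -ler_pdivrMr//; near: n; exact: nbhs_infty_ger.
lra.
Unshelve. all: by end_near. Qed.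

End LipschitzEnvelope.

(** * Expectations and independence *)

Section Expectation.
Context {R : realType} d (T : measurableType d) (P : probability T R).
Implicit Types (f g : T -> R).

Definition intg f := P.-integrable setT (EFin \o f).

Lemma intg_measurable f : intg f -> measurable_fun setT f.
Proof. by move=> /measurable_int/measurable_EFinP. Qed.

Lemma intg_cst c : intg (cst c).
Proof. exact: finite_measure_integrable_cst. Qed.

Lemma intg_le f g : measurable_fun setT f -> (forall w, `|f w| <= g w) ->
  intg g -> intg f.
Proof.
move=> mf fg; apply: le_integrable => //; first exact/measurable_EFinP.
by move=> w _ /=; rewrite lee_fin (le_trans (fg w))// ler_norm.
Qed.

Lemma intg_bdd f M : measurable_fun setT f -> (forall w, `|f w| <= M) -> intg f.
Proof. by move=> mf fM; apply: (intg_le mf fM); exact: intg_cst. Qed.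

Lemma intgD f g : intg f -> intg g -> intg (fun w => f w + g w).
Proof. by move=> hf hg; apply: eq_integrable (integrableD measurableT hf hg). Qed.

Lemma intgZ c f : intg f -> intg (fun w => c * f w).
Proof. by move=> hf; apply: eq_integrable (integrableZl measurableT c hf). Qed.

Lemma intgB f g : intg f -> intg g -> intg (fun w => f w - g w).
Proof. by move=> hf hg; apply: eq_integrable (integrableB measurableT hf hg). Qed.

Lemma intg_norm f : intg f -> intg (fun w => `|f w|).
Proof. exact: integrable_norm. Qed.

Lemma intg_sum I (r : seq I) (h : I -> T -> R) : (forall i, intg (h i)) ->
  intg (fun w => \sum_(i <- r) h i w).
Proof.
move=> hh; elim: r => [|i r ih].
  by apply: eq_integrable (intg_cst 0) => // w _ /=; rewrite big_nil.
by apply: eq_integrable (intgD (hh i) ih) => // w _ /=; rewrite big_cons.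
Qed.

Lemma Ex_cst c : \int[P]_w c = c.
Proof.
transitivity (c * fine (P setT)); first exact: (Rintegral_cst P measurableT).
by rewrite probability_setT mulr1.
Qed.

Lemma ExD f g : intg f -> intg g ->
  \int[P]_w (f w + g w) = \int[P]_w f w + \int[P]_w g w.
Proof. exact: RintegralD. Qed.

Lemma ExB f g : intg f -> intg g ->
  \int[P]_w (f w - g w) = \int[P]_w f w - \int[P]_w g w.
Proof. exact: RintegralB. Qed.

Lemma ExZ c f : intg f -> \int[P]_w (c * f w) = c * \int[P]_w f w.
Proof. exact: RintegralZl. Qed.

Lemma Ex_sum I (r : seq I) (h : I -> T -> R) : (forall i, intg (h i)) ->
  \int[P]_w (\sum_(i <- r) h i w) = \sum_(i <- r) \int[P]_w h i w.
Proof.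
move=> hh; elim: r => [|i r ih].
  by rewrite big_nil -[RHS](Ex_cst 0); apply: eq_Rintegral => w _; rewrite big_nil.
rewrite big_cons -ih -ExD//; last exact: intg_sum.
by apply: eq_Rintegral => w _; rewrite big_cons.
Qed.

Lemma Ex_le f g : intg f -> intg g -> (forall w, f w <= g w) ->
  \int[P]_w f w <= \int[P]_w g w.
Proof. by move=> hf hg fg; apply: le_Rintegral. Qed.

Lemma Ex_norm_le f g : intg f -> intg g -> (forall w, `|f w| <= g w) ->
  `|\int[P]_w f w| <= \int[P]_w g w.
Proof.
move=> hf hg fg; apply: le_trans (le_normr_Rintegral _ hf) _ => //.
by apply: Ex_le => //; exact: intg_norm.
Qed.

Lemma Ex_bdd f M : measurable_fun setT f -> (forall w, `|f w| <= M) ->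
  `|\int[P]_w f w| <= M.
Proof.
move=> mf fM; rewrite -[leRHS]Ex_cst; apply: Ex_norm_le => //.
  exact: intg_bdd fM.
exact: intg_cst.
Qed.

Lemma Ex_close f g M e : measurable_fun setT f -> measurable_fun setT g ->
  (forall w, `|f w| <= M) -> (forall w, `|g w| <= M) ->
  (forall w, `|f w - g w| <= e) -> `|\int[P]_w f w - \int[P]_w g w| <= e.
Proof.
move=> mf mg fM gM fg; rewrite -ExB; [|exact: intg_bdd fM|exact: intg_bdd gM].
by apply: Ex_bdd => //; exact: measurable_funB.
Qed.

Lemma EFin_Ex f : intg f -> (\int[P]_w (f w)%:E)%E = (\int[P]_w f w)%:E.
Proof. by move=> hf; rewrite fineK//; exact: integrable_fin_num. Qed.

Lemma Ex_dct (h : nat -> T -> R) f g : (forall n, measurable_fun setT (h n)) ->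
  (forall w, h n w @[n --> \oo] --> f w) ->
  (forall n w, `|h n w| <= g w) -> intg g ->
  (\int[P]_w h n w) @[n --> \oo] --> \int[P]_w f w.
Proof.
move=> mh hf hg ig.
have mf : measurable_fun setT f.
  by apply: (measurable_fun_cvg (h := h)) => // w _; exact: hf.
have [|||||ifE _ cv] := @dominated_convergence _ _ _ P setT measurableT
  (fun n => EFin \o h n) (EFin \o f) (EFin \o g).
- by move=> n; exact/measurable_EFinP.
- exact/measurable_EFinP.
- by apply: aeW => w _ /=; apply: cvg_EFin; [exact: nearW|exact: (hf w)].
- exact: ig.
- by apply: aeW => w n _ /=; rewrite lee_fin.
by apply: fine_cvg; rewrite -EFin_Ex.
Qed.

Lemma Ex_indic (A : set T) : measurable A -> \int[P]_w (\1_A w) = fine (P A).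
Proof. by move=> mA; rewrite /Rintegral integral_indic// setIT. Qed.

Lemma intg_indic (A : set T) : measurable A -> intg \1_A.
Proof.
by move=> mA; apply: (@intg_bdd _ 1) => // w; rewrite indicE; case: (_ \in _);
  rewrite ?normr1 ?normr0.
Qed.

Lemma pr_ge0 (A : set T) : 0 <= fine (P A). Proof. exact: fine_ge0. Qed.

Lemma EFin_pr (A : set T) : measurable A -> (fine (P A))%:E = P A.
Proof. by move=> mA; rewrite fineK// fin_num_measure. Qed.

Lemma pr_le (A B : set T) : measurable A -> measurable B -> A `<=` B ->
  fine (P A) <= fine (P B).
Proof.
move=> mA mB AB; rewrite fine_le ?fin_num_measure//.
by apply: le_measure => //; rewrite inE.
Qed.

Lemma pr_bigcup_ord n (A : nat -> set T) : (forall i, measurable (A i)) ->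
  fine (P (\bigcup_(i < n) A i)) <= \sum_(i < n) fine (P (A i)).
Proof.
move=> mA; elim: n => [|n ih].
  by rewrite bigcup_mkord big_ord0 measure0 big_ord0.
rewrite big_ord_recr/= bigcup_mkord big_ord_recr/= -bigcup_mkord.
have mU : measurable (\bigcup_(i < n) A i) by apply: bigcup_measurable.
rewrite (le_trans _ (lerD ih (lexx _)))// -lee_fin EFinD.
rewrite !fineK ?fin_num_measure//; last exact: measurableU.
exact: measureU2.
Qed.

Lemma pr_markov f c : intg f -> (forall w, 0 <= f w) ->
  c * fine (P [set w | c <= f w]) <= \int[P]_w f w.
Proof.
move=> hf f0.
have mA : measurable [set w | c <= f w].
  rewrite -[X in measurable X]setTI -preimage_itvcy.
  by apply: (intg_measurable hf) => //; exact: measurable_itv.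
rewrite -Ex_indic// -ExZ; last exact: intg_indic.
apply: Ex_le => //; first by apply: intgZ; exact: intg_indic.
move=> w; rewrite indicE; case: (boolP (w \in _)) => /=; rewrite ?mulr1 ?mulr0//.
by rewrite inE.
Qed.

End Expectation.

(** * Expectations depend on the law only *)

Section Law.
Context {R : realType} d (T : measurableType d) (P : probability T R)
  d' (T' : measurableType d') (Q : probability T' R)
  d1 (U : measurableType d1) (X : T -> U) (Y : T' -> U).
Hypotheses (mX : measurable_fun setT X) (mY : measurable_fun setT Y).
Hypothesis XY : forall A, measurable A -> P (X @^-1` A) = Q (Y @^-1` A).

Lemma ge0_eq_law (g : U -> \bar R) : measurable_fun setT g -> (forall u, 0 <= g u)%E ->
  (\int[P]_w g (X w) = \int[Q]_w g (Y w))%E.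
Proof.
move=> mg g0.
have := ge0_integral_pushforward mX P measurableT (measurable_funTS mg) (fun u _ => g0 u).
have := ge0_integral_pushforward mY Q measurableT (measurable_funTS mg) (fun u _ => g0 u).
rewrite !preimage_setT => <- <-.
by apply: eq_measure_integral => A mA _; exact: XY.
Qed.

Lemma intg_eq_law (g : U -> R) : measurable_fun setT g ->
  intg P (g \o X) -> intg Q (g \o Y).
Proof.
move=> mg /integrableP[_ h]; apply/integrableP; split.
  by apply/measurable_EFinP; exact: measurableT_comp.
rewrite -(@ge0_eq_law (fun u => `|(g u)%:E|)%E)//.
by do 2 apply: measurableT_comp => //.
Qed.

(** Positive and negative parts transfer separately in the extended reals, and [fine] is then
    applied to equal values. *)
Lemma Ex_eq_law (g : U -> R) : measurable_fun setT g ->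
  \int[P]_w g (X w) = \int[Q]_w g (Y w).
Proof.
move=> mg; rewrite /Rintegral; congr fine.
rewrite [LHS]integralE [RHS]integralE.
have mg' : measurable_fun setT (EFin \o g) by exact/measurable_EFinP.
have Hp := ge0_eq_law (measurable_funepos mg') (fun u => funepos_ge0 _ u).
have Hn := ge0_eq_law (measurable_funeneg mg') (fun u => funeneg_ge0 _ u).
rewrite -[fun w => (g (X w))%:E]/((EFin \o g) \o X) (funepos_comp _ X) (funeneg_comp _ X).
rewrite -[fun w => (g (Y w))%:E]/((EFin \o g) \o Y) (funepos_comp _ Y) (funeneg_comp _ Y).
by congr (_ - _)%E; [exact: Hp|exact: Hn].
Qed.

End Law.

Section ProductExpectation.
Context {R : realType} d1 d2 (T1 : measurableType d1) (T2 : measurableType d2)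
  (P1 : probability T1 R) (P2 : probability T2 R).

Section Bounded.
Variables (F : T1 * T2 -> R) (M : R).
Hypotheses (mF : measurable_fun setT F) (FM : forall z, `|F z| <= M).

Let iF : (P1 \x P2)%E.-integrable setT (EFin \o F).
Proof. by have := @intg_bdd R _ _ (P1 \x P2)%E F M mF FM. Qed.

Let inner1 x : (\int[P2]_y (EFin \o F) (x, y))%E = (\int[P2]_y F (x, y))%:E.
Proof.
rewrite EFin_Ex//; apply: (@intg_bdd _ _ _ _ _ M) => //.
exact: measurableT_comp.
Qed.

Let inner2 y : (\int[P1]_x (EFin \o F) (x, y))%E = (\int[P1]_x F (x, y))%:E.
Proof.
rewrite EFin_Ex//; apply: (@intg_bdd _ _ _ _ _ M) => //.
exact: measurableT_comp.
Qed.

Lemma Ex_prod12 : \int[(P1 \x P2)%E]_z F z = \int[P1]_x \int[P2]_y F (x, y).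
Proof.
rewrite /Rintegral -(integral12_prod_meas1 iF); congr fine.
by apply: eq_integral => x _; exact: inner1.
Qed.

Lemma Ex_fubini :
  \int[P1]_x \int[P2]_y F (x, y) = \int[P2]_y \int[P1]_x F (x, y).
Proof.
rewrite -Ex_prod12 /Rintegral -(integral21_prod_meas1 iF); congr fine.
by apply: eq_integral => x _; exact: inner2.
Qed.

Lemma measurable_Ex2 : measurable_fun setT (fun x => \int[P2]_y F (x, y)).
Proof.
apply/measurable_EFinP.
have := measurable_fubini_F iF.
by apply: eq_measurable_fun => x _; exact: inner1.
Qed.

End Bounded.

(** Moments are expectations of unbounded products, outside the bounded case above. Tonelli's
    theorem for the absolute values gives integrability before Fubini's theorem is applied. *)
Lemma Ex_prodM (f : T1 -> R) (g : T2 -> R) : intg P1 f -> intg P2 g ->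
  intg (P1 \x P2)%E (fun z => f z.1 * g z.2) /\
  \int[(P1 \x P2)%E]_z (f z.1 * g z.2) = \int[P1]_x f x * \int[P2]_y g y.
Proof.
move=> hf hg.
have mf := intg_measurable hf; have mg := intg_measurable hg.
have i12 : intg (P1 \x P2)%E (fun z => f z.1 * g z.2).
  apply/integrable12ltyP.
    apply/measurable_EFinP/measurable_funM; exact: measurableT_comp.
  have E x : (\int[P2]_y `|(f x * g y)%:E| = (`|f x| * \int[P2]_y `|g y|)%:E)%E.
    rewrite EFinM -EFin_Ex; last exact: intg_norm.
    rewrite -integralZl//; last exact: intg_norm.
    by apply: eq_integral => y _; rewrite /= normrM EFinM.
  under eq_integral do rewrite E mulrC.
  have := intgZ (\int[P2]_y `|g y|) (intg_norm hf).
  by move=> /(integrable_lty measurableT).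
split => //.
rewrite {1}/Rintegral -(integral12_prod_meas1 i12).
transitivity (fine (\int[P1]_x ((\int[P2]_y g y) * f x)%:E)%E).
  congr fine; apply: eq_integral => x _; rewrite /fubini_F/= mulrC -ExZ//.
  by rewrite EFin_Ex//; exact: intgZ.
by rewrite mulrC -ExZ.
Qed.

End ProductExpectation.

(** * Independence of two random variables *)

Section Independence.
Context {R : realType} d (T : measurableType d) (P : probability T R).

Definition indep d1 d2 (U : measurableType d1) (V : measurableType d2)
    (X : T -> U) (Y : T -> V) :=
  forall A B, measurable A -> measurable B ->
    P (X @^-1` A `&` Y @^-1` B) = (P (X @^-1` A) * P (Y @^-1` B))%E.

Section Pair.
Context d1 d2 (U : measurableType d1) (V : measurableType d2)
  (X : T -> U) (Y : T -> V).
Hypotheses (mX : measurable_fun setT X) (mY : measurable_fun setT Y)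
  (XY : indep X Y).

Let XmY (z : T * T) := (X z.1, Y z.2).
Let mXY : measurable_fun setT (fun w => (X w, Y w)).
Proof. exact: measurable_fun_pair. Qed.
Let mXmY : measurable_fun setT XmY.
Proof. by apply: measurable_fun_pair; exact: measurableT_comp. Qed.

(** The law of [(X, Y)] under [P] and that of [XmY] under [P \x P] both give a rectangle the product
    of the marginal probabilities, so both are the product measure. Independence thereby becomes
    integration over [T * T]. *)
Lemma indep_law C : measurable C ->
  P ((fun w => (X w, Y w)) @^-1` C) = (P \x P)%E (XmY @^-1` C).
Proof.
move=> mC.
pose X' : {mfun T >-> U} := HB.pack X (isMeasurableFun.Build _ _ _ _ X mX).
pose Y' : {mfun T >-> V} := HB.pack Y (isMeasurableFun.Build _ _ _ _ Y mY).
pose XY' : {mfun T >-> (U * V)%type} :=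
  HB.pack (fun w => (X w, Y w)) (isMeasurableFun.Build _ _ _ _ _ mXY).
pose XmY' : {mfun (T * T)%type >-> (U * V)%type} :=
  HB.pack XmY (isMeasurableFun.Build _ _ _ _ _ mXmY).
transitivity ((distribution P X' \x distribution P Y')%E C).
  symmetry; apply: (product_measure_unique
    (m' := distribution P XY')) => // A B mA mB.
apply: (product_measure_unique
  (m' := distribution (P \x P)%E XmY')) => // A B mA mB.
have mXA : measurable (X @^-1` A) by rewrite -[X @^-1` _]setTI; exact: mX.
have mYB : measurable (Y @^-1` B) by rewrite -[Y @^-1` _]setTI; exact: mY.
exact: (product_measure1E P P mXA mYB).
Qed.

Lemma indep_Ex (F : U * V -> R) M : measurable_fun setT F ->
  (forall z, `|F z| <= M) ->
  \int[P]_w F (X w, Y w) = \int[P]_w \int[P]_w' F (X w, Y w').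
Proof.
move=> mF FM.
rewrite (@Ex_eq_law _ _ _ P _ _ (P \x P)%E _ _ _ XmY mXY mXmY indep_law _ mF).
by rewrite (@Ex_prod12 _ _ _ _ _ _ _ _ M)//; exact: measurableT_comp.
Qed.

End Pair.

Lemma indep_mul (X Y : T -> R) : intg P X -> intg P Y -> indep X Y ->
  intg P (fun w => X w * Y w) /\
  \int[P]_w (X w * Y w) = \int[P]_w X w * \int[P]_w Y w.
Proof.
move=> iX iY XY; have mX := intg_measurable iX; have mY := intg_measurable iY.
have [i2 E2] := Ex_prodM iX iY.
have mM : measurable_fun setT (fun z : R * R => z.1 * z.2).
  by apply: measurable_funM; [exact: measurable_fst|exact: measurable_snd].
have mXY : measurable_fun setT (fun w => (X w, Y w)) by exact: measurable_fun_pair.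
have mXmY : measurable_fun setT (fun z : T * T => (X z.1, Y z.2)).
  by apply: measurable_fun_pair; exact: measurableT_comp.
split.
  apply: (@intg_eq_law _ _ _ (P \x P)%E _ _ P _ _ _ _ mXmY mXY _ _ mM i2).
  by move=> A mA; apply: esym; exact: (indep_law mX mY XY mA).
rewrite -E2; exact: (@Ex_eq_law _ _ _ P _ _ (P \x P)%E _ _ _ _ mXY mXmY
  (indep_law mX mY XY) _ mM).
Qed.

Lemma indep_comp d1 d2 d3 d4 (U : measurableType d1) (V : measurableType d2)
    (U' : measurableType d3) (V' : measurableType d4)
    (X : T -> U) (Y : T -> V) (f : U -> U') (g : V -> V') :
  measurable_fun setT f -> measurable_fun setT g ->
  indep X Y -> indep (f \o X) (g \o Y).
Proof.
move=> mf mg XY A B mA mB; apply: (XY (f @^-1` A) (g @^-1` B)).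
  by rewrite -[_ @^-1` _]setTI; exact: mf.
by rewrite -[_ @^-1` _]setTI; exact: mg.
Qed.

End Independence.

(** * Independence of sigma-algebras generated by disjoint sets of indices *)

Section IndependentSequence.
Context {R : realType} d (T : measurableType d) (P : probability T R)
  d1 (U : measurableType d1).
Implicit Types (X : nat -> T -> U) (A : nat -> set U) (I J : pred nat).

(** The product formula over all indices below [n] contains those for subfamilies, by taking
    [A i = setT] outside the subfamily. *)
Definition indepn (n : nat) X := (forall i, measurable_fun setT (X i)) /\
  forall A, (forall i, measurable (A i)) ->
    P (\bigcap_(i in [set i | (i < n)%N]) X i @^-1` A i) =
    (\prod_(i < n) P (X i @^-1` A i))%E.

(** A pi-system that generates the sigma-algebra of the [X i] with [i < n] and [I i]. *)
Definition cylinders n X I : set (set T) :=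
  [set C | exists A, [/\ forall i, measurable (A i),
     forall i, ~~ I i -> A i = setT &
     C = \bigcap_(i in [set i | (i < n)%N]) X i @^-1` A i]].

Lemma cylinders_measurable n X I : (forall i, measurable_fun setT (X i)) ->
  cylinders n X I `<=` measurable.
Proof.
move=> mX _ [A [mA _ ->]]; apply: bigcap_measurableType.
by move=> i _; rewrite -[_ @^-1` _]setTI; exact: mX.
Qed.

Lemma cylindersT n X I : cylinders n X I setT.
Proof.
exists (fun=> setT); split => //.
by rewrite bigcapT.
Qed.

Lemma cylindersI n X I : setI_closed (cylinders n X I).
Proof.
move=> _ _ [A [mA IA ->]] [B [mB IB ->]].
exists (fun i => A i `&` B i); split.
- by move=> i; exact: measurableI.
- by move=> i ni; rewrite IA// IB// setIT.
- by rewrite -bigcapI; apply: eq_bigcapr => i _.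
Qed.

Lemma indep_cylinders n X I J C D : indepn n X -> (forall i, ~~ (I i && J i)) ->
  cylinders n X I C -> cylinders n X J D -> P (C `&` D) = (P C * P D)%E.
Proof.
move=> [mX iX] IJ [A [mA IA ->]] [B [mB JB ->]].
transitivity (P (\bigcap_(i in [set i | (i < n)%N]) X i @^-1` (A i `&` B i))).
  by congr (P _); rewrite -bigcapI; apply: eq_bigcapr => i _.
rewrite !iX//; last by move=> i; exact: measurableI.
rewrite -big_split/=; apply: eq_bigr => i _.
have [Ii|Ii] := boolP (I i).
  rewrite JB ?setIT ?preimage_setT ?probability_setT ?mule1//.
  by have := IJ i; rewrite Ii.
by rewrite IA// setTI preimage_setT probability_setT mul1e.
Qed.

(** For a fixed [D], the finite measures sending [C] to [P (C & D)] and to [P C * P D] agree on the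
    pi-system, hence on the sigma-algebra that it generates. The argument is run once for each of
    the two events. *)
Lemma indep_sigma (G H : set (set T)) : G `<=` measurable -> H `<=` measurable ->
  setI_closed G -> setI_closed H -> G setT -> H setT ->
  (forall C D, G C -> H D -> P (C `&` D) = (P C * P D)%E) ->
  forall C D, <<s G >> C -> <<s H >> D -> P (C `&` D) = (P C * P D)%E.
Proof.
move=> mG mH GI HI GT HT GH.
have sG := smallest_sub (@sigma_algebra_measurable _ T) mG.
have sH := smallest_sub (@sigma_algebra_measurable _ T) mH.
have step (G1 : set (set T)) D : G1 `<=` measurable -> setI_closed G1 -> G1 setT ->
    measurable D ->
    (forall C, G1 C -> P (C `&` D) = (P C * P D)%E) ->
    forall C, <<s G1 >> C -> P (C `&` D) = (P C * P D)%E.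
  move=> mG1 G1I G1T mD h C sC.
  have p0 : 0 <= fine (P D) by exact: pr_ge0.
  rewrite muleC -(EFin_pr P mD).
  have cover : \bigcup_(k in [set: nat]) (setT : set T) = setT.
    by apply/seteqP; split => // w _; exists 0%N.
  apply: (g_sigma_algebra_measure_unique G1 mG1 (fun=> setT)
    (fun=> G1T) cover (mrestr P mD) (mscale (NngNum p0) P)) => //.
    move=> A GA; rewrite /mrestr /mscale /= [RHS]muleC; rewrite -(EFin_pr P mD) in h. exact: h.
  by move=> _; change (P (setT `&` D) < +oo)%E; rewrite setTI ltey_eq fin_num_measure.
move=> C D sC sD; apply: (step G D) => //; first exact: sH.
move=> C' GC'; rewrite setIC muleC; apply: (step H C') => //; first exact: mG.
by move=> D' HD'; rewrite setIC muleC; exact: GH.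
Qed.

(** Retyping the domain by the generated sigma-algebra lets the ordinary closure properties of
    measurable functions prove adaptedness. *)
Definition adapted n X I d2 (V : measurableType d2) (f : T -> V) :=
  measurable_fun setT (f : g_sigma_algebraType (cylinders n X I) -> V).

Lemma adaptedX n X I i : (i < n)%N -> I i -> (forall i, measurable_fun setT (X i)) ->
  adapted n X I (X i).
Proof.
move=> il Ii mX _ B mB; rewrite setTI; apply: sub_sigma_algebra.
exists (fun j => if j == i then B else setT); split.
- by move=> j; case: ifP.
- by move=> j nj; case: eqP => // ji; rewrite ji Ii in nj.
- apply/seteqP; split => [w Bw j _|w /(_ i il)]/=; last by rewrite eqxx.
  by case: eqP => // ->.
Qed.

Lemma indep_cylinders_sigma n X I J C D : indepn n X ->
  (forall i, ~~ (I i && J i)) -> <<s cylinders n X I >> C ->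
  <<s cylinders n X J >> D -> P (C `&` D) = (P C * P D)%E.
Proof.
move=> iX IJ; have [mX _] := iX; apply: indep_sigma.
- exact: cylinders_measurable.
- exact: cylinders_measurable.
- exact: cylindersI.
- exact: cylindersI.
- exact: cylindersT.
- exact: cylindersT.
- by move=> C' D' hC hD; apply: indep_cylinders hC hD.
Qed.

Lemma indep_adapted n X I J d2 d3 (V : measurableType d2) (W : measurableType d3)
    (f : T -> V) (g : T -> W) : indepn n X -> (forall i, ~~ (I i && J i)) ->
  adapted n X I f -> adapted n X J g -> indep P f g.
Proof.
move=> iX IJ af ag A B mA mB; apply: (indep_cylinders_sigma iX IJ).
- by have := af measurableT A mA; rewrite setTI.
- by have := ag measurableT B mB; rewrite setTI.
Qed.

End IndependentSequence.

(** * Moments of the normal law *)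

Section Density.
Local Open Scope ereal_scope.
Context {R : realType} d (T : measurableType d) (mu nu : {measure set T -> \bar R})
  (p : T -> R).
Hypotheses (mp : measurable_fun setT p) (p0 : forall x, (0 <= p x)%R)
  (nuE : forall A, measurable A -> nu A = \int[mu]_(x in A) (p x)%:E).
Import HBNNSimple.

Let mpE : measurable_fun setT (EFin \o p). Proof. exact/measurable_EFinP. Qed.

Let integral_density_indic A : measurable A ->
  \int[nu]_x (\1_A x)%:E = \int[mu]_x ((p x)%:E * (\1_A x)%:E).
Proof.
move=> mA; rewrite integral_indic// setIT nuE// integral_mkcond.
apply: eq_integral => x _; rewrite patchE indicE; case: ifPn => _.
  by rewrite mule1.
by rewrite mule0.
Qed.

Let integral_density_nnsfun (f : {nnsfun T >-> R}) :
  \int[nu]_x (f x)%:E = \int[mu]_x ((p x)%:E * (f x)%:E).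
Proof.
under [LHS]eq_integral do rewrite fimfunE -fsumEFin//.
rewrite [LHS]ge0_integral_fsum//; last 2 first.
  - by move=> r; exact/measurable_EFinP/measurableT_comp.
  - by move=> n x _; rewrite EFinM nnfun_muleindic_ge0.
under [RHS]eq_integral.
  move=> x _; rewrite fimfunE -fsumEFin// ge0_mule_fsumr; last first.
    by move=> r; rewrite EFinM nnfun_muleindic_ge0.
  over.
rewrite [RHS]ge0_integral_fsum//; last 2 first.
  - move=> r; apply: emeasurable_funM => //.
    exact/measurable_EFinP/measurableT_comp.
  - move=> n x _; apply: mule_ge0; first by rewrite lee_fin.
    by rewrite EFinM nnfun_muleindic_ge0.
apply: eq_fsbigr => r _.
have [r0|r0] := leP 0%R r.
  under [LHS]eq_integral do rewrite EFinM.
  under [RHS]eq_integral do rewrite EFinM muleCA.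
  rewrite ge0_integralZl//.
  - rewrite ge0_integralZl//.
    + by rewrite integral_density_indic.
    + by apply: emeasurable_funM => //; exact/measurable_EFinP.
    + by move=> x _; rewrite mule_ge0 ?lee_fin.
  - exact/measurable_EFinP.
rewrite preimage_nnfun0//.
by rewrite !integral0_eq// => x _; rewrite indic0 mulr0 ?mule0.
Qed.

(** Extension from indicators to simple functions by linearity, then to nonnegative functions by
    monotone convergence on both sides. *)
Lemma integral_density (f : T -> \bar R) : measurable_fun setT f ->
  (forall x, 0 <= f x) -> \int[nu]_x f x = \int[mu]_x ((p x)%:E * f x).
Proof.
move=> mf f0; pose g := nnsfun_approx measurableT mf.
have gf x : limn (EFin \o g ^~ x) = f x.
  by apply/cvg_lim => //; exact: cvg_nnsfun_approx.
have gnd x : {homo (fun n => (g n x)%:E) : m n / (m <= n)%N >-> m <= n}.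
  by move=> m n mn; rewrite lee_fin; exact/lefP/nd_nnsfun_approx.
transitivity (limn (fun n => \int[nu]_x (g n x)%:E)).
  rewrite -monotone_convergence//=.
  - by apply: eq_integral => x _; rewrite -gf.
  - by move=> n; exact/measurable_EFinP.
  - by move=> n x _; rewrite lee_fin.
transitivity (limn (fun n => \int[mu]_x ((p x)%:E * (g n x)%:E))).
  by apply/congr_lim/funext => n; exact: integral_density_nnsfun.
rewrite -monotone_convergence//=.
- apply: eq_integral => x _; rewrite -gf limeMl//.
  exact: ereal_nondecreasing_is_cvgn.
- by move=> n; apply: emeasurable_funM => //; exact/measurable_EFinP.
- by move=> n x _; rewrite mule_ge0// lee_fin.
- by move=> x _ m n mn; rewrite lee_wpmul2l ?lee_fin//; exact: gnd.
Qed.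

End Density.

Section NormalMoments.
Context {R : realType}.
Implicit Types (s t x y : R).
Local Notation mu := lebesgue_measure.
Local Notation N s := (normal_prob 0 s : probability _ R).

Lemma integral_normal_prob s (f : R -> R) : measurable_fun setT f ->
  (forall x, 0 <= f x) ->
  (\int[N s]_x (f x)%:E = \int[mu]_x (normal_pdf 0 s x * f x)%:E)%E.
Proof.
move=> mf f0; rewrite (integral_density (mu := mu) (measurable_normal_pdf 0 s))//.
- by move=> x; exact: normal_pdf_ge0.
- exact/measurable_EFinP.
Qed.

(* [c * exp (a x + b x^2)] is a density ratio of two normal laws. *)
Lemma normal_tilt s t m (f : R -> R) c : measurable_fun setT f ->
  (forall x, 0 <= f x) -> (forall x, normal_pdf 0 s x * f x = c * normal_pdf m t x) ->
  0 <= c -> intg (N s) f /\ \int[N s]_x f x = c.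
Proof.
move=> mf f0 fE c0.
have E : (\int[N s]_x (f x)%:E = c%:E)%E.
  rewrite integral_normal_prob//.
  under eq_integral do rewrite fE EFinM.
  rewrite ge0_integralZl//.
  - by rewrite integral_normal_pdf mule1.
  - by apply/measurable_EFinP; exact: measurable_normal_pdf.
  - by move=> x _; rewrite lee_fin normal_pdf_ge0.
split; last by rewrite /Rintegral E.
apply/integrableP; split; first exact/measurable_EFinP.
under eq_integral do rewrite /= ger0_norm//.
by rewrite E ltry.
Qed.

(** This tilt changes the standard deviation from [s] to [t], and the two normalising constants
    leave the quotient [t / s]. *)
Lemma normal_exp_sqr s t : 0 < s -> 0 < t ->
  let f x := expR ((s ^- 2 - t ^- 2) / 2 * x ^+ 2) in
  intg (N s) f /\ \int[N s]_x f x = t / s.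
Proof.
move=> s0 t0 f.
apply: (@normal_tilt s t 0) => //.
- by apply: measurableT_comp => //; apply: measurable_funM => //; exact: measurable_funX.
- by move=> x; exact: expR_ge0.
- move=> x; rewrite !normal_pdfE ?gt_eqF// /normal_fun /normal_peak.
  have sq r : 0 < r -> Num.sqrt (r ^+ 2 * pi *+ 2) = r * Num.sqrt (pi *+ 2).
    by move=> r0; rewrite -mulrnAr sqrtrM ?sqr_ge0// sqrtr_sqr gtr0_norm.
  rewrite !sq// -mulrA -expRD /f [RHS]mulrA.
  have p0 : Num.sqrt (pi *+ 2 : R) != 0 by rewrite gt_eqF// sqrtr_gt0 mulrn_wgt0// pi_gt0.
  congr (_ * expR _).
    by field; rewrite p0 !gt_eqF.
  by rewrite subr0; field; rewrite !gt_eqF.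
- by rewrite divr_ge0// ltW.
Qed.

(** This tilt moves the mean from 0 to [m]. *)
Lemma normal_exp_lin s m : 0 < s ->
  let f x := expR (m / s ^+ 2 * x) in
  intg (N s) f /\ \int[N s]_x f x = expR (m ^+ 2 / (s ^+ 2 *+ 2)).
Proof.
move=> s0 f.
apply: (@normal_tilt s s m) => //.
- by apply: measurableT_comp => //; exact: measurable_funM.
- by move=> x; exact: expR_ge0.
- move=> x; rewrite !normal_pdfE ?gt_eqF// /normal_fun.
  rewrite -mulrA -expRD mulrCA -expRD; congr (_ * expR _).
  by rewrite subr0; field; rewrite gt_eqF.
Qed.

Lemma normal_fourth s : 0 < s -> intg (N s) (fun x => x ^+ 4) /\
  \int[N s]_x (x ^+ 4) <= 64 * s ^+ 4.
Proof.
move=> s0; have s2 : 0 < s * Num.sqrt 2 by rewrite mulr_gt0// sqrtr_gt0.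
have [i1 E1] := normal_exp_sqr s0 s2.
(* For [t = s * sqrt 2] the exponent is [y = (x / (2 s))^2]. Then [x^4 = 16 s^4 y^2], and
   [y^2 / 2 <= exp y] gives the factor 32. *)
have fle x : x ^+ 4 <= 32 * s ^+ 4 *
    expR ((s ^- 2 - (s * Num.sqrt 2) ^- 2) / 2 * x ^+ 2).
  rewrite exprMn sqr_sqrtr//.
  rewrite (_ : _ / 2 * _ = (x / (s * 2)) ^+ 2); last by field; rewrite gt_eqF.
  have := @expR_ge1Dxn R ((x / (s * 2)) ^+ 2) 1 (sqr_ge0 _).
  set e := expR _ => he.
  have : (x / (s * 2)) ^+ 2 ^+ 2 / 2 <= e by rewrite (le_trans _ he)//= lerDr.
  rewrite ler_pdivrMr// -(ler_pM2l (_ : 0 < 16 * s ^+ 4)) ?mulr_gt0 ?exprn_gt0//.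
  rewrite (_ : 16 * s ^+ 4 * _ = x ^+ 4); last by field; rewrite gt_eqF.
  by move=> h; rewrite (le_trans h)// [leRHS](_ : _ = 16 * s ^+ 4 * (e * 2)); last ring.
have i4 : intg (N s) (fun x => x ^+ 4).
  apply: (intg_le _ _ (intgZ (32 * s ^+ 4) i1)); first exact: measurable_funX.
  by move=> x; rewrite ger0_norm ?exprn_even_ge0.
split => //; apply: (le_trans (Ex_le i4 (intgZ (32 * s ^+ 4) i1) fle)).
rewrite ExZ// E1 (_ : _ / s = Num.sqrt 2); last by field; rewrite gt_eqF.
rewrite [leRHS](_ : _ = (32 * s ^+ 4) * 2); last ring.
apply: ler_wpM2l; first by rewrite mulr_ge0// exprn_ge0// ltW.
rewrite -(@ler_pXn2r _ 2)// ?nnegrE// sqr_sqrtr//; lra.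
Qed.

Lemma normal_intg_sqr s : 0 < s -> intg (N s) (fun x => x ^+ 2).
Proof.
move=> s0; have [i4 _] := normal_fourth s0.
apply: (intg_le _ _ (intgD (intg_cst _ 1) i4)); first exact: measurable_funX.
move=> x /=; rewrite ger0_norm ?sqr_ge0//.
have := sqr_ge0 (x ^+ 2 - 1); have := sqr_ge0 x; nra.
Qed.

Lemma normal_intg_id s : 0 < s -> intg (N s) id.
Proof.
move=> s0; apply: (intg_le _ _ (intgD (intg_cst _ 1) (normal_intg_sqr s0))) => //.
move=> x /=; rewrite ler_norml; apply/andP; split; nra.
Qed.

(** Differentiates the known integral of the tilt through convexity. With [t = s * (1 + h)], the
    bound [1 + y <= exp y] is linear in the second moment; [h > 0] bounds the moment above, [h < 0]
    bounds it below, and small [h] pinch it. *)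
Lemma normal_sqr s : 0 < s -> \int[N s]_x (x ^+ 2) = s ^+ 2.
Proof.
move=> s0; have i2 := normal_intg_sqr s0.
set m := \int[N s]_x _.
pose u := m / s ^+ 2.
have m_u : m = u * s ^+ 2 by rewrite /u divfK// gt_eqF// exprn_gt0.
have u0 : 0 <= u.
  by rewrite /u divr_ge0 ?sqr_ge0//; apply: Rintegral_ge0 => x _; exact: sqr_ge0.
have key h : -1 < h -> u * h * (2 + h) <= 2 * h * (1 + h) ^+ 2.
  move=> h1; have h1' : 0 < 1 + h by lra.
  have t0 : 0 < s * (1 + h) by rewrite mulr_gt0.
  have [i1 E1] := normal_exp_sqr s0 t0.
  set a := (s ^- 2 - _) / 2 in i1 E1.
  have : \int[N s]_x (1 + a * x ^+ 2) <= s * (1 + h) / s.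
    rewrite -E1; apply: Ex_le => //; last by move=> x; exact: expR_ge1Dx.
    by apply: intgD; [exact: intg_cst|exact: intgZ].
  rewrite ExD ?Ex_cst ?ExZ//; [|exact: intg_cst|exact: intgZ].
  rewrite -/m (_ : s * (1 + h) / s = 1 + h); last by field; rewrite gt_eqF.
  rewrite lerD2l m_u.
  rewrite (_ : a * _ = (u * h * (2 + h)) / (2 * (1 + h) ^+ 2)); last first.
    by rewrite /a; field; rewrite !gt_eqF.
  rewrite ler_pdivrMr ?mulr_gt0 ?exprn_gt0//; lra.
have kp h : 0 < h -> u * (2 + h) <= 2 * (1 + h) ^+ 2.
  move=> h0; rewrite -(ler_pM2l h0).
  by have := key h ltac:(lra); lra.
have kn h : 0 < h -> h < 1 -> 2 * (1 - h) ^+ 2 <= u * (2 - h).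
  move=> h0 h1; rewrite -(ler_pM2l h0).
  have := key (- h) ltac:(lra); lra.
suff uE : u = 1 by rewrite m_u uE mul1r.
(* In place of a limit [h -> 0], each case takes an explicit [h] that contradicts [kp] or [kn]. *)
apply/eqP; rewrite eq_le; apply/andP; split; rewrite leNgt; apply/negP => u1.
  have [u2|u2] := leP u 2.
    by have := kp ((u - 1) / 4) ltac:(lra); nra.
  by have := kp (1 / 4) ltac:(lra); lra.
by have := kn ((1 - u) / 2) ltac:(lra) ltac:(lra); nra.
Qed.

(** The same convexity argument with the linear tilt: [1 + h m <= exp (h^2 s^2 / 2)]. The left side
    is of first order in [h] and the right side deviates from 1 by second order only, which is
    absurd for small [h] of the sign of [m]. *)
Lemma normal_mean s : 0 < s -> \int[N s]_x x = 0.
Proof.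
move=> s0; have i1 := normal_intg_id s0; set m := \int[N s]_x _.
have key h : h ^+ 2 * s ^+ 2 <= 1 -> h * m <= h ^+ 2 * s ^+ 2.
  move=> hs; have [ie Ee] := normal_exp_lin (s ^+ 2 * h) s0.
  rewrite (_ : s ^+ 2 * h / s ^+ 2 = h) in ie Ee; last by field; rewrite gt_eqF.
  pose y := h ^+ 2 * s ^+ 2 / 2.
  have yE : (s ^+ 2 * h) ^+ 2 / (s ^+ 2 *+ 2) = y.
    by rewrite /y; field; rewrite gt_eqF.
  have : \int[N s]_x (1 + h * x) <= expR y.
    rewrite -yE -Ee; apply: Ex_le => //; last by move=> x; exact: expR_ge1Dx.
    by apply: intgD; [exact: intg_cst|exact: intgZ].
  rewrite ExD ?Ex_cst ?ExZ//; [|exact: intg_cst|exact: (intgZ h i1)].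
  rewrite -/m => hm.
  have y0 : 0 <= y by rewrite /y divr_ge0// mulr_ge0// sqr_ge0.
  have y1 : y <= 1 / 2 by rewrite /y; lra.
  have := expR_ge1Dx (- y); rewrite expRN => hy.
  have ey : 0 < expR y by exact: expR_gt0.
  have : expR y * (1 - y) <= 1.
    by rewrite mulrC -ler_pdivlMr// div1r.
  have -> : h ^+ 2 * s ^+ 2 = 2 * y by rewrite /y; field.
  nra.
apply/eqP; apply: contrapT => /negP m0.
have m2 : 0 < m ^+ 2 by rewrite exprn_even_gt0.
have s2 : 0 < s ^+ 2 by rewrite exprn_gt0.
(* The small [h] is [m / D]. The last summand ensures [h^2 s^2 <= 1], and the first two contradict
   the resulting bound [D <= s^2]. *)
pose D := 1 + 2 * s ^+ 2 + m ^+ 2 * s ^+ 2.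
have ms : 0 < m ^+ 2 * s ^+ 2 by rewrite mulr_gt0.
have D1 : 1 <= D by rewrite /D; lra.
have D0 : 0 < D by lra.
have hD : m ^+ 2 * s ^+ 2 <= D ^+ 2.
  by rewrite (@le_trans _ _ D)// ?expr2 ?ler_peMl ?ltW// /D; lra.
have E1 : (m / D) ^+ 2 * s ^+ 2 = m ^+ 2 * s ^+ 2 / D ^+ 2 by field; rewrite gt_eqF.
have E2 : m / D * m = m ^+ 2 * D / D ^+ 2 by field; rewrite gt_eqF.
have := key (m / D); rewrite E1 E2 ler_pdivrMr ?exprn_gt0// mul1r => /(_ hD).
rewrite ler_pM2r ?invr_gt0 ?exprn_gt0// ler_pM2l// /D; lra.
Qed.

End NormalMoments.

(** * Partial sums: Ottaviani's inequality and Lindeberg replacement *)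

Section BlockSums.
Context {R : realType}.
Implicit Types (u v : nat -> R * R).

Lemma walkE u n : walk u n = \sum_(k < n) u k.
Proof.
by apply: injective_projections; rewrite /walk/=;
  [rewrite (big_morph fst (id1 := 0) (op1 := +%R))
  |rewrite (big_morph snd (id1 := 0) (op1 := +%R))].
Qed.

Lemma measurable_addp d (T : measurableType d) (f g : T -> R * R) :
  measurable_fun setT f -> measurable_fun setT g ->
  measurable_fun setT (fun w => f w + g w).
Proof.
move=> mf mg.
have -> : (fun w => f w + g w) = (fun w => ((f w).1 + (g w).1, (f w).2 + (g w).2)).
  by apply/funext.
by apply: measurable_fun_pair; apply: measurable_funD; apply: measurableT_comp.
Qed.

Lemma measurable_scalep d (T : measurableType d) (c : R) (f : T -> R * R) :
  measurable_fun setT f -> measurable_fun setT (fun w => c *: f w).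
Proof.
move=> mf.
have -> : (fun w => c *: f w) = (fun w => (c * (f w).1, c * (f w).2)).
  by apply/funext.
by apply: measurable_fun_pair; apply: measurable_funM => //; apply: measurableT_comp.
Qed.

Lemma measurable_sump d (T : measurableType d) I (r : seq I) (f : I -> T -> R * R) :
  (forall i, measurable_fun setT (f i)) ->
  measurable_fun setT (fun w => \sum_(i <- r) f i w).
Proof.
move=> mf; elim: r => [|i r ih].
  under eq_fun do rewrite big_nil; exact: measurable_cst.
by under eq_fun do rewrite big_cons; exact: measurable_addp.
Qed.

Lemma measurable_enorm : measurable_fun setT (@enorm R).
Proof.
have -> : @enorm R = @Num.sqrt R \o (fun x => x.1 ^+ 2 + x.2 ^+ 2) by [].
apply: measurableT_comp.
  by apply: continuous_measurable_fun; exact: sqrt_continuous.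
apply: measurable_funD; apply: measurable_funX.
  exact: measurable_fst.
exact: measurable_snd.
Qed.

Definition bsum T (X : nat -> T -> R * R) (k l : nat) (w : T) : R * R :=
  \sum_(k <= i < l) X i w.

Lemma bsumnn T (X : nat -> T -> R * R) k w : bsum X k k w = 0.
Proof. by rewrite /bsum big_geq. Qed.

Lemma bsumSr T (X : nat -> T -> R * R) k l w : (k <= l)%N ->
  bsum X k l.+1 w = bsum X k l w + X l w.
Proof. by move=> kl; rewrite /bsum big_nat_recr. Qed.

Lemma bsum_cat T (X : nat -> T -> R * R) k l m w : (k <= l)%N -> (l <= m)%N ->
  bsum X k m w = bsum X k l w + bsum X l m w.
Proof. by move=> kl lm; rewrite /bsum (@big_cat_nat _ _ _ l). Qed.

End BlockSums.

Section Walks.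
Context {R : realType} d (T : measurableType d) (P : probability T R).
Variables (n : nat) (X : nat -> T -> R * R).
Hypothesis iX : indepn P n X.

Let mX i : measurable_fun setT (X i). Proof. by case: iX. Qed.

Lemma measurable_bsum k l : measurable_fun setT (bsum X k l).
Proof. by apply: measurable_sump => i; exact: mX. Qed.

Lemma adapted_bsum k l : (l <= n)%N ->
  adapted n X (fun i => (k <= i < l)%N) (bsum X k l).
Proof.
move=> ln; rewrite /adapted.
(* The guard makes every summand adapted, as [measurable_sump] asks of all indices and not only of
   those in range. *)
have -> : bsum X k l = fun w => \sum_(k <= i < l) (if (k <= i < l)%N then X i w else 0).
  by apply/funext => w; apply: eq_big_nat => i ->.
apply: (@measurable_sump R _ (g_sigma_algebraType
  (cylinders n X (fun i : nat => (k <= i < l)%N)))) => i.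
have [kil|_] := boolP (k <= i < l)%N; last exact: measurable_cst.
apply: (adaptedX (n := n)) => //.
by case/andP : kil => _ il; exact: leq_trans il ln.
Qed.

Lemma adapted_sub (I J : pred nat) d2 (V : measurableType d2) (f : T -> V) :
  (forall i, I i -> J i) -> adapted n X I f -> adapted n X J f.
Proof.
move=> IJ af _ B mB; have := af measurableT B mB.
apply: sub_smallest2r; first exact: smallest_sigma_algebra.
move=> C [A [mA IA ->]].
by exists A; split => // i nJ; apply: IA; apply: contra nJ; exact: IJ.
Qed.

Lemma indep_bsum k l m : (k <= l)%N -> (l <= m)%N -> (m <= n)%N ->
  indep P (bsum X k l) (bsum X l m).
Proof.
move=> kl lm mn.
have dj (i : nat) : ~~ ((k <= i < l)%N && (l <= i < m)%N).
  by apply/negP => /andP[/andP[_ h1] /andP[h2 _]]; rewrite ltnNge h2 in h1.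
exact: (indep_adapted iX dj (@adapted_bsum k l (leq_trans lm mn))
  (@adapted_bsum l m mn)).
Qed.

Section Moments.
Variable s2 : R.
Hypothesis iX2 : forall i, (i < n)%N -> intg P (fun w => enorm (X i w) ^+ 2).
Hypothesis EX1 : forall i, (i < n)%N -> \int[P]_w (X i w).1 = 0.
Hypothesis EX2 : forall i, (i < n)%N -> \int[P]_w (X i w).2 = 0.
Hypothesis EXX : forall i, (i < n)%N -> \int[P]_w (enorm (X i w) ^+ 2) <= s2.

Lemma intg_coord (Y : T -> R * R) : measurable_fun setT Y ->
  intg P (fun w => enorm (Y w) ^+ 2) ->
  intg P (fun w => (Y w).1) /\ intg P (fun w => (Y w).2).
Proof.
move=> mY iY; split; apply: (intg_le _ _ (intgD (intg_cst _ 1) iY)).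
- exact: measurableT_comp.
- move=> w /=; have := sqr_enorm (Y w); have := sqr_ge0 (Y w).2.
  by rewrite ler_norml => h ->; apply/andP; split; nra.
- exact: measurableT_comp.
- move=> w /=; have := sqr_enorm (Y w); have := sqr_ge0 (Y w).1.
  by rewrite ler_norml => h ->; apply/andP; split; nra.
Qed.

(** Adding one step leaves no cross term in expectation, because it is a sum of products of
    independent centred coordinates. *)
Lemma bsum_moments k l : (k <= l)%N -> (l <= n)%N ->
  [/\ intg P (fun w => enorm (bsum X k l w) ^+ 2),
      \int[P]_w (bsum X k l w).1 = 0, \int[P]_w (bsum X k l w).2 = 0 &
      \int[P]_w (enorm (bsum X k l w) ^+ 2) <= (l - k)%:R * s2].
Proof.
elim: l => [|l ih]; first rewrite leqn0 => /eqP ->.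
  move=> _; have E w : bsum X 0 0 w = 0 by exact: bsumnn.
  split.
  - under eq_fun do rewrite E enorm0 expr0n/=; exact: intg_cst.
  - by under eq_Rintegral do rewrite E; exact: Ex_cst.
  - by under eq_Rintegral do rewrite E; exact: Ex_cst.
  - by under eq_Rintegral do rewrite E enorm0 expr0n/=; rewrite Ex_cst subn0 mul0r.
rewrite leq_eqVlt => /predU1P[-> _|].
  have E w : bsum X l.+1 l.+1 w = 0 by exact: bsumnn.
  split.
  - under eq_fun do rewrite E enorm0 expr0n/=; exact: intg_cst.
  - by under eq_Rintegral do rewrite E; exact: Ex_cst.
  - by under eq_Rintegral do rewrite E; exact: Ex_cst.
  - by under eq_Rintegral do rewrite E enorm0 expr0n/=; rewrite Ex_cst subnn mul0r.
rewrite ltnS => kl ln; have [iS ES1 ES2 ESS] := ih kl (ltnW ln).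
have E w : bsum X k l.+1 w = bsum X k l w + X l w by exact: bsumSr.
set S := bsum X k l in iS ES1 ES2 ESS E.
have mS : measurable_fun setT S by exact: measurable_bsum.
have [iS1 iS2] := intg_coord mS iS.
have [iX1' iX2'] := intg_coord (mX l) (iX2 ln).
have ind : indep P S (X l).
  have := indep_bsum kl (leqnSn l) ln.
  by have -> : bsum X l l.+1 = X l by apply/funext => w; rewrite /bsum big_nat1.
have ind1 : indep P (fun w => (S w).1) (fun w => (X l w).1).
  exact: (indep_comp (f := fst) (g := fst)).
have ind2 : indep P (fun w => (S w).2) (fun w => (X l w).2).
  exact: (indep_comp (f := snd) (g := snd)).
have [i11 E11] := indep_mul iS1 iX1' ind1.
have [i22 E22] := indep_mul iS2 iX2' ind2.
have E2 w : enorm (bsum X k l.+1 w) ^+ 2 = enorm (S w) ^+ 2 + enorm (X l w) ^+ 2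
    + 2 * ((S w).1 * (X l w).1 + (S w).2 * (X l w).2).
  by rewrite E !sqr_enorm /=; ring.
have iSX := intgD iS (iX2 ln).
have icr := intgZ 2 (intgD i11 i22).
split.
- by under eq_fun do rewrite E2; exact: intgD.
- under eq_Rintegral do rewrite E.
  by rewrite (ExD iS1 iX1') ES1 EX1// addr0.
- under eq_Rintegral do rewrite E.
  by rewrite (ExD iS2 iX2') ES2 EX2// addr0.
- under eq_Rintegral do rewrite E2.
  rewrite ExD// ExZ; last exact: intgD.
  rewrite [X in _ + _ * X]ExD// E11 E22 ES1 ES2 !mul0r addr0 mulr0 addr0.
  rewrite ExD//; last exact: iX2.
  by rewrite subSn// -natr1 mulrDl mul1r lerD// EXX.
Qed.

Lemma bsum_chebyshev k l a : (k <= l)%N -> (l <= n)%N -> 0 < a ->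
  fine (P [set w | a <= enorm (bsum X k l w)]) <= (l - k)%:R * s2 / a ^+ 2.
Proof.
move=> kl ln a0; have [iS _ _ ESS] := bsum_moments kl ln.
rewrite ler_pdivlMr ?exprn_gt0// mulrC.
apply: le_trans ESS; rewrite (_ : [set w | a <= _] =
    [set w | a ^+ 2 <= enorm (bsum X k l w) ^+ 2]).
  by apply: pr_markov => // w; exact: sqr_ge0.
by apply/seteqP; split => w /=;
  rewrite ler_pXn2r ?nnegrE ?enorm_ge0// ltW.
Qed.

(* Ottaviani's inequality, split according to the first exit time [k + i]. *)
Lemma ottaviani k l a : 0 <= s2 -> (k <= l)%N -> (l <= n)%N -> 0 < a ->
  (l - k)%:R * s2 / a ^+ 2 <= 1 / 2 ->
  fine (P (\bigcup_(i in [set i | (i < (l - k).+1)%N])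
             [set w | 2 * a < enorm (bsum X k (k + i) w)])) <=
  2 * fine (P [set w | a < enorm (bsum X k l w)]).
Proof.
move=> s20 kl ln a0 h2.
pose S i := bsum X k (k + i).
pose A i := [set w | 2 * a < enorm (S i w)] `&`
  \bigcap_(j in [set j | (j < i)%N]) [set w | enorm (S j w) <= 2 * a].
pose B i := [set w | enorm (bsum X (k + i) l w) <= a].
pose D := [set w | a < enorm (bsum X k l w)].
have mgt d0 (T0 : measurableType d0) (f : T0 -> R * R) c : measurable_fun setT f ->
    measurable [set w | c < enorm (f w)].
  move=> mf; rewrite -[X in measurable X]setTI -preimage_itvoy.
  by apply: (measurableT_comp measurable_enorm mf) => //; exact: measurable_itv.
have mge d0 (T0 : measurableType d0) (f : T0 -> R * R) c : measurable_fun setT f ->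
    measurable [set w | c <= enorm (f w)].
  move=> mf; rewrite -[X in measurable X]setTI -preimage_itvcy.
  by apply: (measurableT_comp measurable_enorm mf) => //; exact: measurable_itv.
have mle d0 (T0 : measurableType d0) (f : T0 -> R * R) c : measurable_fun setT f ->
    measurable [set w | enorm (f w) <= c].
  move=> mf; rewrite -[X in measurable X]setTI -preimage_itvNyc.
  by apply: (measurableT_comp measurable_enorm mf) => //; exact: measurable_itv.
have mA i : measurable (A i).
  apply: measurableI; first by apply: mgt; exact: measurable_bsum.
  by apply: bigcap_measurableType => j _; apply: mle; exact: measurable_bsum.
have mB i : measurable (B i) by apply: mle; exact: measurable_bsum.
have mD : measurable D by apply: mgt; exact: measurable_bsum.
have kil i : (i < (l - k).+1)%N -> (k + i <= l)%N.
  by rewrite ltnS leq_subRL.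
have AB i : (i < (l - k).+1)%N -> fine (P (A i)) <= 2 * fine (P (A i `&` B i)).
  move=> /kil il; have iln := leq_trans il ln.
  (* The exit event [A i] is determined by the steps before [k + i], and [B i] by those from [k + i]
     on. *)
  have -> : P (A i `&` B i) = (P (A i) * P (B i))%E.
    apply: (indep_cylinders_sigma (n := n) iX
      (I := fun j => (k <= j < k + i)%N) (J := fun j => (k + i <= j < l)%N)).
    - by move=> j; apply/negP => /andP[/andP[_ +] /andP[]]; rewrite ltnNge => /negP.
    - apply: (@measurableI _ (g_sigma_algebraType (cylinders n X
        (fun j => (k <= j < k + i)%N)))).
        by apply: mgt; exact: adapted_bsum.
      apply: bigcap_measurableType => j ji; apply: mle.
      apply: (@adapted_sub (fun m => (k <= m < k + j)%N)).
        by move=> m /andP[-> mj] /=; rewrite (leq_trans mj)// leq_add2l ltnW.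
      by apply: adapted_bsum; rewrite (leq_trans _ iln)// leq_add2l ltnW.
    - apply: (mle _ (g_sigma_algebraType (cylinders n X
        (fun j => (k + i <= j < l)%N)))); exact: adapted_bsum.
  rewrite fineM ?fin_num_measure// mulrCA ler_peMr ?pr_ge0//.
  have BC : fine (P (B i)) = 1 - fine (P (~` B i)).
    by rewrite probability_setC// fineB ?fin_num_measure//=; ring.
  have : fine (P (~` B i)) <= 1 / 2.
    apply: (@le_trans _ _ (fine (P [set w | a <= enorm (bsum X (k + i) l w)]))).
      apply: (@pr_le _ _ _ P).
      - by apply: measurableC; exact: mB.
      - by apply: mge; exact: measurable_bsum.
      - by move=> w /= /negP; rewrite -ltNge => /ltW.
    apply: (le_trans (bsum_chebyshev il ln a0)); apply: le_trans h2.
    rewrite ler_pM2r ?invr_gt0 ?exprn_gt0// ler_wpM2r// ler_nat.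
    by apply: leq_sub2l; exact: leq_addr.
  rewrite BC; lra.
apply: (@le_trans _ _ (fine (P (\bigcup_(i in [set i | (i < (l - k).+1)%N]) A i)))).
  apply: (@pr_le _ _ _ P).
  - by apply: bigcup_measurable => i _; apply: mgt; exact: measurable_bsum.
  - by apply: bigcup_measurable => i _; exact: mA.
  - move=> w [i il iw].
    have ex : exists i, 2 * a < enorm (S i w) by exists i.
    case: (ex_minnP ex) => m mw mmin.
    exists m => /=; first exact: leq_ltn_trans (mmin _ iw) il.
    split => // j jm /=; rewrite leNgt; apply/negP => /mmin.
    by rewrite leqNgt jm.
apply: (le_trans (pr_bigcup_ord P _ mA)).
apply: (@le_trans _ _ (\sum_(i < (l - k).+1) 2 * fine (P (A i `&` B i)))).
  by apply: ler_sum => i _; exact: AB.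
rewrite -mulr_sumr ler_pM2l//.
have mAB i : measurable (A i `&` B i) by exact: measurableI.
have -> : \sum_(i < (l - k).+1) fine (P (A i `&` B i)) =
    \sum_(i < (l - k).+1) \int[P]_w (\1_(A i `&` B i) w).
  by apply: eq_bigr => i _; rewrite Ex_indic.
rewrite -Ex_indic// -Ex_sum; last by move=> i; exact: intg_indic.
apply: Ex_le.
- by apply: intg_sum => i; exact: intg_indic.
- exact: intg_indic.
(* The first exit index is unique, so the indicators add up to at most 1. If one of them is 1, then
   [D] holds: the sum was beyond [2 * a] and the remaining steps take back at most [a]. *)
move=> w; have [[i [Aw Bw]]|nw] := pselect (exists i : 'I_(l - k).+1, A i w /\ B i w).
  have Dw : D w.
    rewrite /D/=; have := @bsum_cat _ _ X k (k + i) l w (leq_addr _ _) (kil _ (ltn_ord i)).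
    move=> e; have [/= Sw _] := Aw; rewrite /B /= in Bw.
    have := enormD (bsum X k l w) (- bsum X (k + i) l w).
    by rewrite enormN {1}e addrK -/(S i w) => h; lra.
  rewrite (bigD1 i)//= big1 ?addr0.
    by rewrite !indicE; move/mem_set : Dw => ->; case: (_ \in _); rewrite ?lexx ?ler01.
  move=> j ji; rewrite indicE (memNset _)// => -[[Sj hj] _].
  have [[Si hi] _] := (conj Aw Bw).
  have [ij|ij|/val_inj ij] := ltngtP i j.
  - by have := hj _ ij; rewrite /= leNgt Si.
  - by have := hi _ ij; rewrite /= leNgt Sj.
  - by rewrite ij eqxx in ji.
rewrite big1 ?indicE// => i _; rewrite indicE memNset// => -[Aw Bw].
by apply: nw; exists i.
Qed.

End Moments.

(** The last block is split off: the product of the earlier factors is adapted to the indices below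
    [c m]. *)
Lemma bsum_prod (c : nat -> nat) m (phi : nat -> R * R -> R) :
  {homo c : i j / (i <= j)%N >-> (i <= j)%N} -> (c m <= n)%N ->
  (forall j, measurable_fun setT (phi j)) -> (forall j x, `|phi j x| <= 1) ->
  \int[P]_w (\prod_(j < m) phi j (bsum X (c j) (c j.+1) w)) =
  \prod_(j < m) \int[P]_w phi j (bsum X (c j) (c j.+1) w).
Proof.
move=> hc + mphi phi1; elim: m => [_|m ih cm].
  by rewrite big_ord0; under eq_Rintegral do rewrite big_ord0; exact: Ex_cst.
have cmm := hc _ _ (leqnSn m); have cmn := leq_trans cmm cm.
rewrite big_ord_recr/= -ih//.
under eq_Rintegral do rewrite big_ord_recr/=.
have mb j : measurable_fun setT (fun w => phi j (bsum X (c j) (c j.+1) w)).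
  by apply: measurableT_comp => //; exact: measurable_bsum.
have b1 w : `|\prod_(j < m) phi j (bsum X (c j) (c j.+1) w)| <= 1.
  by rewrite normr_prod; apply: numdomain.Num.Theory.prodr_ile1 => j _; rewrite normr_ge0/=.
apply: (indep_mul _ _ _).2.
- by apply: intg_bdd b1; exact: measurable_prod.
- by apply: intg_bdd (fun w => phi1 m _).
apply: (@indep_adapted _ _ _ P _ _ n X (fun i => (0 <= i < c m)%N)
  (fun i => (c m <= i < c m.+1)%N) _ _ _ _ _ _ iX).
- by move=> i; apply/negP => /andP[/andP[_ +] /andP[]]; rewrite ltnNge => /negP.
- apply: measurable_prod => j _; apply: measurableT_comp => //.
  apply: (@adapted_sub (fun i => (c j <= i < c j.+1)%N)).
    by move=> i /andP[_ /leq_trans]; apply; exact: hc.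
  by apply: adapted_bsum; rewrite (leq_trans _ cmn)//; exact: hc.
- by apply: measurableT_comp => //; exact: adapted_bsum.
Qed.

End Walks.

(** * Replacement of one walk by another *)

Section Trotter.
Context {R : realType} d (T : measurableType d) (P : probability T R)
  d' (T' : measurableType d') (Q : probability T' R).
Variables (n : nat) (X : nat -> T -> R * R) (Y : nat -> T' -> R * R).
Hypotheses (iX : indepn P n X) (iY : indepn Q n Y).
Variables (phi : R * R -> R) (M del : R).
Hypotheses (mphi : measurable_fun setT phi) (phiM : forall x, `|phi x| <= M).
Hypothesis close : forall i, (i < n)%N -> forall x,
  `|\int[P]_w phi (x + X i w) - \int[Q]_w phi (x + Y i w)| <= del.

Let split_last d0 (T0 : measurableType d0) (P0 : probability T0 R)
    (X0 : nat -> T0 -> R * R) k l x : indepn P0 n X0 -> (k <= l)%N -> (l < n)%N ->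
  \int[P0]_w phi (x + bsum X0 k l.+1 w) =
  \int[P0]_w \int[P0]_w' phi (x + bsum X0 k l w + X0 l w').
Proof.
move=> iX0 kl ln.
have ind := indep_bsum iX0 kl (leqnSn l) ln.
have E : bsum X0 l l.+1 = X0 l by apply/funext => w; rewrite /bsum big_nat1.
rewrite E in ind; have [mX0 _] := iX0.
under eq_Rintegral do rewrite bsumSr// addrA.
apply: (indep_Ex _ _ ind (F := fun z => phi (x + z.1 + z.2)) (M := M)) => //.
  exact: measurable_bsum iX0 _ _.
apply: measurableT_comp => //; apply: measurable_addp => //.
exact: measurable_addp.
Qed.

(* Replaces the steps of the first walk by those of the second one at a time;
   [close] holds uniformly in the starting point, so the errors just add up. *)
Lemma trotter k l x : (k <= l)%N -> (l <= n)%N ->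
  `|\int[P]_w phi (x + bsum X k l w) - \int[Q]_w phi (x + bsum Y k l w)|
    <= (l - k)%:R * del.
Proof.
have [mX _] := iX; have [mY _] := iY.
move=> + ln; move: ln x; elim: l => [|l ih] ln x.
  rewrite leqn0 => /eqP ->; rewrite subn0 mul0r.
  under eq_Rintegral do rewrite bsumnn addr0.
  under [X in _ - X]eq_Rintegral do rewrite bsumnn addr0.
  by rewrite !Ex_cst subrr normr0.
rewrite leq_eqVlt => /predU1P[->|].
  rewrite subnn mul0r.
  under eq_Rintegral do rewrite bsumnn addr0.
  under [X in _ - X]eq_Rintegral do rewrite bsumnn addr0.
  by rewrite !Ex_cst subrr normr0.
rewrite ltnS => kl.
rewrite (split_last x iX kl ln) (split_last x iY kl ln).
have mS := measurable_bsum iX k l; have mS' := measurable_bsum iY k l.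
have mF d1 d2 (T1 : measurableType d1) (T2 : measurableType d2)
    (f : T1 -> R * R) (g : T2 -> R * R) : measurable_fun setT f ->
    measurable_fun setT g ->
    measurable_fun setT (fun z : T1 * T2 => phi (x + f z.1 + g z.2)).
  move=> mf mg; apply: measurableT_comp => //.
  by apply: measurable_addp; [apply: measurable_addp => //|]; exact: measurableT_comp.
(* The hybrid of the first walk up to [l] and the last step of the second. On one side it differs by
   a single step, covered by [close]. On the other, Fubini's theorem absorbs the common step [Y l]
   into the starting point, where the induction hypothesis applies. *)
set B := \int[P]_w \int[Q]_w' phi (x + bsum X k l w + Y l w').
have BE : B = \int[Q]_w \int[P]_w' phi (x + Y l w + bsum X k l w').
  rewrite /B (@Ex_fubini _ _ _ _ _ P Q (fun z => phi (x + bsum X k l z.1 + Y l z.2)) M)//.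
    by apply: eq_Rintegral => w _; apply: eq_Rintegral => w' _; rewrite addrAC.
  exact: mF.
have CE : \int[Q]_w \int[Q]_w' phi (x + bsum Y k l w + Y l w') =
    \int[Q]_w \int[Q]_w' phi (x + Y l w + bsum Y k l w').
  rewrite (@Ex_fubini _ _ _ _ _ Q Q (fun z => phi (x + bsum Y k l z.1 + Y l z.2)) M)//.
    by apply: eq_Rintegral => w _; apply: eq_Rintegral => w' _; rewrite addrAC.
  exact: mF.
have bd d1 (T1 : measurableType d1) (P1 : probability T1 R) (f : T1 -> R * R) y :
    measurable_fun setT f -> `|\int[P1]_w phi (y + f w)| <= M.
  by move=> mf; apply: Ex_bdd => //; apply: measurableT_comp => //; exact: measurable_addp.
have me d1 d2 (T1 : measurableType d1) (T2 : measurableType d2)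
    (P1 : probability T1 R) (P2 : probability T2 R)
    (f : T1 -> R * R) (g : T2 -> R * R) : measurable_fun setT f ->
    measurable_fun setT g ->
    measurable_fun setT (fun w => \int[P2]_w' phi (x + f w + g w')).
  move=> mf mg.
  apply: (@measurable_Ex2 _ _ _ _ _ P1 P2 (fun z => phi (x + f z.1 + g z.2)) M).
    exact: mF.
  by move=> z; exact: phiM.
rewrite (le_trans (ler_distD B _ _))// subSn// -natr1 mulrDl mul1r addrC.
apply: lerD.
  rewrite BE CE; apply: (@Ex_close _ _ _ _ _ _ M) => //; try exact: (me _ _ _ _ Q);
    move=> w; first exact: bd; first exact: bd.
  exact: ih (ltnW ln) _ kl.
apply: (@Ex_close _ _ _ _ _ _ M) => //; try exact: (me _ _ _ _ P); move=> w;
  first exact: bd; first exact: bd.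
exact: close.
Qed.

End Trotter.

(** * Smooth test functions *)

Section SmoothFunctions.
Context {R : realType}.
Implicit Types (phi psi : R -> R).

(** Bounded with a uniform second order Taylor expansion, stated without derivatives: [a] stands for
    the first derivative and [h] for half the second. Piecewise cubic functions of class C^2 fit
    this form directly. *)
Definition smooth3 phi := measurable_fun setT phi /\ exists C : R, forall x,
  `|phi x| <= C /\ exists a h, [/\ `|a| <= C, `|h| <= C &
    forall t, `|phi (x + t) - phi x - a * t - h * t ^+ 2| <= C * `|t| ^+ 3].

Lemma smooth3_cst c : smooth3 (cst c).
Proof.
split; first exact: measurable_cst.
exists `|c| => x; split => //; exists 0, 0; split; rewrite ?normr0// => t.
by rewrite /= subrr !mul0r !subr0 normr0 mulr_ge0// exprn_ge0.
Qed.

Lemma smooth3_lin c phi psi : smooth3 phi -> smooth3 psi ->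
  smooth3 (fun x => phi x + c * psi x).
Proof.
move=> [mf [C hC]] [mg [D hD]]; split.
  by apply: measurable_funD => //; exact: measurable_funM.
exists (C + `|c| * D) => x.
have [fC [a [h [aC hC' ft]]]] := hC x; have [gD [b [k [bD kD gt]]]] := hD x.
have tri (u v : R) (A B : R) : `|u| <= A -> `|v| <= B -> `|u + c * v| <= A + `|c| * B.
  move=> uA vB; rewrite (le_trans (ler_normD _ _))// lerD// normrM.
  by rewrite ler_wpM2l.
split; first exact: tri.
exists (a + c * b), (h + c * k); split; [exact: tri|exact: tri|] => t.
rewrite [leRHS]mulrDl -[X in _ <= _ + X]mulrA.
rewrite (_ : _ - _ = (phi (x + t) - phi x - a * t - h * t ^+ 2) +
  c * (psi (x + t) - psi x - b * t - k * t ^+ 2)); last ring.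
by apply: tri.
Qed.

Lemma smooth3_affine al be phi : smooth3 phi -> smooth3 (fun x => phi (al * x + be)).
Proof.
move=> [mf [C hC]]; split.
  by apply: measurableT_comp => //; apply: measurable_funD => //; exact: measurable_funM.
pose D := 1 + `|al| + `|al| ^+ 2 + `|al| ^+ 3.
have C0 : 0 <= C by have [/(le_trans _)-> //] := hC 0.
have al0 : 0 <= `|al| by [].
have [h2 h3] : 0 <= `|al| ^+ 2 /\ 0 <= `|al| ^+ 3 by rewrite !exprn_ge0.
have D1 : 1 <= D /\ `|al| <= D /\ `|al| ^+ 2 <= D /\ `|al| ^+ 3 <= D by rewrite /D; lra.
have [D11 [D12 [D13 D14]]] := D1.
exists (C * D) => x; have [fC [a [h [aC hC' ft]]]] := hC (al * x + be).
split; first by rewrite (le_trans fC)// ler_peMr.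
exists (a * al), (h * al ^+ 2); split.
- by rewrite normrM ler_pM.
- by rewrite normrM normrX ler_pM.
- move=> t; have := ft (al * t).
  rewrite (_ : al * x + be + al * t = al * (x + t) + be); last ring.
  rewrite (_ : a * (al * t) = a * al * t); last ring.
  rewrite (_ : h * (al * t) ^+ 2 = h * al ^+ 2 * t ^+ 2); last ring.
  move/le_trans; apply; rewrite normrM exprMn mulrA.
  by rewrite ler_wpM2r ?exprn_ge0// ler_wpM2l.
Qed.

Let pos x : R := maxr x 0.

(** The truncated cube has only two continuous derivatives at 0. The remainder is [t^3] or 0 when
    the segment stays on one side, and crossing 0 does not enlarge the bound. *)
Let pos_taylor x t : `|pos (x + t) ^+ 3 - pos x ^+ 3 - 3 * pos x ^+ 2 * t
  - 3 * pos x * t ^+ 2| <= `|t| ^+ 3.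
Proof.
rewrite -normrX /pos; have [x0|x0] := leP x 0; have [xt0|xt0] := leP (x + t) 0.
- by rewrite !expr0n/= !mulr0 !mul0r !subr0 normr0.
- rewrite !expr0n/= !mulr0 !mul0r !subr0 !normrX ler_pXn2r ?nnegrE//.
  by rewrite gtr0_norm// (le_trans _ (ler_norm _))// gerDr.
- have t0 : t < 0 by lra.
  rewrite (ltr0_norm (_ : t ^+ 3 < 0)); last by rewrite exprn_odd_lt0.
  have s3 : 0 <= (- (x + t)) ^+ 3 by rewrite exprn_ge0// oppr_ge0.
  have st : (- (x + t)) ^+ 3 <= (- t) ^+ 3 by rewrite lerXn2r// ?nnegrE; lra.
  by rewrite ler_norml; apply/andP; split; lra.
- by rewrite (_ : _ - _ = t ^+ 3)//; ring.
Qed.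

(** The integral of the quadratic B-spline on [0, 3], as a third difference of truncated cubes
    divided by 3!. It rises from 0 to 1 over that interval. *)
Definition smoothstep x : R := (pos x ^+ 3 - 3 * pos (x - 1) ^+ 3
  + 3 * pos (x - 2) ^+ 3 - pos (x - 3) ^+ 3) / 6.

Let posE x : (x <= 0 /\ pos x = 0) \/ (0 <= x /\ pos x = x).
Proof. by rewrite /pos; case: leP => h; [left|right]; rewrite ?(ltW h). Qed.

(* Nonnegativity of the cubic Bernstein basis on a unit interval makes the
   piecewise cubic inequalities below linear. *)
Let bern (u : R) : 0 <= u -> u <= 1 -> [/\ 0 <= u ^+ 3, 0 <= u ^+ 2 * (1 - u),
  0 <= u * (1 - u) ^+ 2 & 0 <= (1 - u) ^+ 3].
Proof.
move=> u0 u1; have v0 : 0 <= 1 - u by rewrite subr_ge0.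
by split; rewrite ?mulr_ge0 ?exprn_ge0.
Qed.

Let bern2 (u : R) : 0 <= u -> u <= 1 -> [/\ 0 <= u ^+ 2, 0 <= u * (1 - u) &
  0 <= (1 - u) ^+ 2].
Proof.
move=> u0 u1; have v0 : 0 <= 1 - u by rewrite subr_ge0.
by split; rewrite ?mulr_ge0 ?exprn_ge0.
Qed.

Ltac lra_bern u := have [? ? ? ?] := @bern u ltac:(lra) ltac:(lra); lra.
Ltac lra_bern2 u := have [? ? ?] := @bern2 u ltac:(lra) ltac:(lra); lra.

Lemma smoothstep0 x : x <= 0 -> smoothstep x = 0.
Proof.
by move=> x0; rewrite /smoothstep /pos !max_r//; lra.
Qed.

Lemma smoothstep1 x : 3 <= x -> smoothstep x = 1.
Proof. by move=> x3; rewrite /smoothstep /pos !max_l//; lra. Qed.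

Lemma smoothstep_itv x : 0 <= smoothstep x <= 1.
Proof.
rewrite /smoothstep.
have [[h ->]|[h ->]] := posE x; have [[h1 ->]|[h1 ->]] := posE (x - 1);
have [[h2 ->]|[h2 ->]] := posE (x - 2); have [[h3 ->]|[h3 ->]] := posE (x - 3);
  first [lra | lra_bern x | lra_bern (x - 1) | lra_bern (x - 2)].
Qed.

Lemma smooth3_smoothstep : smooth3 smoothstep.
Proof.
split.
  have mpos (c : R) : measurable_fun setT (fun x : R => pos (x - c) ^+ 3).
    apply: measurable_funX; apply: measurable_maxr => //.
    exact: measurable_funB.
  have m0 : measurable_fun setT (fun x : R => pos x ^+ 3).
    by apply: measurable_funX; exact: measurable_maxr.
  apply: measurable_funM => //; apply: measurable_funB => //.
  apply: measurable_funD; last by apply: measurable_funM.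
  by apply: measurable_funB => //; apply: measurable_funM.
exists 100 => x; split.
  by have /andP[h1 h2] := smoothstep_itv x; rewrite ger0_norm//; lra.
(* The first derivative, followed by half the second. The four truncated cubes contribute at most (1
   + 3 + 3 + 1)/6 to the remainder, so 100 is a generous common constant. *)
pose a := (pos x ^+ 2 - 3 * pos (x - 1) ^+ 2 + 3 * pos (x - 2) ^+ 2 - pos (x - 3) ^+ 2) / 2.
pose h := (pos x - 3 * pos (x - 1) + 3 * pos (x - 2) - pos (x - 3)) / 2.
exists a, h; split.
- rewrite /a ler_norml.
  have [[h0 ->]|[h0 ->]] := posE x; have [[h1 ->]|[h1 ->]] := posE (x - 1);
  have [[h2 ->]|[h2 ->]] := posE (x - 2); have [[h3 ->]|[h3 ->]] := posE (x - 3);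
    first [lra | lra_bern2 x | lra_bern2 (x - 1) | lra_bern2 (x - 2)].
- rewrite /h ler_norml.
  have [[h0 ->]|[h0 ->]] := posE x; have [[h1 ->]|[h1 ->]] := posE (x - 1);
  have [[h2 ->]|[h2 ->]] := posE (x - 2); have [[h3 ->]|[h3 ->]] := posE (x - 3);
    lra.
- move=> t; rewrite /smoothstep.
  have E (c : R) : x + t - c = x - c + t by ring.
  rewrite !E /a /h.
  have := pos_taylor x t; have := pos_taylor (x - 1) t.
  have := pos_taylor (x - 2) t; have := pos_taylor (x - 3) t.
  have t3 : 0 <= `|t| ^+ 3 by rewrite exprn_ge0.
  rewrite !ler_norml => /andP[? ?] /andP[? ?] /andP[? ?] /andP[? ?].
  by apply/andP; split; lra.
Qed.

(** The cubic B-spline on [0, 4]. In this form the sum of its integer translates telescopes. *)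
Definition bump x : R := smoothstep x - smoothstep (x - 1).

Lemma bump_ge0 x : 0 <= bump x.
Proof.
rewrite /bump /smoothstep -!addrA -!opprD.
have -> : 1 + 1 = 2 :> R by ring. have -> : 1 + 2 = 3 :> R by ring.
have -> : 1 + 3 = 4 :> R by ring.
have [[h0 ->]|[h0 ->]] := posE x; have [[h1 ->]|[h1 ->]] := posE (x - 1);
have [[h2 ->]|[h2 ->]] := posE (x - 2); have [[h3 ->]|[h3 ->]] := posE (x - 3);
have [[h4 ->]|[h4 ->]] := posE (x - 4);
  first [lra | lra_bern x | lra_bern (x - 1) | lra_bern (x - 2) | lra_bern (x - 3)].
Qed.

Lemma bump_le1 x : bump x <= 1.
Proof.
have /andP[_ h1] := smoothstep_itv x; have /andP[h2 _] := smoothstep_itv (x - 1).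
rewrite /bump; lra.
Qed.

Lemma smooth3_bump : smooth3 bump.
Proof.
have := smooth3_lin (-1) smooth3_smoothstep (smooth3_affine 1 (-1) smooth3_smoothstep).
by under eq_fun do rewrite mulN1r mul1r.
Qed.

Lemma bump_supp x : bump x != 0 -> 0 <= x <= 4.
Proof.
apply: contraNT; rewrite negb_and -!ltNge => /orP[x0|x4]; apply/eqP; rewrite /bump.
  by rewrite !smoothstep0//; lra.
by rewrite !smoothstep1 ?subrr//; lra.
Qed.

Lemma sum_bump x N : \sum_(i < N) bump (x - i%:R) = smoothstep x - smoothstep (x - N%:R).
Proof.
elim: N => [|N ih]; first by rewrite big_ord0 subr0 subrr.
rewrite big_ord_recr/= ih /bump (_ : x - N.+1%:R = x - N%:R - 1); first ring.
by rewrite -natr1; ring.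
Qed.

Lemma partition_of_unity (K e : R) : 0 < e ->
  exists N (be : 'I_N -> R -> R) (g : 'I_N -> R), [/\
    forall i, smooth3 (be i), forall i x, 0 <= be i x <= 1,
    forall x, \sum_i be i x <= 1, forall x, `|x| <= K -> \sum_i be i x = 1 &
    forall i x, be i x != 0 -> `|x - g i| <= e].
Proof.
(* A bump has support of length 4, hence of length [e] after scaling by [eta], with left end [g i].
   The offset [L] makes the first smoothstep equal to 1 from [- K] on, and [N] keeps the last one at
   0 up to [K]. *)
move=> e0; pose eta := e / 4.
have eta0 : 0 < eta by rewrite /eta divr_gt0.
pose L := K + 3 * eta.
pose N := (Num.trunc ((K + L) / eta)).+1.
have NL : (K + L) / eta <= N%:R.
  have [h|h] := leP 0 ((K + L) / eta); first by rewrite ltW// /N truncnS_gt.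
  by rewrite (le_trans (ltW h)).
pose y x := eta^-1 * x + L / eta.
exists N, (fun i x => bump (y x - i%:R)), (fun i => eta * i%:R - L); split.
- move=> i.
  have := smooth3_affine eta^-1 (L / eta - i%:R) smooth3_bump.
  by under eq_fun do rewrite addrA.
- by move=> i x; rewrite bump_ge0 bump_le1.
- move=> x; rewrite sum_bump.
  have /andP[_ h1] := smoothstep_itv (y x).
  have /andP[h2 _] := smoothstep_itv (y x - N%:R); lra.
- move=> x; rewrite ler_norml => /andP[x1 x2]; rewrite sum_bump.
  have yE : y x = (x + L) / eta by rewrite /y; field; rewrite gt_eqF.
  rewrite smoothstep1; last by rewrite yE ler_pdivlMr// /L; lra.
  rewrite smoothstep0 ?subr0// subr_le0 (le_trans _ NL)// yE.
  by rewrite ler_pM2r ?invr_gt0//; lra.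
- move=> i x /bump_supp/andP[h1 h2].
  have yE : y x = (x + L) / eta by rewrite /y; field; rewrite gt_eqF.
  have xE : x - (eta * i%:R - L) = eta * (y x - i%:R).
    by rewrite yE; field; rewrite gt_eqF.
  rewrite xE normrM (gtr0_norm eta0) (ger0_norm h1).
  by rewrite (le_trans (ler_wpM2l (ltW eta0) h2))// /eta; lra.
Qed.

(** Both bounds on the remainder are kept: the square is integrable under a second moment, and the
    cube is small for small steps. *)
Definition smooth2 (Phi : R * R -> R) := measurable_fun setT Phi /\
  exists C, forall x : R * R, `|Phi x| <= C /\
    exists a b h k m, forall v : R * R, let r := `|Phi (x + v) - (Phi x + a * v.1
        + b * v.2 + h * v.1 ^+ 2 + k * (v.1 * v.2) + m * v.2 ^+ 2)| in
      r <= C * enorm v ^+ 2 /\ r <= C * enorm v ^+ 3.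

Lemma smooth2_prod phi psi : smooth3 phi -> smooth3 psi ->
  smooth2 (fun x => phi x.1 * psi x.2).
Proof.
move=> [mf [C0 hC]] [mg [D0 hD]]; split.
  by apply: measurable_funM; exact: measurableT_comp.
have C00 : 0 <= C0 by have [/(le_trans _)-> //] := hC 0.
have D00 : 0 <= D0 by have [/(le_trans _)-> //] := hD 0.
pose C := C0 + D0.
have C0C : C0 <= C by rewrite /C; lra.
have D0C : D0 <= C by rewrite /C; lra.
have CC : 0 <= C by rewrite /C; lra.
(* In both regimes below the remainder splits into terms of the form [C^2] times a power of [rho],
   and 7 bounds their number. *)
exists (7 * C ^+ 2) => x.
have [fC [a [h [aC hC' ft]]]] := hC x.1; have [gD [b [k [bD kD gt]]]] := hD x.2.
have {}fC := le_trans fC C0C; have {}aC := le_trans aC C0C.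
have {}hC' := le_trans hC' C0C; have {}gD := le_trans gD D0C.
have {}bD := le_trans bD D0C; have {}kD := le_trans kD D0C.
split.
  rewrite normrM (le_trans (ler_pM _ _ fC gD))//; nra.
exists (a * psi x.2), (b * phi x.1), (h * psi x.2), (a * b), (k * phi x.1) => v r.
set rho := enorm v.
have rho0 : 0 <= rho by exact: enorm_ge0.
have tr : `|v.1| <= rho by exact: enorm_ge1.
have ur : `|v.2| <= rho by exact: enorm_ge2.
have ler_pM4 (p q A B : R) : `|p| <= A -> `|q| <= B -> `|p * q| <= A * B.
  by move=> pA qB; rewrite normrM ler_pM.
have ler_nD (p q A B : R) : `|p| <= A -> `|q| <= B -> `|p + q| <= A + B.
  by move=> pA qB; rewrite (le_trans (ler_normD _ _))// lerD.
(* For [rho > 1] boundedness gives the square, and the cube is larger. For [rho <= 1] the Taylor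
   expansions give the cube, and the square is larger. *)
have [rho1|rho1] := leP rho 1; last first.
  suff : r <= 7 * C ^+ 2 * rho ^+ 2.
    move=> h1; split => //; apply: (le_trans h1).
    apply: ler_wpM2l; first by rewrite mulr_ge0 ?sqr_ge0.
    by rewrite [leRHS]exprS ler_peMl ?exprn_ge0// ltW.
  have fC2 : `|phi (x.1 + v.1)| <= C by have [/le_trans->] := hC (x.1 + v.1).
  have gD2 : `|psi (x.2 + v.2)| <= C by have [/le_trans->] := hD (x.2 + v.2).
  have vv (p q : R) : `|p| <= rho -> `|q| <= rho -> `|p * q| <= rho ^+ 2.
    by move=> h1 h2; rewrite expr2 ler_pM4.
  have r1 : 1 <= rho ^+ 2 by rewrite exprn_ege1// ltW.
  have r2 : rho <= rho ^+ 2 by rewrite expr2 ler_peMl// ltW.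
  apply: (@le_trans _ _ (C * C + (C * C + C * C * rho + C * C * rho
     + C * C * rho ^+ 2 + C * C * rho ^+ 2 + C * C * rho ^+ 2))).
    rewrite /r; apply: (@ler_nD); first exact: ler_pM4.
    rewrite normrN; apply: (@ler_nD); [apply: (@ler_nD); [apply: (@ler_nD);
      [apply: (@ler_nD); [apply: (@ler_nD)|]|]|]|].
    - exact: ler_pM4.
    - by apply: (ler_pM4 _ _ _ _ _ tr); exact: ler_pM4.
    - by apply: (ler_pM4 _ _ _ _ _ ur); exact: ler_pM4.
    - by apply: (ler_pM4 _ _ _ _ _ (vv _ _ tr tr)); exact: ler_pM4.
    - by apply: (ler_pM4 _ _ _ _ _ (vv _ _ tr ur)); exact: ler_pM4.
    - by apply: (ler_pM4 _ _ _ _ _ (vv _ _ ur ur)); exact: ler_pM4.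
  have c2 : 0 <= C * C by rewrite mulr_ge0.
  have := ler_wpM2l c2 r1; have := ler_wpM2l c2 r2; rewrite expr2; lra.
suff : r <= 7 * C ^+ 2 * rho ^+ 3.
  move=> h1; split => //; apply: (le_trans h1).
  apply: ler_wpM2l; first by rewrite mulr_ge0 ?sqr_ge0.
  by rewrite [leLHS]exprS ler_piMl ?exprn_ge0.
have {}ft : `|phi (x.1 + v.1) - phi x.1 - a * v.1 - h * v.1 ^+ 2| <= C * rho ^+ 3.
  by rewrite (le_trans (ft v.1))// ler_pM// ?exprn_ge0// lerXn2r ?nnegrE.
have {}gt : `|psi (x.2 + v.2) - psi x.2 - b * v.2 - k * v.2 ^+ 2| <= C * rho ^+ 3.
  by rewrite (le_trans (gt v.2))// ler_pM// ?exprn_ge0// lerXn2r ?nnegrE.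
set q1 := (X in `|X| <= _) in ft; set q2 := (X in `|X| <= _) in gt.
have gD2 : `|psi (x.2 + v.2)| <= C by have [/le_trans->] := hD (x.2 + v.2).
have rE : r = `|q1 * psi (x.2 + v.2) + (phi x.1 + a * v.1 + h * v.1 ^+ 2) * q2
   + a * v.1 * (k * v.2 ^+ 2) + h * v.1 ^+ 2 * (b * v.2)
   + h * v.1 ^+ 2 * (k * v.2 ^+ 2)|.
  by rewrite /r /=; congr `|_|; rewrite /q1 /q2; ring.
have sq (p : R) : `|p| <= rho -> `|p ^+ 2| <= rho ^+ 2.
  by move=> h1; rewrite normrX lerXn2r ?nnegrE.
rewrite rE.
apply: (@le_trans _ _ (C * rho ^+ 3 * C + (C + C * rho + C * rho ^+ 2) * (C * rho ^+ 3)
  + C * rho * (C * rho ^+ 2) + C * rho ^+ 2 * (C * rho)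
  + C * rho ^+ 2 * (C * rho ^+ 2))).
  do 4 (apply: (@ler_nD); last by do ?[apply: (@ler_pM4)|apply: (@ler_nD)|apply: (@sq)|done]).
  exact: ler_pM4.
have r3 : 0 <= rho ^+ 3 by rewrite exprn_ge0.
have c2 : 0 <= C ^+ 2 * rho ^+ 3 by rewrite mulr_ge0 ?sqr_ge0.
have := ler_wpM2l c2 rho1.
have := ler_wpM2l c2 (exprn_ile1 2 rho0 rho1).
lra.
Qed.

End SmoothFunctions.

(** * The central limit theorem for a block *)

Section LindebergStep.
Context {R : realType}.

(** The remainder of [smooth2] up to a constant. That [n] times its expectation over one scaled step
    vanishes plays the part of Lindeberg's condition. *)
Definition min23 (v : R * R) : R := minr (enorm v ^+ 2) (enorm v ^+ 3).

Lemma min23_ge0 v : 0 <= min23 v.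
Proof. by rewrite le_min !exprn_ge0// enorm_ge0. Qed.

Lemma min23_le2 v : min23 v <= enorm v ^+ 2.
Proof. by rewrite ge_min lexx. Qed.

Lemma min23_le3 v : min23 v <= enorm v ^+ 3.
Proof. by rewrite ge_min lexx orbT. Qed.

Lemma measurable_min23 : measurable_fun setT min23.
Proof.
by apply: measurable_minr; apply: measurable_funX; exact: measurable_enorm.
Qed.

Section Rv.
Context d (T : measurableType d) (P : probability T R) (X : T -> R * R).
Hypotheses (mX : measurable_fun setT X)
  (iX : intg P (fun w => enorm (X w) ^+ 2)).

Lemma intg_sqr_coord : [/\ intg P (fun w => (X w).1 ^+ 2),
  intg P (fun w => (X w).1 * (X w).2) & intg P (fun w => (X w).2 ^+ 2)].
Proof.
have m1 : measurable_fun setT (fun w => (X w).1) by exact: measurableT_comp.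
have m2 : measurable_fun setT (fun w => (X w).2) by exact: measurableT_comp.
split; apply: (intg_le _ _ iX).
- exact: measurable_funX.
- by move=> w; rewrite sqr_enorm ger0_norm ?sqr_ge0// lerDl sqr_ge0.
- exact: measurable_funM.
- move=> w; rewrite sqr_enorm ler_norml; apply/andP; split.
    by have := sqr_ge0 ((X w).1 + (X w).2); have := sqr_ge0 (X w).1; have := sqr_ge0 (X w).2; lra.
  by have := sqr_ge0 ((X w).1 - (X w).2); have := sqr_ge0 (X w).1; have := sqr_ge0 (X w).2; lra.
- exact: measurable_funX.
- by move=> w; rewrite sqr_enorm ger0_norm ?sqr_ge0// lerDr sqr_ge0.
Qed.

Lemma intg_min23 : intg P (fun w => min23 (X w)).
Proof.
apply: (intg_le _ _ iX); first exact: measurableT_comp measurable_min23 mX.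
by move=> w; rewrite ger0_norm ?min23_ge0// min23_le2.
Qed.

Lemma taylor_Ex (Phi : R * R -> R) C A a b h k m x : measurable_fun setT Phi ->
  (forall v, `|Phi v| <= A) ->
  (forall v : R * R, let r := `|Phi (x + v) - (Phi x + a * v.1
        + b * v.2 + h * v.1 ^+ 2 + k * (v.1 * v.2) + m * v.2 ^+ 2)| in
      r <= C * enorm v ^+ 2 /\ r <= C * enorm v ^+ 3) ->
  `|\int[P]_w Phi (x + X w) - (Phi x + a * (\int[P]_w (X w).1)
     + b * (\int[P]_w (X w).2) + h * (\int[P]_w ((X w).1 ^+ 2))
     + k * (\int[P]_w ((X w).1 * (X w).2)) + m * (\int[P]_w ((X w).2 ^+ 2)))|
  <= C * \int[P]_w min23 (X w).
Proof.
move=> mPhi PhiA hr.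
have [i1 i2] := intg_coord mX iX; have [i11 i12 i22] := intg_sqr_coord.
have iP : intg P (fun w => Phi (x + X w)).
  apply: (@intg_bdd _ _ _ _ _ A) => //.
  by apply: measurableT_comp => //; exact: measurable_addp.
have j0 := intg_cst P (Phi x).
have ja := intgD j0 (intgZ a i1). have jb := intgD ja (intgZ b i2).
have jh := intgD jb (intgZ h i11). have jk := intgD jh (intgZ k i12).
have jm := intgD jk (intgZ m i22).
have E : \int[P]_w (Phi x + a * (X w).1 + b * (X w).2 + h * (X w).1 ^+ 2
   + k * ((X w).1 * (X w).2) + m * (X w).2 ^+ 2) =
   Phi x + a * (\int[P]_w (X w).1)
     + b * (\int[P]_w (X w).2) + h * (\int[P]_w ((X w).1 ^+ 2))
     + k * (\int[P]_w ((X w).1 * (X w).2)) + m * (\int[P]_w ((X w).2 ^+ 2)).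
  rewrite (ExD jk (intgZ m i22)) (ExD jh (intgZ k i12)) (ExD jb (intgZ h i11)).
  rewrite (ExD ja (intgZ b i2)) (ExD j0 (intgZ a i1)).
  by rewrite (ExZ a i1) (ExZ b i2) (ExZ h i11) (ExZ k i12) (ExZ m i22) Ex_cst.
rewrite -E -(ExB iP jm) -ExZ; last exact: intg_min23.
apply: Ex_norm_le.
- exact: intgB iP jm.
- apply: intgZ; exact: intg_min23.
- move=> w; have [h1 h2] := hr (X w).
  by rewrite /min23; case: (leP (enorm (X w) ^+ 2)).
Qed.

End Rv.

(** With equal first and second moments the expected Taylor polynomials coincide, so that only
    remainders are left. [C] is chosen before the laws and the point [x], which lets the errors of
    many steps be added. *)
Lemma lindeberg_step (Phi : R * R -> R) :
  smooth2 Phi -> exists2 C, 0 <= C & forall d (T : measurableType d) (P : probability T R)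
    d' (T' : measurableType d') (Q : probability T' R) (X : T -> R * R) (Y : T' -> R * R),
    measurable_fun setT X -> measurable_fun setT Y ->
    intg P (fun w => enorm (X w) ^+ 2) -> intg Q (fun w => enorm (Y w) ^+ 2) ->
    \int[P]_w (X w).1 = 0 -> \int[P]_w (X w).2 = 0 ->
    \int[Q]_w (Y w).1 = 0 -> \int[Q]_w (Y w).2 = 0 ->
    \int[P]_w ((X w).1 ^+ 2) = \int[Q]_w ((Y w).1 ^+ 2) ->
    \int[P]_w ((X w).1 * (X w).2) = \int[Q]_w ((Y w).1 * (Y w).2) ->
    \int[P]_w ((X w).2 ^+ 2) = \int[Q]_w ((Y w).2 ^+ 2) ->
    forall x, `|\int[P]_w Phi (x + X w) - \int[Q]_w Phi (x + Y w)| <=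
      C * (\int[P]_w min23 (X w) + \int[Q]_w min23 (Y w)).
Proof.
move=> [mPhi [C hC]].
have PhiC v : `|Phi v| <= C by have [] := hC v.
exists C; first exact: le_trans (PhiC 0).
move=> d T P d' T' Q X Y mX mY iX iY X1 X2 Y1 Y2 E11 E12 E22 x.
have [_ [a [b [h [k [m hr]]]]]] := hC x.
have hX := taylor_Ex mX iX mPhi PhiC hr.
have := taylor_Ex mY iY mPhi PhiC hr.
rewrite X1 X2 in hX; rewrite Y1 Y2 -E11 -E12 -E22.
set q := Phi x + _ + _ + _ + _ + _ in hX * => hY.
rewrite mulrDr (le_trans (ler_distD q _ _))// lerD// distrC.
exact: hY.
Qed.

End LindebergStep.

(** * Laws and moments of Brownian increments *)

Section BrownianIncrements.
Context {R : realType} d' (T' : measurableType d') (Q : probability T' R)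
  (b : R -> T' -> R * R).
Hypothesis bm : std_BM2 Q b.

Lemma BM_measurable t : measurable_fun setT (b t).
Proof. by have [_ _ + _] := bm. Qed.

Lemma BM0 w : b 0 w = 0. Proof. by have [+ _ _ _] := bm; apply. Qed.

Lemma gauss2_setT h : gauss2 h setT = 1%E :> \bar R.
Proof.
exact: (probability_setT (normal_prob 0 (Num.sqrt h) \x normal_prob 0 (Num.sqrt h))%E).
Qed.

Lemma BM_steps_law k (ts : nat -> R) j A : ts 0%N = 0 ->
  (forall i, (i < k)%N -> ts i < ts i.+1) -> ts k <= 1 -> (j < k)%N ->
  measurable A ->
  Q [set w | A (b (ts j.+1) w - b (ts j) w)] = gauss2 (ts j.+1 - ts j) A.
Proof.
move=> t0 tS tk jk mA; have [_ _ _ law] := bm.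
have := law k ts (fun i => if i == j then A else setT) t0 tS tk.
rewrite (bigD1 (Ordinal jk))//= eqxx big1 ?mule1.
  move=> <-; last by move=> i; case: ifP.
  congr (Q _); apply/seteqP; split => w /=.
    by move=> Aw i _ /=; case: eqP => // ->.
  by move=> /(_ j jk) /=; rewrite eqxx.
by move=> i ij; rewrite ifN ?gauss2_setT.
Qed.

Lemma BM_law s t A : 0 <= s -> s < t -> t <= 1 -> measurable A ->
  Q [set w | A (b t w - b s w)] = gauss2 (t - s) A.
Proof.
(* The times in [std_BM2] start at 0 and increase strictly, so [s = 0] takes a single step and
   [s > 0] takes two. *)
move=> s0 st t1 mA; have [->|sn0] := eqVneq s 0.
  apply: (@BM_steps_law 1 (fun i => if i is 0%N then 0 else t) 0) => //.
  by move=> [|]// _; lra.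
have {}s0 : 0 < s by rewrite lt_neqAle eq_sym sn0.
apply: (@BM_steps_law 2 (fun i => match i with 0%N => 0 | 1%N => s | _ => t end) 1) => //.
by move=> [|[|]].
Qed.

Section Moments.
Variables (D : T' -> R * R) (h : R).
Hypotheses (mD : measurable_fun setT D) (h0 : 0 < h)
  (lawD : forall A, measurable A -> Q (D @^-1` A) = gauss2 h A).

Local Notation N := (normal_prob 0 (Num.sqrt h) : probability _ R).

Let sh0 : 0 < Num.sqrt h. Proof. by rewrite sqrtr_gt0. Qed.

Let law A : measurable A -> Q (D @^-1` A) = (N \x N)%E (id @^-1` A).
Proof. exact: lawD. Qed.

Let law' A : measurable A -> (N \x N)%E (id @^-1` A) = Q (D @^-1` A).
Proof. by move=> mA; rewrite law. Qed.

Let Ex_prod (f g : R -> R) : measurable_fun setT f -> measurable_fun setT g ->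
  intg N f -> intg N g ->
  intg Q (fun w => f (D w).1 * g (D w).2) /\
  \int[Q]_w (f (D w).1 * g (D w).2) = (\int[N]_x f x) * \int[N]_x g x.
Proof.
move=> mf mg jf jg; have [j2 E2] := Ex_prodM jf jg.
have mm : measurable_fun setT (fun z : R * R => f z.1 * g z.2).
  by apply: measurable_funM; exact: measurableT_comp.
split.
  exact: (@intg_eq_law _ _ _ (N \x N)%E _ _ Q _ _ id D (@measurable_id _ _ _) mD law' _ mm j2).
rewrite -E2.
exact: (@Ex_eq_law _ _ _ Q _ _ (N \x N)%E _ _ D id mD (@measurable_id _ _ _) law _ mm).
Qed.

Let mone : measurable_fun setT (cst 1 : R -> R).
Proof. exact: measurable_cst. Qed.

Let one_l (f : R -> R) : measurable_fun setT f -> intg N f ->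
  intg Q (fun w => f (D w).1) /\ \int[Q]_w f (D w).1 = \int[N]_x f x.
Proof.
move=> mf jf; have [] := Ex_prod mf mone jf (intg_cst _ 1).
rewrite (_ : (fun w => f (D w).1 * cst 1 (D w).2) = (fun w => f (D w).1)).
  by rewrite Ex_cst mulr1.
by apply/funext => w; rewrite mulr1.
Qed.

Let one_r (f : R -> R) : measurable_fun setT f -> intg N f ->
  intg Q (fun w => f (D w).2) /\ \int[Q]_w f (D w).2 = \int[N]_x f x.
Proof.
move=> mf jf; have [] := Ex_prod mone mf (intg_cst _ 1) jf.
rewrite (_ : (fun w => cst 1 (D w).1 * f (D w).2) = (fun w => f (D w).2)).
  by rewrite Ex_cst mul1r.
by apply/funext => w; rewrite mul1r.
Qed.

Let mX n : measurable_fun setT (fun x : R => x ^+ n).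
Proof. exact: measurable_funX. Qed.

Let sqh : Num.sqrt h ^+ 2 = h. Proof. by rewrite sqr_sqrtr// ltW. Qed.

Lemma gauss_mean : \int[Q]_w (D w).1 = 0 /\ \int[Q]_w (D w).2 = 0.
Proof.
have jn := normal_intg_id sh0; have mi := @measurable_id _ R setT.
by have [_ ->] := one_l mi jn; have [_ ->] := one_r mi jn; rewrite (normal_mean sh0).
Qed.

Lemma gauss_second : [/\ intg Q (fun w => (D w).1 ^+ 2), intg Q (fun w => (D w).2 ^+ 2),
  intg Q (fun w => (D w).1 * (D w).2), \int[Q]_w ((D w).1 ^+ 2) = h &
  \int[Q]_w ((D w).2 ^+ 2) = h /\ \int[Q]_w ((D w).1 * (D w).2) = 0].
Proof.
have jn := normal_intg_id sh0; have mi := @measurable_id _ R setT.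
have j2 := normal_intg_sqr sh0.
have [a1 a2] := one_l (mX 2) j2; have [b1 b2] := one_r (mX 2) j2.
have [c1 c2] := Ex_prod mi mi jn jn.
split; [exact: a1|exact: b1|exact: c1| |split].
- by rewrite a2 (normal_sqr sh0) sqh.
- by rewrite b2 (normal_sqr sh0) sqh.
- by rewrite c2 (normal_mean sh0) mul0r.
Qed.

Lemma gauss_fourth : intg Q (fun w => enorm (D w) ^+ 4) /\
  \int[Q]_w (enorm (D w) ^+ 4) <= 256 * h ^+ 2.
Proof.
have [j4 E4] := normal_fourth sh0.
have [a1 a2] := one_l (mX 4) j4; have [b1 b2] := one_r (mX 4) j4.
have le4 w : enorm (D w) ^+ 4 <= 2 * ((D w).1 ^+ 4 + (D w).2 ^+ 4).
  rewrite (exprM _ 2 2) sqr_enorm (exprM (D w).1 2 2) (exprM (D w).2 2 2).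
  have := sqr_ge0 ((D w).1 ^+ 2 - (D w).2 ^+ 2); lra.
have jj := intgZ 2 (intgD a1 b1).
have iD : intg Q (fun w => enorm (D w) ^+ 4).
  apply: (intg_le _ _ jj).
    by apply: measurable_funX; exact: measurableT_comp measurable_enorm mD.
  by move=> w; rewrite ger0_norm ?exprn_ge0 ?enorm_ge0.
split => //; apply: (le_trans (Ex_le iD jj le4)).
rewrite ExZ ?ExD ?a2 ?b2//; last exact: intgD.
have : Num.sqrt h ^+ 4 = h ^+ 2 by rewrite (exprM _ 2 2) sqh.
by move: E4 => /= E4 h4; rewrite h4 in E4; lra.
Qed.

End Moments.
End BrownianIncrements.

Lemma indepn_comp (R : realType) d (T : measurableType d) (P : probability T R)
    d1 (U : measurableType d1) d2 (V : measurableType d2) n (X : nat -> T -> U) (f : U -> V) :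
  measurable_fun setT f -> indepn P n X -> indepn P n (fun i w => f (X i w)).
Proof.
move=> mf [mX iX]; split; first by move=> i; exact: measurableT_comp.
move=> A mA; have := iX (fun i => f @^-1` A i).
by apply => i; rewrite -[_ @^-1` _]setTI; exact: mf.
Qed.

Section MatrixBounds.
Context {R : realType}.

Lemma mxappE (M : 'M[R]_2) x :
  mxapp M x = (M 0 0 * x.1 + M 0 1 * x.2, M 1 0 * x.1 + M 1 1 * x.2).
Proof.
rewrite /mxapp !big_ord_recl !big_ord0 /Defs.coord /= !addr0.
have -> : lift ord0 ord0 = 1 :> 'I_2 by apply/val_inj.
by have -> : ord_max = 1 :> 'I_2 by apply/val_inj.
Qed.

Lemma measurable_mxapp (M : 'M[R]_2) : measurable_fun setT (mxapp M).
Proof.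
rewrite (_ : mxapp M = fun x => (M 0 0 * x.1 + M 0 1 * x.2, M 1 0 * x.1 + M 1 1 * x.2)).
  by apply: measurable_fun_pair; apply: measurable_funD; exact: measurable_funM.
by apply/funext => x; rewrite mxappE.
Qed.

Definition mxnorm (M : 'M[R]_2) : R := `|M 0 0| + `|M 0 1| + `|M 1 0| + `|M 1 1|.

Lemma mxnorm_ge0 M : 0 <= mxnorm M. Proof. by rewrite /mxnorm !addr_ge0. Qed.

Lemma enorm_mxapp M x : enorm (mxapp M x) <= mxnorm M * enorm x.
Proof.
rewrite mxappE (le_trans (enorm_le_add _))//=.
have h1 := enorm_ge1 x; have h2 := enorm_ge2 x.
have tri (p q : R) : `|p * x.1 + q * x.2| <= (`|p| + `|q|) * enorm x.
  rewrite (le_trans (ler_normD _ _))// !normrM mulrDl.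
  by apply: lerD; apply: ler_wpM2l.
by rewrite (le_trans (lerD (tri _ _) (tri _ _)))// -mulrDl /mxnorm addrA.
Qed.

Lemma continuous_mxapp (M : 'M[R]_2) : continuous (mxapp M).
Proof.
move=> x; apply/cvgrPdist_lt => e e0.
have K0 : 0 < mxnorm M + 1 by rewrite ltr_wpDl ?mxnorm_ge0.
have e1 : 0 < e / (2 * (mxnorm M + 1)) by rewrite divr_gt0// mulr_gt0.
have cx : id y @[y --> x] --> x by exact: cvg_id.
near=> y; rewrite -mxappB (le_lt_trans (le_norm_enorm _))//.
rewrite (le_lt_trans (enorm_mxapp _ _))//.
have xy : `|x - y| < e / (2 * (mxnorm M + 1)).
  by near: y; exact: cvgr_dist_lt cx _ e1.
rewrite ltr_pdivlMr ?mulr_gt0// in xy.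
rewrite (le_lt_trans _ xy)// mulrCA mulrA mulrC.
apply: ler_pM; rewrite ?mxnorm_ge0 ?enorm_ge0// ?lerDl//.
exact: enorm_le_norm.
Unshelve. all: by end_near. Qed.

End MatrixBounds.

(** * Comparison of the scaled walk with Brownian motion over a block *)

Section Donsker.
Context {R : realType} d (T : measurableType d) (P : probability T R)
  (Z : nat -> T -> R * R) d' (T' : measurableType d') (Q : probability T' R)
  (b : R -> T' -> R * R) (S : 'M[R]_2).
Hypotheses (iidZ : iid_seq P Z)
  (Z2 : (\int[P]_w ((enorm (Z 0%N w)) ^+ 2)%:E < +oo)%E)
  (meanZ : forall i, meanv P (Z 0%N) i = 0)
  (bm : std_BM2 Q b) (psdS : psd2 S) (covS : S *m S = covmx P (Z 0%N)).

Definition steps n (i : nat) w : R * R := (Num.sqrt n%:R)^-1 *: Z i w.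
(** Increments of the transformed path over the mesh [1 / n]; their mean and covariance are those of
    [steps n i]. *)
Definition bsteps n (i : nat) w : R * R :=
  mxapp S (b (i.+1%:R / n%:R) w - b (i%:R / n%:R) w).

Let mZ i : measurable_fun setT (Z i). Proof. by case: iidZ. Qed.

Lemma intg_Z2 i : intg P (fun w => enorm (Z i w) ^+ 2).
Proof.
have [_ law _] := iidZ.
have law' A : measurable A -> P (Z 0%N @^-1` A) = P (Z i @^-1` A).
  by move=> mA; rewrite law.
have me : measurable_fun setT (fun x : R * R => enorm x ^+ 2).
  by apply: measurable_funX; exact: measurable_enorm.
apply: (intg_eq_law (mZ 0%N) (mZ i) law' me).
apply/integrableP; split.
  apply/measurable_EFinP; apply: measurable_funX.
  exact: measurableT_comp measurable_enorm (mZ _).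
by under eq_integral do rewrite /= ger0_norm ?sqr_ge0//.
Qed.

Lemma Ex_Z i (g : R * R -> R) : measurable_fun setT g ->
  \int[P]_w g (Z i w) = \int[P]_w g (Z 0%N w).
Proof.
have [_ law _] := iidZ.
by move=> mg; exact: (Ex_eq_law (mZ i) (mZ 0%N) (law i) mg).
Qed.

Lemma mean_Z i : \int[P]_w (Z i w).1 = 0 /\ \int[P]_w (Z i w).2 = 0.
Proof.
rewrite (Ex_Z i measurable_fst) (Ex_Z i measurable_snd).
by split; [exact: (meanZ 0)|exact: (meanZ 1)].
Qed.

(** The right sides are the entries of [S *m S^T], the form in which the Brownian covariances
    appear. Symmetry of [S] identifies it with [S *m S]. *)
Lemma cov_Z i : [/\ \int[P]_w ((Z i w).1 ^+ 2) = S 0 0 ^+ 2 + S 0 1 ^+ 2,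
  \int[P]_w ((Z i w).1 * (Z i w).2) = S 0 0 * S 1 0 + S 0 1 * S 1 1 &
  \int[P]_w ((Z i w).2 ^+ 2) = S 1 0 ^+ 2 + S 1 1 ^+ 2].
Proof.
have m1 : measurable_fun setT (fun x : R * R => x.1 ^+ 2).
  by apply: measurable_funX; exact: measurable_fst.
have m2 : measurable_fun setT (fun x : R * R => x.2 ^+ 2).
  by apply: measurable_funX; exact: measurable_snd.
have m12 : measurable_fun setT (fun x : R * R => x.1 * x.2).
  by apply: measurable_funM; [exact: measurable_fst|exact: measurable_snd].
rewrite (Ex_Z i m1) (Ex_Z i m2) (Ex_Z i m12).
have [symS _] := psdS.
have E k l : (S *m S) k l = \int[P]_w (Defs.coord (Z 0%N w) k * Defs.coord (Z 0%N w) l).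
  rewrite covS /covmx mxE; congr fine; apply: eq_integral => w _.
  by rewrite !meanZ !subr0.
have S10 : S 1 0 = S 0 1 by have /matrixP/(_ 0 1) := symS; rewrite mxE.
have E' k l : (S *m S) k l = S k 0 * S 0 l + S k 1 * S 1 l.
  rewrite mxE !big_ord_recl big_ord0 addr0.
  by have -> : lift ord0 ord0 = 1 :> 'I_2 by apply/val_inj.
have := E 0 0; have := E 0 1; have := E 1 1; rewrite !E' /Defs.coord/= S10.
move=> e11 e01 e00; split.
- by rewrite !expr2 e00; apply: eq_Rintegral => w _; rewrite expr2.
- by rewrite e01.
- by rewrite !expr2 e11; apply: eq_Rintegral => w _; rewrite expr2.
Qed.

Lemma indepn_Z n : indepn P n Z.
Proof.
have [mz _ law] := iidZ; split => // A mA.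
have := law (iota 0 n) A (iota_uniq 0 n) mA.
move=> lawn; rewrite -(big_mkord xpredT (fun i => P (Z i @^-1` A i))) /index_iota subn0 -lawn.
by have -> : [set i | (i < n)%N] = [set` iota 0 n];
  [apply/seteqP; split => i /=; rewrite mem_iota|].
Qed.

Lemma indepn_steps n : indepn P n (steps n).
Proof.
have mf : measurable_fun setT (fun x : R * R => (Num.sqrt n%:R)^-1 *: x).
  exact: measurable_scalep.
exact: (indepn_comp mf (indepn_Z n)).
Qed.

Lemma indepn_bsteps n : (0 < n)%N -> indepn Q n (bsteps n).
Proof.
move=> n0.
suff iD : indepn Q n (fun i w => b (i.+1%:R / n%:R) w - b (i%:R / n%:R) w).
  exact: (indepn_comp (measurable_mxapp S) iD).
have nn0 : 0 < n%:R^-1 :> R by rewrite invr_gt0 ltr0n.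
split.
  move=> i; under eq_fun do rewrite -scaleN1r.
  apply: measurable_addp; first exact: (BM_measurable bm).
  by apply: measurable_scalep; exact: (BM_measurable bm).
move=> A mA; have [_ _ _ law] := bm.
have t0 : 0%:R / n%:R = 0 :> R by rewrite mul0r.
have tS i : (i < n)%N -> i%:R / n%:R < i.+1%:R / n%:R :> R.
  by move=> _; rewrite ltr_pM2r// ltr_nat.
have t1 : n%:R / n%:R <= 1 :> R by rewrite divff// pnatr_eq0 -lt0n.
have := law n (fun i => i%:R / n%:R) A t0 tS t1 mA => /= ->.
apply: eq_bigr => i _; rewrite -(BM_steps_law bm t0 tS t1 (ltn_ord i) (mA i)).
by [].
Qed.

Lemma bsum_bsteps n k l w : (k <= l)%N ->
  bsum (bsteps n) k l w = mxapp S (b (l%:R / n%:R) w - b (k%:R / n%:R) w).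
Proof.
elim: l => [|l ih]; first by rewrite leqn0 => /eqP ->; rewrite bsumnn subrr mxapp0.
rewrite leq_eqVlt => /predU1P[->|]; first by rewrite bsumnn subrr mxapp0.
rewrite ltnS => kl; rewrite bsumSr// ih// /bsteps -mxappD.
by congr mxapp; rewrite addrC addrA subrK.
Qed.

(** The trace of the covariance matrix, as the squared Frobenius norm of its root. *)
Definition sig2 := S 0 0 ^+ 2 + S 0 1 ^+ 2 + (S 1 0 ^+ 2 + S 1 1 ^+ 2).

Lemma sig2_ge0 : 0 <= sig2. Proof. by rewrite /sig2 !addr_ge0// sqr_ge0. Qed.

Let sqrtn n : (0 < n)%N -> ((Num.sqrt n%:R)^-1) ^+ 2 = n%:R^-1 :> R.
Proof. by move=> n0; rewrite exprVn sqr_sqrtr. Qed.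

Lemma steps_moments n i : (0 < n)%N ->
  [/\ intg P (fun w => enorm (steps n i w) ^+ 2),
   \int[P]_w (steps n i w).1 = 0 /\ \int[P]_w (steps n i w).2 = 0,
   \int[P]_w ((steps n i w).1 ^+ 2) = n%:R^-1 * (S 0 0 ^+ 2 + S 0 1 ^+ 2),
   \int[P]_w ((steps n i w).1 * (steps n i w).2) = n%:R^-1 * (S 0 0 * S 1 0 + S 0 1 * S 1 1) &
   \int[P]_w ((steps n i w).2 ^+ 2) = n%:R^-1 * (S 1 0 ^+ 2 + S 1 1 ^+ 2)].
Proof.
move=> n0; set c := (Num.sqrt n%:R)^-1 : R.
have c2 : c ^+ 2 = n%:R^-1 by exact: sqrtn.
have iZ := intg_Z2 i; have [i1 i2] := intg_coord (mZ i) iZ.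
have [i11 i12 i22] := intg_sqr_coord (mZ i) iZ.
have [m1 m2] := mean_Z i; have [e11 e12 e22] := cov_Z i.
split.
- have := intgZ (c ^+ 2) iZ; apply: eq_integrable => // w _ /=.
  by rewrite /steps enormZ exprMn real_normK ?num_real.
- split; first by rewrite -[RHS](mulr0 c) -m1 -ExZ.
  by rewrite -[RHS](mulr0 c) -m2 -ExZ.
- rewrite -e11 -c2 -ExZ//; apply: eq_Rintegral => w _; exact: exprMn.
- rewrite -e12 -c2 -ExZ//; apply: eq_Rintegral => w _.
  by rewrite expr2 mulrACA.
- rewrite -e22 -c2 -ExZ//; apply: eq_Rintegral => w _; exact: exprMn.
Qed.

Section BrownianMoments.
Variables s t : R.
Hypotheses (s0 : 0 <= s) (st : s < t) (t1 : t <= 1).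
Let D w := b t w - b s w.
Let V w := mxapp S (D w).

Let mD : measurable_fun setT D.
Proof.
rewrite /D; under eq_fun do rewrite -scaleN1r.
apply: measurable_addp; first exact: (BM_measurable bm).
by apply: measurable_scalep; exact: (BM_measurable bm).
Qed.

Let lawD A : measurable A -> Q (D @^-1` A) = gauss2 (t - s) A.
Proof. exact: (BM_law bm s0 st t1). Qed.

Let h0 : 0 < t - s. Proof. by rewrite subr_gt0. Qed.

Lemma bm_increment_measurable : measurable_fun setT V.
Proof. by apply: measurableT_comp => //; exact: measurable_mxapp. Qed.

Lemma bm_increment_moments : [/\ intg Q (fun w => enorm (V w) ^+ 2),
   \int[Q]_w (V w).1 = 0 /\ \int[Q]_w (V w).2 = 0,
   \int[Q]_w ((V w).1 ^+ 2) = (t - s) * (S 0 0 ^+ 2 + S 0 1 ^+ 2),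
   \int[Q]_w ((V w).1 * (V w).2) = (t - s) * (S 0 0 * S 1 0 + S 0 1 * S 1 1) &
   \int[Q]_w ((V w).2 ^+ 2) = (t - s) * (S 1 0 ^+ 2 + S 1 1 ^+ 2)].
Proof.
have [m1 m2] := gauss_mean mD h0 lawD.
have [i11 i22 i12 e11 [e22 e12]] := gauss_second mD h0 lawD.
have iD : intg Q (fun w => enorm (D w) ^+ 2).
  by have := intgD i11 i22; apply: eq_integrable => // w _ /=; rewrite sqr_enorm.
have [i1 i2] := intg_coord mD iD.
have lin p q : \int[Q]_w (p * (D w).1 + q * (D w).2) = 0.
  rewrite ExD ?ExZ//; [|exact: intgZ|exact: intgZ].
  by rewrite m1 m2 !mulr0 addr0.
have quad p q p' q' :
    \int[Q]_w ((p * (D w).1 + q * (D w).2) * (p' * (D w).1 + q' * (D w).2)) =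
    (t - s) * (p * p' + q * q').
  have E w : (p * (D w).1 + q * (D w).2) * (p' * (D w).1 + q' * (D w).2) =
      p * p' * (D w).1 ^+ 2 + q * q' * (D w).2 ^+ 2
      + (p * q' + q * p') * ((D w).1 * (D w).2) by ring.
  under eq_Rintegral do rewrite E.
  have ja := intgZ (p * p') i11; have jb := intgZ (q * q') i22.
  have jc := intgZ (p * q' + q * p') i12.
  rewrite (ExD (intgD ja jb) jc) (ExD ja jb) !ExZ// e11 e22 e12; ring.
have VE w : V w = (S 0 0 * (D w).1 + S 0 1 * (D w).2, S 1 0 * (D w).1 + S 1 1 * (D w).2).
  by rewrite /V mxappE.
split.
- apply: (intg_le _ _ (intgZ (mxnorm S ^+ 2) iD)).
    apply: measurable_funX; exact: measurableT_comp measurable_enorm bm_increment_measurable.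
  move=> w; rewrite ger0_norm ?sqr_ge0// -exprMn.
  by rewrite lerXn2r ?nnegrE ?enorm_ge0 ?mulr_ge0 ?mxnorm_ge0 ?enorm_ge0 ?enorm_mxapp.
- by split; under eq_Rintegral do rewrite VE/=; exact: lin.
- by under eq_Rintegral do rewrite VE/= expr2; rewrite quad -!expr2.
- by under eq_Rintegral do rewrite VE/=; rewrite quad.
- by under eq_Rintegral do rewrite VE/= expr2; rewrite quad -!expr2.
Qed.

Lemma bm_increment_fourth : intg Q (fun w => enorm (V w) ^+ 4) /\
  \int[Q]_w (enorm (V w) ^+ 4) <= 256 * mxnorm S ^+ 4 * (t - s) ^+ 2.
Proof.
have [i4 e4] := gauss_fourth mD h0 lawD.
have le4 w : enorm (V w) ^+ 4 <= mxnorm S ^+ 4 * enorm (D w) ^+ 4.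
  rewrite -exprMn.
  by rewrite lerXn2r ?nnegrE ?enorm_ge0 ?mulr_ge0 ?mxnorm_ge0 ?enorm_ge0 ?enorm_mxapp.
have iV : intg Q (fun w => enorm (V w) ^+ 4).
  apply: (intg_le _ _ (intgZ (mxnorm S ^+ 4) i4)).
    apply: measurable_funX; exact: measurableT_comp measurable_enorm bm_increment_measurable.
  by move=> w; rewrite ger0_norm ?exprn_ge0 ?enorm_ge0.
split => //; apply: (le_trans (Ex_le iV (intgZ _ i4) le4)).
rewrite ExZ// [leRHS](_ : _ = mxnorm S ^+ 4 * (256 * (t - s) ^+ 2)); last ring.
by rewrite ler_wpM2l// exprn_ge0 ?mxnorm_ge0.
Qed.

End BrownianMoments.

Let grid n i : (i < n)%N -> [/\ 0 <= i%:R / n%:R :> R,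
  i%:R / n%:R < i.+1%:R / n%:R :> R & i.+1%:R / n%:R <= 1 :> R].
Proof.
move=> il; have n0 : 0 < n%:R :> R by rewrite ltr0n (leq_ltn_trans _ il).
split; first by rewrite divr_ge0.
  by rewrite ltr_pM2r ?invr_gt0// ltr_nat.
by rewrite ler_pdivrMr// mul1r ler_nat.
Qed.

Let gridB n i : (0 < n)%N -> i.+1%:R / n%:R - i%:R / n%:R = n%:R^-1 :> R.
Proof. by move=> n0; rewrite -mulrBl -natr1 addrC addKr mul1r. Qed.

(** By scaling, the integrand is the minimum of [|Z|^2] and [|Z|^3 / sqrt n]. It tends to 0
    pointwise and is dominated by [|Z|^2]. *)
Lemma Ex_min23_steps : n%:R * (\int[P]_w min23 (steps n 0%N w)) @[n --> \oo] --> 0.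
Proof.
pose f n w := n%:R * min23 (steps n 0%N w).
have mst n : measurable_fun setT (steps n 0%N) by apply: measurable_scalep; exact: mZ.
(* The conditional covers [n = 0], where the factor [n] makes the first argument 0. *)
have fE n w : f n w = minr (if n == 0%N then 0 else enorm (Z 0%N w) ^+ 2)
   ((Num.sqrt n%:R)^-1 * enorm (Z 0%N w) ^+ 3).
  rewrite /f /min23 minr_pMr// /steps enormZ.
  have [->|n0] := posnP n.
    by rewrite /= !mul0r sqrtr0 invr0 mul0r.
  have sn : 0 < Num.sqrt n%:R :> R by rewrite sqrtr_gt0 ltr0n.
  have nE : n%:R = Num.sqrt n%:R ^+ 2 :> R by rewrite sqr_sqrtr.
  rewrite ger0_norm ?invr_ge0 ?(ltW sn)// {1 3}nE.
  by congr minr; field; rewrite gt_eqF.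
have -> : (fun n => n%:R * \int[P]_w min23 (steps n 0%N w)) =
    (fun n => \int[P]_w f n w).
  apply/funext => -[|n]; last first.
    by rewrite -ExZ//; apply: intg_min23 => //; have [] := steps_moments 0%N (ltn0Sn n).
  rewrite mul0r -[LHS](Ex_cst P); apply: eq_Rintegral => w _.
  by rewrite /f mul0r.
rewrite -(Ex_cst P 0); apply: (Ex_dct (g := fun w => enorm (Z 0%N w) ^+ 2)).
- move=> n; apply: measurable_funM => //.
  exact: measurableT_comp measurable_min23 (mst n).
- move=> w; apply: (@squeeze_cvgr _ _ _ _ (cst 0)
    (fun n => (Num.sqrt n%:R)^-1 * enorm (Z 0%N w) ^+ 3)).
  + near=> n; rewrite /f mulr_ge0 ?min23_ge0//=.
    by rewrite -/(f n w) fE ge_min lexx orbT.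
  + exact: cvg_cst.
  + rewrite -(mul0r (enorm (Z 0%N w) ^+ 3)); apply: cvgMl.
    apply/cvgrPdist_lt => e e0; near=> n.
    have sn : 0 < Num.sqrt n%:R :> R.
      by rewrite sqrtr_gt0; near: n; exact: nbhs_infty_gtr.
    rewrite sub0r normrN ger0_norm ?invr_ge0 ?(ltW sn)//.
    rewrite invf_plt// -(@ltr_pXn2r _ 2)// ?nnegrE ?invr_ge0 ?(ltW e0) ?(ltW sn)//.
    rewrite sqr_sqrtr//; near: n; exact: nbhs_infty_gtr.
- move=> n w; rewrite ger0_norm ?mulr_ge0 ?min23_ge0// -/(f n w) fE ge_min.
  by case: ifP; rewrite ?sqr_ge0 ?lexx.
- exact: intg_Z2.
Unshelve. all: by end_near. Qed.

Lemma Ex_min23_bsteps n i : (i < n)%N -> n%:R * (\int[Q]_w min23 (bsteps n i w)) <=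
  (sig2 + 256 * mxnorm S ^+ 4) / Num.sqrt n%:R.
Proof.
move=> il; have [g0 g1 g2] := grid il; have n0 := leq_ltn_trans (leq0n i) il.
have [i2 _ e11 _ e22] := bm_increment_moments g0 g1 g2.
have [i4 e4] := bm_increment_fourth g0 g1 g2.
have mV := bm_increment_measurable (i%:R / n%:R) (i.+1%:R / n%:R).
have [i11 _ i22] := intg_sqr_coord mV i2.
rewrite gridB// in e11 e22 e4.
pose eta := Num.sqrt n%:R : R.
have eta0 : 0 < eta by rewrite sqrtr_gt0 ltr0n.
have etaE : n%:R = eta ^+ 2 by rewrite sqr_sqrtr.
(* Arithmetic-geometric mean for the cube. The weight [eta = sqrt n] balances a second moment of
   order [1/n] against a fourth moment of order [1/n^2]. *)
have le3 w : min23 (bsteps n i w) <=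
    eta^-1 * enorm (bsteps n i w) ^+ 2 + eta * enorm (bsteps n i w) ^+ 4.
  rewrite (le_trans (min23_le3 _))//; set e := enorm _.
  rewrite -(ler_pM2l eta0) mulrDr !mulrA divff ?gt_eqF// mul1r -expr2.
  have := sqr_ge0 (1 - eta * e); have := sqr_ge0 e; have := sqr_ge0 (e - eta * e ^+ 2).
  nra.
have jj := intgD (intgZ eta^-1 i2) (intgZ eta i4).
have := Ex_le (intg_min23 mV i2) jj le3.
rewrite (ExD (intgZ eta^-1 i2) (intgZ eta i4)) !ExZ//.
have -> : \int[Q]_w (enorm (mxapp S (b (i.+1%:R / n%:R) w - b (i%:R / n%:R) w)) ^+ 2)
    = n%:R^-1 * sig2.
  under eq_Rintegral do rewrite sqr_enorm.
  by rewrite ExD// e11 e22 -mulrDr.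
move=> h.
rewrite -(@ler_pM2l _ n%:R) ?ltr0n// in h.
apply: (le_trans h); rewrite -/eta; rewrite etaE in e4 *.
rewrite mulrDr mulrDl lerD//.
  by rewrite le_eqVlt; apply/orP; left; apply/eqP; field; rewrite gt_eqF.
apply: (@le_trans _ _ (eta ^+ 2 * (eta * (256 * mxnorm S ^+ 4 * (eta ^+ 2)^-1 ^+ 2)))).
  by rewrite ler_pM2l ?exprn_gt0// ler_pM2l.
by rewrite le_eqVlt; apply/orP; left; apply/eqP; field; rewrite gt_eqF.
Qed.

Lemma Ex_steps n i (g : R * R -> R) : measurable_fun setT g ->
  \int[P]_w g (steps n i w) = \int[P]_w g (steps n 0%N w).
Proof.
move=> mg; apply: (Ex_Z i (g := fun x => g ((Num.sqrt n%:R)^-1 *: x))).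
by apply: measurableT_comp => //; exact: measurable_scalep.
Qed.

(** The error is uniform in the block: at most [n] replacements cost [del n] each, and [n * del n]
    tends to 0. *)
Lemma block_clt (Phi : R * R -> R) : smooth2 Phi ->
  exists2 err : nat -> R, err n @[n --> \oo] --> 0 &
  forall n k l, (0 < n)%N -> (k <= l)%N -> (l <= n)%N ->
  `|\int[P]_w Phi (bsum (steps n) k l w) - \int[Q]_w Phi (bsum (bsteps n) k l w)| <= err n.
Proof.
move=> sPhi; have [C C0 step] := lindeberg_step sPhi.
have [mPhi [A hA]] := sPhi.
have PhiA v : `|Phi v| <= A by have [] := hA v.
pose K := sig2 + 256 * mxnorm S ^+ 4.
pose del n := C * (\int[P]_w min23 (steps n 0%N w) + K / Num.sqrt n%:R / n%:R).
exists (fun n => n%:R * del n).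
  have sq0 : (Num.sqrt n%:R)^-1 @[n --> \oo] --> (0 : R).
    apply/cvgrPdist_lt => e e0; near=> n.
    have sn : 0 < Num.sqrt n%:R :> R.
      by rewrite sqrtr_gt0; near: n; exact: nbhs_infty_gtr.
    rewrite sub0r normrN ger0_norm ?invr_ge0 ?(ltW sn)//.
    rewrite invf_plt// -(@ltr_pXn2r _ 2)// ?nnegrE ?invr_ge0 ?(ltW e0) ?(ltW sn)//.
    rewrite sqr_sqrtr//; near: n; exact: nbhs_infty_gtr.
  have lim : C * (n%:R * (\int[P]_w min23 (steps n 0%N w)) + K * (Num.sqrt n%:R)^-1)
      @[n --> \oo] --> C * (0 + K * 0).
    apply: cvgMr; apply: cvgD; first exact: Ex_min23_steps.
    by apply: cvgMr.
  rewrite mulr0 addr0 mulr0 in lim; apply: cvg_trans lim.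
  apply: near_eq_cvg; near=> n.
  have n0 : 0 < n%:R :> R by near: n; exact: nbhs_infty_gtr.
  by rewrite /del; field; rewrite gt_eqF// gt_eqF// sqrtr_gt0.
move=> n k l n0 kl ln.
have nn0 : 0 < n%:R :> R by rewrite ltr0n.
have iX := indepn_steps n; have iY := indepn_bsteps n0.
have cl i : (i < n)%N -> forall x,
    `|\int[P]_w Phi (x + steps n i w) - \int[Q]_w Phi (x + bsteps n i w)| <= del n.
  move=> il x.
  have [iX2 [X1 X2] X11 X12 X22] := steps_moments i n0.
  have [g0 g1 g2] := grid il.
  have [iY2 [Y1 Y2] Y11 Y12 Y22] := bm_increment_moments g0 g1 g2.
  rewrite gridB// in Y11 Y12 Y22.
  have [mX _] := iX; have [mY _] := iY.
  have := step _ _ P _ _ Q _ _ (mX i) (mY i) iX2 iY2 X1 X2 Y1 Y2.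
  rewrite X11 X12 X22 Y11 Y12 Y22 => /(_ erefl erefl erefl x) /le_trans; apply.
  rewrite /del ler_wpM2l// (Ex_steps n i measurable_min23) lerD2l.
  by rewrite ler_pdivlMr// mulrC; exact: Ex_min23_bsteps.
have del0 : 0 <= del n.
  by apply: le_trans (cl 0%N n0 0).
have := trotter iX iY mPhi PhiA cl 0 kl ln.
under eq_Rintegral do rewrite add0r.
under [X in _ - X]eq_Rintegral do rewrite add0r.
by move/le_trans; apply; rewrite ler_wpM2r// ler_nat (leq_trans (leq_subr _ _)).
Unshelve. all: by end_near. Qed.

End Donsker.

(** * Path functionals and finite-dimensional convergence *)

Section Discretisation.
Context {R : realType} d (T : measurableType d).

Lemma measurable_countable_comp (I : countType) (c : T -> I) (g : I -> R) :
  (forall z, measurable (c @^-1` [set z])) -> measurable_fun setT (g \o c).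
Proof.
move=> mc _ B mB; rewrite setTI.
have -> : (g \o c) @^-1` B = \bigcup_n
    (if unpickle n is Some z then (if `[< B (g z) >] then c @^-1` [set z] else set0)
     else set0).
  apply/seteqP; split => [w /= Bw|w [n _]].
    by exists (pickle (c w)) => //; rewrite pickleK; case: asboolP.
  by case: unpickle => // z; case: asboolP => // Bz /= ->.
apply: bigcupT_measurable => n; case: unpickle => // z.
by case: ifP => // _; exact: mc.
Qed.

Let round k (x : R) : R := (Num.floor (k.+1%:R * x))%:~R / k.+1%:R.

Let round_dist k x : `|round k x - x| <= k.+1%:R^-1.
Proof.
have k0 : 0 < k.+1%:R :> R by [].
have /andP[h1 h2] := floor_itv (k.+1%:R * x).
rewrite -(@ler_pM2l _ k.+1%:R)// divff ?gt_eqF// -[X in X * `|_|](gtr0_norm k0) -normrM.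
rewrite mulrBr mulrC divfK ?gt_eqF// ler_norml.
by move: h2; rewrite intrD; lra.
Qed.

(** Rounding the points to a grid turns [F] into a function of a countable code, measurable whatever
    [F] is; by continuity these functions converge pointwise as the grid is refined. *)
Lemma measurable_path_fun N (F : (nat -> R * R) -> R) (X : nat -> T -> R * R) :
  (forall i, measurable_fun setT (X i)) ->
  (forall u (e : R), 0 < e -> exists2 del : R, 0 < del & forall v,
     (forall i, (i < N)%N -> enorm (u i - v i) < del) -> `|F u - F v| < e) ->
  measurable_fun setT (fun w => F (fun i => X i w)).
Proof.
move=> mX cF.
(* The modulus of continuity looks at indices below [N] only, so [F] depends on nothing else and a
   finite code determines its value. *)
have loc u v : (forall i, (i < N)%N -> u i = v i) -> F u = F v.
  move=> uv; apply/eqP; rewrite -subr_eq0 -normr_le0; apply/ler_addgt0Pl => e e0.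
  rewrite addr0; have [del del0 h] := cF u e e0; apply/ltW/h => i iN.
  by rewrite uv// subrr enorm0.
pose D k (x : R * R) := (round k x.1, round k x.2).
apply: (measurable_fun_cvg (h := fun k w => F (fun i => D k (X i w)))).
  move=> k.
  pose code w : {ffun 'I_N -> int * int} := [ffun i : 'I_N =>
    (Num.floor (k.+1%:R * (X i w).1), Num.floor (k.+1%:R * (X i w).2))].
  pose g (z : {ffun 'I_N -> int * int}) : R := F (fun i => if insub i is Some j
    then ((z j).1%:~R / k.+1%:R, (z j).2%:~R / k.+1%:R) else 0).
  rewrite (_ : (fun w => _) = g \o code); last first.
    apply/funext => w; apply: loc => i iN.
    by rewrite insubT/= ffunE.
  apply: measurable_countable_comp => z.
  have -> : code @^-1` [set z] = \bigcap_(i : 'I_N)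
     ([set w | Num.floor (k.+1%:R * (X i w).1) = (z i).1] `&`
      [set w | Num.floor (k.+1%:R * (X i w).2) = (z i).2]).
    apply/seteqP; split => [w /= <- i _|w /= h]; first by rewrite !ffunE.
    by apply/ffunP => i; have [h1 h2] := h i I; rewrite ffunE h1 h2 -surjective_pairing.
  have mfl (f : T -> R) (m : int) : measurable_fun setT f ->
      measurable [set w | Num.floor (k.+1%:R * f w) = m].
    move=> mf.
    rewrite [X in measurable X](_ : _ = (fun w => k.+1%:R * f w) @^-1` `[m%:~R, (m + 1)%:~R[%classic).
      rewrite -[X in measurable X]setTI.
      by apply: measurable_funM => //; exact: measurable_itv.
    apply/seteqP; split => w /=; rewrite in_itv/=.
      by move=> <-; exact: floor_itv.
    by move=> h; apply: floor_def.
  apply: fin_bigcap_measurable => [|i _]; first exact: finite_finset.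
  by apply: measurableI; apply: mfl; apply: measurableT_comp => //; exact: mX.
move=> w _; apply/cvgrPdist_lt => e e0.
have [del del0 h] := cF (fun i => X i w) e e0.
near=> k; apply: h => i _.
rewrite (le_lt_trans (enorm_le_add _))//=.
have kd : k.+1%:R^-1 < del / 2.
  near: k.
  have : (fun n => n.+1%:R^-1 : R) @ \oo --> (0 : R) by exact: cvg_harmonic.
  move/cvgrPdist_lt => /(_ (del / 2)); rewrite divr_gt0// => /(_ isT).
  apply: filterS => k; rewrite sub0r normrN ger0_norm//.
have h1 := round_dist k (X i w).1; have h2 := round_dist k (X i w).2.
rewrite distrC in h1; rewrite distrC in h2.
by rewrite (le_lt_trans (lerD h1 h2))// [ltRHS]splitr ltrD.
Unshelve. all: by end_near. Qed.

End Discretisation.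

Section UniformPath.
Context {R : realType}.

Lemma near_invn_lt (e : R) : 0 < e -> \forall n \near \oo, n%:R^-1 < e.
Proof.
move=> e0; near=> n.
have n0 : 0 < n%:R :> R by near: n; exact: nbhs_infty_gtr.
by rewrite invf_plt ?posrE//; near: n; exact: nbhs_infty_gtr.
Unshelve. all: by end_near. Qed.

(** The Heine-Cantor theorem, with modulus [1 / n] to match the grids; compactness enters as a
    near-covering property. *)
Lemma path_modulus (p : R -> R * R) (e : R) : {within `[0, 1], continuous p} ->
  0 < e -> \forall n \near \oo, forall s t : R, 0 <= s <= 1 -> 0 <= t <= 1 ->
    `|s - t| <= n%:R^-1 -> enorm (p s - p t) <= e.
Proof.
move=> cp e0.
have cI : compact (`[0, 1]%classic : set R) by exact: segment_compact.
pose good (n : nat) (x : R) := x \in `[0, 1] -> forall s : R, 0 <= s <= 1 ->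
  `|s - x| <= n%:R^-1 -> enorm (p s - p x) <= e.
have loc (x : R) : `[0, 1]%classic x -> exists2 del : R, 0 < del & forall y : R, 0 <= y <= 1 ->
    `|x - y| < del -> enorm (p x - p y) <= e / 2.
  move=> Ax; have e4 : 0 < e / 4 by rewrite divr_gt0.
  have /cvgrPdist_lt/(_ _ e4) := cp x.
  rewrite {1}/nbhs/= -nbhs_subspace_in// => -[del /= del0 h].
  exists del => // y y01 xy; rewrite (le_trans (enorm_le_norm _))//.
  have : `|p x - p y| < e / 4 by apply: h => //; rewrite /= in_itv.
  lra.
have cov (x : R) : `[0, 1]%classic x -> \forall x' \near x & n \near \oo, good n x'.
  move=> Ax; have [del del0 h] := loc x Ax.
  have d2 : 0 < del / 2 by rewrite divr_gt0.
  have cx : id y @[y --> x] --> x by exact: cvg_id.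
  near=> x' n => x'A s s01 sx'.
  have xx' : `|x - x'| < del / 2 by near: x'; exact: cvgr_dist_lt cx _ d2.
  have nd : n%:R^-1 < del / 2 by near: n; exact: near_invn_lt.
  have x'01 : 0 <= x' <= 1 by move: x'A; rewrite in_itv.
  have xs : `|x - s| < del.
    rewrite (le_lt_trans (ler_distD x' _ _))// (distrC x' s); lra.
  have h1 := h _ x'01 (lt_trans xx' _); have h2 := h _ s01 xs.
  rewrite (le_trans (enormDB _ (p x) _))// (enormC (p s)).
  by have := h1 ltac:(lra); lra.
have : \forall n \near \oo, `[0, 1]%classic `<=` good n.
  by move/compact_near_coveringP : cI; apply; exact: cov.
apply: filterS => n h s t s01 t01 st.
apply: (h t) => //; rewrite ?inE/= ?in_itv//=.
Unshelve. all: by end_near. Qed.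

End UniformPath.

(** * Hulls of finite paths *)

Section HullPath.
Context {R : realType}.
Implicit Types (u v : nat -> R * R) (f : set (R * R) -> R).

Definition hullpath m u : set (R * R) := hull [set u k | k in [set k | (k <= m)%N]].

Lemma hullpath_K20 m u : u 0%N = 0 -> K20 (hullpath m u).
Proof.
move=> u0; apply: K20_hull; last by exists 0%N.
apply: finite_compact; apply: finite_image.
have -> : [set k | (k <= m)%N] = `I_m.+1 by [].
exact: finite_II.
Qed.

Lemma walk0 u : walk u 0 = 0. Proof. by rewrite walkE big_ord0. Qed.

Lemma rhoH_hullpath_sub n m u (c : nat -> nat) e : 0 <= e ->
  (forall j, (j <= m)%N -> (c j <= n)%N) ->
  (forall k, (k <= n)%N -> exists2 j, (j <= m)%N & enorm (u k - u (c j)) <= e) ->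
  rhoH (hullpath n u) (hullpath m (u \o c)) <= e.
Proof.
move=> e0 cn h; apply: rhoH_hull => //.
- by exists (u 0%N), 0%N.
- by exists (u (c 0%N)), 0%N.
- move=> _ [k kn <-]; have [j jm uj] := h k kn.
  by exists (u (c j)) => //; exists j.
- move=> _ [j jm <-]; exists (u (c j)); first by exists (c j) => //; exact: cn.
  by rewrite /= subrr enorm0.
Qed.

Lemma rhoH_hullpath m u v e : 0 <= e ->
  (forall k, (k <= m)%N -> enorm (u k - v k) <= e) ->
  rhoH (hullpath m u) (hullpath m v) <= e.
Proof.
move=> e0 h; apply: rhoH_hull => //.
- by exists (u 0%N), 0%N.
- by exists (v 0%N), 0%N.
- by move=> _ [k km <-]; exists (v k); [exists k|exact: h].
- by move=> _ [k km <-]; exists (u k); [exists k|exact: h].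
Qed.

Lemma walk_close m u v k : (k <= m)%N ->
  enorm (walk u k - walk v k) <= \sum_(j < m) enorm (u j - v j).
Proof.
move=> km; rewrite !walkE -sumrB.
apply: (@le_trans _ _ (\sum_(j < k) enorm (u j - v j))).
  elim/big_ind2 : _ => [|x1 x2 y1 y2 h1 h2|//]; first by rewrite enorm0.
  by rewrite (le_trans (enormD _ _))// lerD.
rewrite (big_ord_widen m (fun j => enorm (u j - v j)) km) big_mkcond/=.
by apply: ler_sum => j _; case: ifP => // _; exact: enorm_ge0.
Qed.

Lemma rhoH_walk m u v : rhoH (hullpath m (walk u)) (hullpath m (walk v)) <=
  \sum_(j < m) enorm (u j - v j).
Proof.
apply: rhoH_hullpath; first by apply: sumr_ge0 => j _; exact: enorm_ge0.
by move=> k; exact: walk_close.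
Qed.

Lemma measurable_hullpath d (T : measurableType d) f m (X : nat -> T -> R * R) :
  bdd_cont_K20 f -> (forall i, measurable_fun setT (X i)) ->
  measurable_fun setT (fun w => f (hullpath m (walk (fun i => X i w)))).
Proof.
move=> [_ cf] mX.
apply: (@measurable_path_fun _ _ _ m (fun u => f (hullpath m (walk u)))) => // u e e0.
have [del del0 h] := cf _ (hullpath_K20 m (walk0 u)) e e0.
(* The [m] increments then add up to strictly less than [del], and [m = 0] causes no division by
   0. *)
exists (del / m.+1%:R); first by rewrite divr_gt0.
move=> v uv; apply: h; first exact: hullpath_K20 (walk0 v).
rewrite (le_lt_trans (rhoH_walk _ _ _))//.
apply: (@le_lt_trans _ _ (\sum_(j < m) del / m.+1%:R)).
  by apply: ler_sum => j _; apply/ltW/uv.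
rewrite sumr_const card_ord -[X in X < _]mulr_natr mulrAC ltr_pdivrMr//.
by rewrite ltr_pM2l// ltr_nat.
Qed.

Lemma lip_bdd_cont M L f : 0 <= L -> lip_K20 M L f -> bdd_cont_K20 f.
Proof.
move=> L0 [fM fL]; split; first by exists M.
move=> A kA e e0; have L1 : 0 < L + 1 by lra.
exists (e / (L + 1)); first by rewrite divr_gt0.
move=> B kB; rewrite ltr_pdivlMr// => AB.
rewrite (le_lt_trans (fL _ _ kA kB))// (le_lt_trans _ AB)// mulrC ler_wpM2l ?rhoH_ge0//.
by rewrite lerDl.
Qed.

End HullPath.

(** * From convergence of one block to joint convergence of [m] blocks *)

Section ProductTestFunctions.
Context {R : realType}.

Lemma cvg_sumr I (r : seq I) (f : I -> nat -> R) (l : I -> R) :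
  (forall i, f i n @[n --> \oo] --> l i) ->
  (\sum_(i <- r) f i n) @[n --> \oo] --> \sum_(i <- r) l i.
Proof.
move=> fl; elim: r => [|i r ih].
  by rewrite big_nil; under eq_fun do rewrite big_nil; exact: cvg_cst.
by rewrite big_cons; under eq_fun do rewrite big_cons; exact: cvgD.
Qed.

Lemma normr_prodB m (x y : 'I_m -> R) : (forall j, `|x j| <= 1) ->
  (forall j, `|y j| <= 1) ->
  `|\prod_j x j - \prod_j y j| <= \sum_j `|x j - y j|.
Proof.
elim: m x y => [x y _ _|m ih x y hx hy]; first by rewrite !big_ord0 subrr normr0.
rewrite !big_ord_recr/=; set p := \prod_(i < m) _; set q := \prod_(i < m) _.
rewrite (_ : _ - _ = (p - q) * x ord_max + q * (x ord_max - y ord_max)); last ring.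
rewrite (le_trans (ler_normD _ _))// !normrM lerD//.
  by rewrite (le_trans (ler_piMr _ (hx _)))//; exact: ih.
rewrite ler_piMl// /q normr_prod.
by apply: numdomain.Num.Theory.prodr_ile1 => j _; rewrite normr_ge0/=.
Qed.

Section Fdd.
Context d (T : measurableType d) (P : probability T R)
  d' (T' : measurableType d') (Q : probability T' R).
Variables (m : nat) (U : nat -> nat -> T -> R * R) (V : nat -> nat -> T' -> R * R).
Variables (s2 M L : R) (F : (nat -> R * R) -> R).
Hypotheses (mU : forall n j, measurable_fun setT (U n j))
  (mV : forall n j, measurable_fun setT (V n j)).
Hypothesis prodU : forall n (phi : nat -> R * R -> R), (0 < n)%N ->
  (forall j, measurable_fun setT (phi j)) -> (forall j x, `|phi j x| <= 1) ->
  \int[P]_w (\prod_(j < m) phi j (U n j w)) = \prod_(j < m) \int[P]_w phi j (U n j w).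
Hypothesis prodV : forall n (phi : nat -> R * R -> R), (0 < n)%N ->
  (forall j, measurable_fun setT (phi j)) -> (forall j x, `|phi j x| <= 1) ->
  \int[Q]_w (\prod_(j < m) phi j (V n j w)) = \prod_(j < m) \int[Q]_w phi j (V n j w).
Hypothesis clt : forall Phi, smooth2 Phi -> forall j, (j < m)%N ->
  (\int[P]_w Phi (U n j w) - \int[Q]_w Phi (V n j w)) @[n --> \oo] --> 0.
Hypotheses (U2 : forall n j, (0 < n)%N -> (j < m)%N ->
    intg P (fun w => enorm (U n j w) ^+ 2) /\ \int[P]_w (enorm (U n j w) ^+ 2) <= s2)
  (V2 : forall n j, (0 < n)%N -> (j < m)%N ->
    intg Q (fun w => enorm (V n j w) ^+ 2) /\ \int[Q]_w (enorm (V n j w) ^+ 2) <= s2).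
Hypotheses (s20 : 0 <= s2) (M0 : 0 <= M) (L0 : 0 <= L) (FM : forall u, `|F u| <= M)
  (FL : forall u v, `|F u - F v| <= L * \sum_(j < m) enorm (u j - v j)).
Hypotheses (mFU : forall n, measurable_fun setT (fun w => F (fun j => U n j w)))
  (mFV : forall n, measurable_fun setT (fun w => F (fun j => V n j w))).

Lemma fdd_cvg :
  (\int[P]_w F (fun j => U n j w) - \int[Q]_w F (fun j => V n j w)) @[n --> \oo] --> 0.
Proof.
suff main (e : R) : 0 < e -> \forall n \near \oo,
    `|\int[P]_w F (fun j => U n j w) - \int[Q]_w F (fun j => V n j w)| < e.
  apply/cvgrPdist_lt => e e0; apply: filterS (main e e0) => n.
  by rewrite sub0r normrN.
(* [eta] bounds the error of replacing increments by grid points, [L * m * 2 * eta], by [e / 8]. [K]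
   bounds the truncation error [B / K^2] by [e / 8]; there [K >= 1] gives [K <= K^2]. *)
move=> e0; pose eta := e / (16 * (L * m%:R + 1)).
have Lm : 0 <= L * m%:R by rewrite mulr_ge0.
have eta0 : 0 < eta by rewrite /eta divr_gt0// mulr_gt0//; lra.
pose B := 2 * M * m%:R * s2.
have B0 : 0 <= B by rewrite /B !mulr_ge0.
pose K := 1 + 8 * B / e.
have K1 : 1 <= K by rewrite /K lerDl divr_ge0 ?mulr_ge0// ltW.
have [N [be [g [sbe be01 bele1 be1 beg]]]] := partition_of_unity K eta0.
(* An index picks one planar cell for each of the [m] increments: [pt] is its grid point and [phi]
   its bump, both extended by 0 to [j >= m]. *)
pose I := {ffun 'I_m -> 'I_N * 'I_N}.
pose pt (k : I) (j : nat) : R * R :=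
  if insub j is Some i then (g (k i).1, g (k i).2) else 0.
pose phi (k : I) (j : nat) (x : R * R) : R :=
  if insub j is Some i then be (k i).1 x.1 * be (k i).2 x.2 else 0.
have mbe i : measurable_fun setT (be i) by have [] := sbe i.
have mphi k j : measurable_fun setT (phi k j).
  rewrite /phi; case: insub => [i|]; last exact: measurable_cst.
  by apply: measurable_funM; apply: measurableT_comp.
have phi01 k j x : 0 <= phi k j x <= 1.
  rewrite /phi; case: insub => [i|]; last by rewrite lexx ler01.
  have /andP[a0 a1] := be01 (k i).1 x.1; have /andP[b0 b1] := be01 (k i).2 x.2.
  by rewrite mulr_ge0//= mulr_ile1.
have phi1 k j x : `|phi k j x| <= 1.
  by have /andP[h0 h1] := phi01 k j x; rewrite ger0_norm.
pose W (k : I) (u : nat -> R * R) := \prod_(j < m) phi k j (u j).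
have W0 k u : 0 <= W k u by apply: prodr_ge0 => j _; have /andP[] := phi01 k j (u j).
have W1 k u : `|W k u| <= 1.
  rewrite /W normr_prod; apply: numdomain.Num.Theory.prodr_ile1 => j _.
  by rewrite normr_ge0/=.
have sumW u : \sum_k W k u =
    \prod_(j < m) ((\sum_a be a (u j).1) * (\sum_b be b (u j).2)).
  transitivity (\prod_(j < m) \sum_(ab : 'I_N * 'I_N) be ab.1 (u j).1 * be ab.2 (u j).2).
    rewrite (bigA_distr_bigA (fun (j : 'I_m) (ab : 'I_N * 'I_N) => be ab.1 (u j).1 * be ab.2 (u j).2)).
    apply: eq_bigr => k _; apply: eq_bigr => j _.
    by rewrite /phi valK.
  apply: eq_bigr => j _; rewrite mulr_suml.
  rewrite -(pair_bigA _ (fun a b => be a (u j).1 * be b (u j).2))/=.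
  by apply: eq_bigr => a _; rewrite mulr_sumr.
have be0 i (x : R) : 0 <= be i x by have /andP[] := be01 i x.
have sumW1 u : \sum_k W k u <= 1.
  rewrite sumW; apply: numdomain.Num.Theory.prodr_ile1 => j _.
  by rewrite mulr_ge0 ?sumr_ge0//= mulr_ile1 ?sumr_ge0.
pose G u := \sum_k F (pt k) * W k u.
have GM u : `|G u| <= M.
  rewrite (le_trans (ler_norm_sum _ _ _))//.
  apply: (@le_trans _ _ (\sum_k M * W k u)).
    by apply: ler_sum => k _; rewrite normrM (ger0_norm (W0 k u)) ler_wpM2r.
  by rewrite -mulr_sumr ler_piMr.
have FG u : `|F u - G u| <= L * m%:R * (2 * eta) + 2 * M / K ^+ 2 *
    \sum_(j < m) enorm (u j) ^+ 2.
  have S0 : 0 <= \sum_(j < m) enorm (u j) ^+ 2 by apply: sumr_ge0 => j _; exact: sqr_ge0.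
  have K20 : 0 < K ^+ 2 by rewrite exprn_gt0//; lra.
  have c0 : 0 <= 2 * M / K ^+ 2 by apply: divr_ge0; [exact: mulr_ge0|exact: ltW].
  (* Inside the box the weights sum to 1 and live within [eta] of the grid point in each coordinate.
     Outside it, some increment exceeds [K], so the second moment term alone covers the trivial
     bound [2 * M]. *)
  have [box|] := pselect (forall j : 'I_m, enorm (u j) <= K).
    apply: (@le_trans _ _ (L * m%:R * (2 * eta))); last first.
      by rewrite lerDl; exact: mulr_ge0.
    have s1 : \sum_k W k u = 1.
      rewrite sumW big1// => j _; have bj := box j.
      by rewrite !be1 ?mulr1// (le_trans _ bj)// ?enorm_ge1 ?enorm_ge2.
    have -> : F u - G u = \sum_k (F u - F (pt k)) * W k u.
      under eq_bigr do rewrite mulrBl.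
      by rewrite sumrB -mulr_sumr s1 mulr1.
    rewrite (le_trans (ler_norm_sum _ _ _))//.
    apply: (@le_trans _ _ (\sum_k L * m%:R * (2 * eta) * W k u)); last first.
      by rewrite -mulr_sumr s1 mulr1.
    apply: ler_sum => k _; rewrite normrM (ger0_norm (W0 k u)).
    have [->|Wn0] := eqVneq (W k u) 0; first by rewrite !mulr0.
    rewrite ler_wpM2r//; apply: (le_trans (FL _ _)).
    rewrite -mulrA ler_wpM2l//.
    apply: (@le_trans _ _ (\sum_(j < m) 2 * eta)); last first.
      by rewrite sumr_const card_ord [leRHS]mulr_natl.
    apply: ler_sum => j _; have : phi k j (u j) != 0.
      by move: Wn0; apply: contraNneq => pj; rewrite /W (bigD1 j)//= pj mul0r.
    rewrite /phi /pt valK mulf_eq0 negb_or => /andP[h1 h2].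
    rewrite (le_trans (enorm_le_add _))//= mulr_natl mulr2n.
    by apply: lerD; exact: beg.
  move/existsNP => [j /negP]; rewrite -ltNge => jK.
  apply: (@le_trans _ _ (2 * M)).
    by rewrite (le_trans (ler_normB _ _))// mulr_natl mulr2n lerD.
  apply: (@le_trans _ _ (2 * M / K ^+ 2 * \sum_(j < m) enorm (u j) ^+ 2)); last first.
    by rewrite lerDr; apply: mulr_ge0 => //; rewrite mulr_ge0// ltW.
  have jS : enorm (u j) ^+ 2 <= \sum_(j < m) enorm (u j) ^+ 2.
    by rewrite [leRHS](bigD1 j)//= lerDl sumr_ge0// => i _; exact: sqr_ge0.
  have Kj : K ^+ 2 <= enorm (u j) ^+ 2.
    by rewrite lerXn2r ?nnegrE ?enorm_ge0 ?(ltW jK)//; lra.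
  rewrite mulrAC ler_pdivlMr// ler_wpM2l ?mulr_ge0//.
  exact: le_trans Kj jS.
have err : L * m%:R * (2 * eta) + 2 * M / K ^+ 2 * (m%:R * s2) <= e / 4.
  have h1 : L * m%:R * (2 * eta) <= e / 8.
    rewrite /eta (_ : _ * _ = e / 8 * (L * m%:R / (L * m%:R + 1))); last first.
      by field; rewrite gt_eqF//; lra.
    rewrite ler_piMr//; first by rewrite divr_ge0// ltW.
    by rewrite ler_pdivrMr ?mul1r; lra.
  have h2 : 2 * M / K ^+ 2 * (m%:R * s2) <= e / 8.
    rewrite (_ : _ * _ = B / K ^+ 2); last by rewrite /B; field; rewrite gt_eqF//; lra.
    rewrite ler_pdivrMr ?exprn_gt0//; last lra.
    have BK : B <= e / 8 * K.
      rewrite /K mulrDr mulr1 (_ : e / 8 * (8 * B / e) = B) ?lerDr; first lra.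
      by field; rewrite gt_eqF.
    rewrite (le_trans BK)// ler_wpM2l ?divr_ge0 ?(ltW e0)// expr2 ler_peMr//; lra.
  lra.
have FGU d0 (T0 : measurableType d0) (P0 : probability T0 R) (X : nat -> T0 -> R * R) :
   (forall j, measurable_fun setT (X j)) ->
   measurable_fun setT (fun w => F (fun j => X j w)) ->
   (forall j, (j < m)%N -> intg P0 (fun w => enorm (X j w) ^+ 2) /\
       \int[P0]_w (enorm (X j w) ^+ 2) <= s2) ->
   `|\int[P0]_w F (fun j => X j w) - \int[P0]_w G (fun j => X j w)| <= e / 4.
  move=> mX mF X2; apply: le_trans err.
  have mG : measurable_fun setT (fun w => G (fun j => X j w)).
    apply: measurable_sum => k; apply: measurable_funM => //.
    by apply: measurable_prod => j _; exact: measurableT_comp.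
  have iF : intg P0 (fun w => F (fun j => X j w)) by apply: (@intg_bdd _ _ _ _ _ M).
  have iG : intg P0 (fun w => G (fun j => X j w)) by apply: (@intg_bdd _ _ _ _ _ M).
  have iX (j : 'I_m) : intg P0 (fun w => enorm (X j w) ^+ 2) by have [] := X2 j (ltn_ord j).
  have iS := intg_sum (index_enum 'I_m) iX.
  have iB := intgD (intg_cst P0 (L * m%:R * (2 * eta))) (intgZ (2 * M / K ^+ 2) iS).
  rewrite -ExB//.
  have := Ex_norm_le (intgB iF iG) iB (fun w => FG _).
  move/le_trans; apply.
  rewrite (ExD (intg_cst _ _) (intgZ _ iS)) Ex_cst lerD2l (ExZ _ iS) (Ex_sum _ iX).
  apply: ler_wpM2l; first by apply: divr_ge0; [exact: mulr_ge0|exact: sqr_ge0].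
  rewrite mulr_natl -[X in _ *+ X](card_ord m) -sumr_const.
  by apply: ler_sum => j _; have [] := X2 j (ltn_ord j).
have Gcvg : (\int[P]_w G (fun j => U n j w) - \int[Q]_w G (fun j => V n j w))
    @[n --> \oo] --> 0.
  have EG d0 (T0 : measurableType d0) (P0 : probability T0 R) (X : nat -> T0 -> R * R) :
     (forall j, measurable_fun setT (X j)) ->
     \int[P0]_w G (fun j => X j w) = \sum_k F (pt k) * \int[P0]_w W k (fun j => X j w).
    move=> mX.
    have iW k : intg P0 (fun w => W k (fun j => X j w)).
      apply: (@intg_bdd _ _ _ _ _ 1) => //.
      by apply: measurable_prod => j _; exact: measurableT_comp.
    rewrite /G Ex_sum; last by move=> k; exact: intgZ.
    by apply: eq_bigr => k _; rewrite ExZ.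
  pose g1 (k : I) n := F (pt k) * (\int[P]_w W k (fun j => U n j w) -
    \int[Q]_w W k (fun j => V n j w)).
  have g10 k : g1 k n @[n --> \oo] --> 0.
    rewrite /g1 -(mulr0 (F (pt k))); apply: cvgMr.
    have sphi j : smooth2 (phi k j).
      rewrite /phi; case: insub => [i|]; first exact: smooth2_prod.
      rewrite (_ : (fun=> 0) = fun x : R * R => cst 0 x.1 * cst 0 x.2).
        by apply: smooth2_prod; exact: smooth3_cst.
      by apply/funext => x; rewrite /= mulr0.
    pose dif (j : 'I_m) n :=
      `|\int[P]_w phi k j (U n j w) - \int[Q]_w phi k j (V n j w)|.
    have dif0 j : dif j n @[n --> \oo] --> 0.
      by rewrite -(normr0 R); apply: cvg_norm; exact: clt.
    have lim := @cvg_sumr _ (index_enum 'I_m) _ _ dif0.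
    rewrite big1// in lim.
    apply/norm_cvg0P.
    apply: (@squeeze_cvgr _ _ _ _ (cst 0) _ _ _ _ _ lim); last exact: cvg_cst.
    near=> n.
    have n0 : (0 < n)%N by near: n; exact: nbhs_infty_gt.
    rewrite normr_ge0/= prodU// prodV//.
    apply: normr_prodB => j; apply: Ex_bdd => // w;
      by apply: measurableT_comp.
  have lim := @cvg_sumr _ (index_enum I) _ _ g10; rewrite big1// in lim.
  rewrite (_ : (fun n => _) = (fun n => \sum_k g1 k n)); first exact: lim.
  apply/funext => n; rewrite !EG// -sumrB; apply: eq_bigr => k _.
  by rewrite -mulrBr.
near=> n; have n0 : (0 < n)%N by near: n; exact: nbhs_infty_gt.
have hU := FGU _ _ P (U n) (mU n) (mFU n) (fun j => @U2 n j n0).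
have hV := FGU _ _ Q (V n) (mV n) (mFV n) (fun j => @V2 n j n0).
have hG : `|0 - (\int[P]_w G (fun j => U n j w) - \int[Q]_w G (fun j => V n j w))| < e / 4.
  near: n; move/cvgrPdist_lt : Gcvg; apply; by rewrite divr_gt0.
rewrite sub0r normrN in hG.
move: hU hV hG; rewrite !ler_norml !ltr_norml.
move=> /andP[? ?] /andP[? ?] /andP[? ?]; apply/andP; split; lra.
Unshelve. all: by end_near. Qed.

End Fdd.
End ProductTestFunctions.

(** * Convergence of the hulls *)

Section CutPoints.
Variables (m n : nat).
Hypothesis m0 : (0 < m)%N.

(** Rounding each block end separately makes the last one equal to [n] for any remainder of [n]
    modulo [m], and keeps every block length within [n / m + 1]. *)
Definition cut j := (j * n %/ m)%N.

Lemma cut_homo : {homo cut : i j / (i <= j)%N >-> (i <= j)%N}.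
Proof. by move=> i j ij; apply: leq_div2r; rewrite leq_mul2r ij orbT. Qed.

Lemma cut0 : cut 0 = 0%N. Proof. by rewrite /cut mul0n div0n. Qed.

Lemma cut_last : cut m = n. Proof. by rewrite /cut mulKn. Qed.

Lemma cut_le j : (j <= m)%N -> (cut j <= n)%N.
Proof. by move=> jm; rewrite -[leqRHS]cut_last; exact: cut_homo. Qed.

Lemma cut_gap j : ((cut j.+1 - cut j) * m <= n + m)%N.
Proof.
rewrite mulnBl leq_subLR.
have h1 : (cut j.+1 * m <= j.+1 * n)%N by exact: leq_divM.
have h2 : (j * n < (cut j).+1 * m)%N by exact: ltn_ceil.
by move: h1 h2; rewrite !mulSn; lia.
Qed.

Lemma cut_cover k : (k <= n)%N -> exists2 j, (j < m)%N & (cut j <= k <= cut j.+1)%N.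
Proof.
move=> kn; pose p j := ((j < m) && (cut j <= k))%N.
have ex : exists j, p j by exists 0%N; rewrite /p m0 cut0.
have ub j : p j -> (j <= m)%N by move=> /andP[/ltnW].
case: (ex_maxnP ex ub) => j /andP[jm jk] jmax.
exists j => //; rewrite jk/=.
have [j1m|mj1] := ltnP j.+1 m.
  have : ~~ p j.+1 by apply/negP => /jmax; rewrite ltnn.
  by rewrite /p j1m/= -ltnNge => /ltnW.
have -> : j.+1 = m by apply/eqP; rewrite eqn_leq jm.
by rewrite cut_last.
Qed.

Lemma cut_dist (R : realType) j : (0 < n)%N ->
  `|(cut j)%:R / n%:R - j%:R / m%:R| <= n%:R^-1 :> R.
Proof.
move=> n0; have nn : 0 < n%:R :> R by rewrite ltr0n.
have mm : 0 < m%:R :> R by rewrite ltr0n.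
have h1 : (cut j * m <= j * n)%N by exact: leq_divM.
have h2 : (j * n <= (cut j).+1 * m)%N by apply: ltnW; exact: ltn_ceil.
have h1' : (cut j)%:R * m%:R <= j%:R * n%:R :> R by rewrite -!natrM ler_nat.
have h2' : j%:R * n%:R <= ((cut j)%:R + 1) * m%:R :> R by rewrite natr1 -!natrM ler_nat.
have l1 : (cut j)%:R / n%:R <= j%:R / m%:R :> R.
  by rewrite ler_pdivrMr// mulrAC ler_pdivlMr.
have l2 : j%:R / m%:R <= (cut j)%:R / n%:R + n%:R^-1 :> R.
  by rewrite -[X in _ + X]div1r -mulrDl ler_pdivrMr// mulrAC ler_pdivlMr.
by rewrite ler_norml; apply/andP; split; [rewrite lerNl opprB lerBlDl|
  rewrite (le_trans _ (_ : 0 <= _))// ?subr_le0 ?invr_ge0].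
Qed.

End CutPoints.

Lemma smooth3_plateau (R : realType) (a : R) : 0 < a -> exists phi : R -> R,
  [/\ smooth3 phi, forall t, 0 <= phi t <= 1,
     forall t, `|t| <= a / 4 -> phi t = 1 & forall t, a / 2 <= `|t| -> phi t = 0].
Proof.
(* A smoothstep rises over length 3, here compressed to [a / 4], hence the slope [12 / a]. The
   shifts 6 and -3 place the rise on [[- a / 2, - a / 4]] and the fall on [[a / 4, a / 2]]. *)
move=> a0; have ha : 12 / a * a = 12 by rewrite divfK ?gt_eqF.
have k0 : 0 < 12 / a by rewrite divr_gt0.
have mono (x y : R) : x <= y -> 12 / a * x <= 12 / a * y by move=> xy; rewrite ler_pM2l.
exists (fun t => smoothstep (12 / a * t + 6) - smoothstep (12 / a * t + - 3)); split.
- have := smooth3_lin (-1) (smooth3_affine (12 / a) 6 (@smooth3_smoothstep R))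
    (smooth3_affine (12 / a) (-3) (@smooth3_smoothstep R)).
  by under eq_fun do rewrite mulN1r.
- move=> t; have /andP[h1 h2] := smoothstep_itv (12 / a * t + 6).
  have /andP[h3 h4] := smoothstep_itv (12 / a * t + - 3).
  have [t1|t1] := leP t 0.
    rewrite [X in _ - X]smoothstep0 ?subr0 ?h1//.
    by have := mono _ _ t1; rewrite mulr0; lra.
  rewrite [X in X - _]smoothstep1; first by apply/andP; split; lra.
  by have := mono _ _ (ltW t1); rewrite mulr0; lra.
- move=> t; rewrite ler_norml => /andP[t1 t2].
  rewrite smoothstep1 ?smoothstep0 ?subr0//.
    by have := mono _ _ t2; lra.
  by have := mono _ _ t1; lra.
- move=> t; have [t0|t0] := leP 0 t.
    rewrite ger0_norm// => /mono h; rewrite !smoothstep1 ?subrr//; lra.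
  rewrite ltr0_norm// => /mono h; rewrite !smoothstep0 ?subrr//; lra.
Qed.

(** * Oscillation of the walk within blocks *)

Section LipschitzConvergence.
Context {R : realType} d (T : measurableType d) (P : probability T R)
  (Z : nat -> T -> R * R) d' (T' : measurableType d') (Q : probability T' R)
  (b : R -> T' -> R * R) (S : 'M[R]_2).
Hypotheses (iidZ : iid_seq P Z)
  (Z2 : (\int[P]_w ((enorm (Z 0%N w)) ^+ 2)%:E < +oo)%E)
  (meanZ : forall i, meanv P (Z 0%N) i = 0)
  (bm : std_BM2 Q b) (psdS : psd2 S) (covS : S *m S = covmx P (Z 0%N)).

Local Notation steps := (steps Z).
Local Notation bsteps := (bsteps b S).
Local Notation sig2 := (sig2 S).

Lemma stepsE n i : (0 < n)%N -> \int[P]_w (enorm (steps n i w) ^+ 2) = n%:R^-1 * sig2.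
Proof.
move=> n0; have [i2 _ e11 _ e22] := steps_moments iidZ Z2 meanZ psdS covS i n0.
have mX : measurable_fun setT (steps n i).
  by apply: measurable_scalep; case: iidZ.
have [i11 _ i22] := intg_sqr_coord mX i2.
under eq_Rintegral do rewrite sqr_enorm.
by rewrite ExD// e11 e22 -mulrDr.
Qed.

Lemma steps_sq n i : (0 < n)%N -> intg P (fun w => enorm (steps n i w) ^+ 2).
Proof. by move=> n0; have [] := steps_moments iidZ Z2 meanZ psdS covS i n0. Qed.

Lemma steps_mean n i : (0 < n)%N ->
  \int[P]_w (steps n i w).1 = 0 /\ \int[P]_w (steps n i w).2 = 0.
Proof. by move=> n0; have [] := steps_moments iidZ Z2 meanZ psdS covS i n0. Qed.

Let grid n i : (i < n)%N -> [/\ 0 <= i%:R / n%:R :> R,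
  i%:R / n%:R < i.+1%:R / n%:R :> R & i.+1%:R / n%:R <= 1 :> R].
Proof.
move=> il; have n0 : 0 < n%:R :> R by rewrite ltr0n (leq_ltn_trans _ il).
split; first by rewrite divr_ge0.
  by rewrite ltr_pM2r ?invr_gt0// ltr_nat.
by rewrite ler_pdivrMr// mul1r ler_nat.
Qed.

Lemma bsteps_sq n i : (i < n)%N -> intg Q (fun w => enorm (bsteps n i w) ^+ 2).
Proof.
by move=> il; have [g0 g1 g2] := grid il; have [] := bm_increment_moments S bm g0 g1 g2.
Qed.

Lemma bsteps_mean n i : (i < n)%N ->
  \int[Q]_w (bsteps n i w).1 = 0 /\ \int[Q]_w (bsteps n i w).2 = 0.
Proof.
by move=> il; have [g0 g1 g2] := grid il; have [] := bm_increment_moments S bm g0 g1 g2.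
Qed.

Lemma bstepsE n i : (i < n)%N -> \int[Q]_w (enorm (bsteps n i w) ^+ 2) = n%:R^-1 * sig2.
Proof.
move=> il; have [g0 g1 g2] := grid il.
have [i2 _ e11 _ e22] := bm_increment_moments S bm g0 g1 g2.
have mV := bm_increment_measurable S bm (i%:R / n%:R) (i.+1%:R / n%:R).
have [i11 _ i22] := intg_sqr_coord mV i2.
under eq_Rintegral do rewrite sqr_enorm.
rewrite ExD// e11 e22 -mulrDr; congr (_ * _).
by rewrite -mulrBl -natr1 addrC addKr mul1r.
Qed.

(** The cutoff [Psi] is 1 on the ball of radius [a / 4] and 0 outside that of radius [a]. Thus
    [1 - Psi] dominates the indicator of the walk's tail, and Markov's inequality with the fourth
    moment bounds its Brownian expectation. *)
Lemma oscillation a : 0 < a -> exists2 K : R, 0 <= K & exists m0 : nat,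
  forall m, (m0 <= m)%N -> (0 < m)%N -> \forall n \near \oo,
    \sum_(j < m) fine (P (\bigcup_(i in [set i | (i < (cut m n j.+1 - cut m n j).+1)%N])
       [set w | 2 * a < enorm (bsum (steps n) (cut m n j) (cut m n j + i) w)]))
    <= K / m%:R.
Proof.
move=> a0; have [phi [sphi phi01 phi1 phi0]] := smooth3_plateau a0.
pose Psi (x : R * R) := phi x.1 * phi x.2.
have sPsi : smooth2 Psi by exact: smooth2_prod.
have [mPsi _] := sPsi.
have Psi01 x : 0 <= Psi x <= 1.
  have /andP[h1 h2] := phi01 x.1; have /andP[h3 h4] := phi01 x.2.
  by rewrite /Psi mulr_ge0//= mulr_ile1.
have Psi1 x : `|Psi x| <= 1 by have /andP[h1 h2] := Psi01 x; rewrite ger0_norm.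
have [err err0 clt] := block_clt iidZ Z2 meanZ bm psdS covS sPsi.
pose K4 := 256 * mxnorm S ^+ 4.
have K40 : 0 <= K4 by rewrite /K4 mulr_ge0 ?exprn_ge0 ?mxnorm_ge0.
have a4 : 0 < (a / 4) ^+ 4 by rewrite exprn_gt0// divr_gt0.
(* Twice, by Ottaviani's inequality, the sum of the comparison error [1 / (2 m^2)] and the fourth
   moment bound [K4 (2 / m)^2 / (a / 4)^4] equals [K / m^2] for each block. *)
pose K := 1 + 8 * (K4 / (a / 4) ^+ 4).
have K0 : 0 <= K by rewrite /K addr_ge0// mulr_ge0// divr_ge0// ltW.
exists K => //.
(* A block has second moment at most [2 * sig2 / m]; [m >= m0] makes this at most [a^2 / 2], the
   condition in Ottaviani's inequality. *)
pose m0 := (Num.trunc (4 * sig2 / a ^+ 2)).+1.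
exists m0 => m m0m mpos.
have mm : 0 < m%:R :> R by rewrite ltr0n.
have hm : 4 * sig2 / a ^+ 2 <= m%:R.
  apply: (@le_trans _ _ m0%:R); last by rewrite ler_nat.
  by apply: ltW; exact: truncnS_gt.
have ee : 0 < (2 * m%:R ^+ 2)^-1 :> R by rewrite invr_gt0 mulr_gt0// exprn_gt0.
have [err1 _ herr1] : exists2 N, True & forall n, (N <= n)%N -> err n <= (2 * m%:R ^+ 2)^-1.
  move/cvgrPdist_le : err0 => /(_ _ ee)[N _ h]; exists N => // n Nn.
  have := h n Nn; rewrite sub0r normrN => /(le_trans (ler_norm _)); exact.
(* Besides the small comparison error, [n >= m] turns the block length [n / m + 1] into at most
   [2 n / m]. *)
exists (maxn err1 m) => // n /=; rewrite geq_max => /andP[/herr1 errn mn].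
have npos : (0 < n)%N by exact: leq_trans mpos mn.
have nn : 0 < n%:R :> R by rewrite ltr0n.
rewrite (_ : K / m%:R = \sum_(j < m) K / m%:R ^+ 2); last first.
  by rewrite sumr_const card_ord -[RHS]mulr_natr; field; rewrite gt_eqF.
apply: ler_sum => j _.
set k := cut m n j; set l := cut m n j.+1.
have kl : (k <= l)%N by exact: cut_homo.
have ln : (l <= n)%N by exact: cut_le.
have gap : (l - k)%:R / n%:R <= 2 / m%:R :> R.
  rewrite ler_pdivrMr// mulrAC ler_pdivlMr// -!natrM ler_nat.
  by rewrite (leq_trans (cut_gap n mpos j))// mul2n -addnn leq_add2l.
have s20 : 0 <= n%:R^-1 * sig2 by rewrite mulr_ge0 ?invr_ge0 ?sig2_ge0.
have iX := indepn_steps iidZ n.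
have cond : (l - k)%:R * (n%:R^-1 * sig2) / a ^+ 2 <= 1 / 2.
  rewrite mulrA ler_pdivrMr ?exprn_gt0//.
  rewrite (le_trans (ler_wpM2r (sig2_ge0 S) gap))//.
  rewrite ler_pdivrMr ?exprn_gt0// in hm.
  by rewrite mulrAC ler_pdivrMr//; lra.
have steps_le i : \int[P]_w (enorm (steps n i w) ^+ 2) <= n%:R^-1 * sig2.
  by rewrite stepsE.
have ott := @ottaviani R d T P n (steps n) iX _ (fun i _ => steps_sq i npos)
  (fun i _ => (steps_mean i npos).1) (fun i _ => (steps_mean i npos).2)
  (fun i _ => steps_le i) k l a s20 kl ln a0 cond.
apply: (le_trans ott).
have mU := measurable_bsum iX k l.
have mA : measurable [set w | a < enorm (bsum (steps n) k l w)].
  rewrite -[X in measurable X]setTI -preimage_itvoy.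
  by apply: (measurableT_comp measurable_enorm mU) => //; exact: measurable_itv.
have iPU : intg P (fun w => Psi (bsum (steps n) k l w)).
  by apply: (@intg_bdd _ _ _ _ _ 1) => //; exact: measurableT_comp.
have hU : fine (P [set w | a < enorm (bsum (steps n) k l w)]) <=
    1 - \int[P]_w Psi (bsum (steps n) k l w).
  rewrite -Ex_indic// -[X in X - _](Ex_cst P 1) -ExB//; last exact: intg_cst.
  apply: Ex_le.
  - exact: intg_indic.
  - by apply: intgB => //; exact: intg_cst.
  move=> w; rewrite indicE; have /andP[h0 h1] := Psi01 (bsum (steps n) k l w).
  case: (boolP (w \in _)) => [|_]; last by rewrite subr_ge0.
  rewrite inE/= => aw.
  have : a / 2 <= `|(bsum (steps n) k l w).1| \/ a / 2 <= `|(bsum (steps n) k l w).2|.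
    have := enorm_le_add (bsum (steps n) k l w).
    have [h|h] := leP (a / 2) `|(bsum (steps n) k l w).1|; [by left|right; lra].
  by rewrite /Psi => -[/phi0 ->|/phi0 ->]; rewrite ?mul0r ?mulr0 subr0.
have hV : 1 - \int[Q]_w Psi (bsum (bsteps n) k l w) <=
    K4 * (4 / m%:R ^+ 2) / (a / 4) ^+ 4.
  (* The Gaussian moments ask for a positive time span; an empty block has increment 0, where [Psi]
     is 1. *)
  have [kl'|lk] := ltnP k l; last first.
    have -> : l = k by apply/eqP; rewrite eqn_leq kl lk.
    under eq_Rintegral do rewrite bsumnn.
    rewrite Ex_cst /Psi /= phi1 ?normr0 ?divr_ge0 ?(ltW a0)// mulr1 subrr.
    apply: divr_ge0; last exact: ltW.
    by apply: mulr_ge0 => //; apply: divr_ge0 => //; exact: sqr_ge0.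
  have t0 : 0 <= k%:R / n%:R :> R by rewrite divr_ge0.
  have st : k%:R / n%:R < l%:R / n%:R :> R by rewrite ltr_pM2r ?invr_gt0// ltr_nat.
  have t1 : l%:R / n%:R <= 1 :> R by rewrite ler_pdivrMr// mul1r ler_nat.
  have [i4 e4] := bm_increment_fourth S bm t0 st t1.
  under eq_Rintegral do rewrite bsum_bsteps//.
  have mV := bm_increment_measurable S bm (k%:R / n%:R) (l%:R / n%:R).
  have iPV : intg Q (fun w => Psi (mxapp S (b (l%:R / n%:R) w - b (k%:R / n%:R) w))).
    by apply: (@intg_bdd _ _ _ _ _ 1) => //; exact: measurableT_comp.
  rewrite -[X in X - _](Ex_cst Q 1) -ExB//; last exact: intg_cst.
  rewrite ler_pdivlMr// mulrC -ExZ; last by apply: intgB => //; exact: intg_cst.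
  apply: le_trans (_ : _ <= \int[Q]_w (enorm (mxapp S
     (b (l%:R / n%:R) w - b (k%:R / n%:R) w)) ^+ 4)) _.
    apply: Ex_le => //; first by apply: intgZ; apply: intgB => //; exact: intg_cst.
    move=> w; set v := mxapp _ _; have /andP[h0 h1] := Psi01 v.
    have v4 : 0 <= enorm v ^+ 4 by rewrite exprn_ge0 ?enorm_ge0.
    have [va|av] := leP (enorm v) (a / 4).
      rewrite /Psi !phi1 ?(le_trans (enorm_ge1 _))// ?(le_trans (enorm_ge2 _))//.
      by rewrite mulr1 subrr mulr0.
    apply: (@le_trans _ _ ((a / 4) ^+ 4)).
      by rewrite ler_piMr ?(ltW a4)//; lra.
    by rewrite lerXn2r ?nnegrE ?enorm_ge0 ?(ltW av)// divr_ge0// ltW.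
  apply: (le_trans e4); rewrite -/K4 ler_wpM2l// -mulrBl.
  rewrite [leRHS](_ : _ = (2 / m%:R) ^+ 2); last by field; rewrite gt_eqF.
  have d0 : 0 <= (l%:R - k%:R) / n%:R :> R by rewrite divr_ge0// subr_ge0 ler_nat.
  have d1 : (l%:R - k%:R) / n%:R <= 2 / m%:R :> R by rewrite -natrB.
  by rewrite lerXn2r ?nnegrE// divr_ge0.
have := clt n k l npos kl ln; rewrite ler_norml => /andP[hc _].
have KE : K / m%:R ^+ 2 = 2 * ((2 * m%:R ^+ 2)^-1 + K4 * (4 / m%:R ^+ 2) / (a / 4) ^+ 4).
  by rewrite /K; field; rewrite !gt_eqF.
rewrite KE ler_pM2l//; lra.
Qed.

End LipschitzConvergence.

Lemma hullpathS (R : realType) m (u v : nat -> R * R) :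
  (forall k, (k <= m)%N -> u k = v k) -> hullpath m u = hullpath m v.
Proof.
move=> uv; congr hull; apply/seteqP; split => [_ [k km <-]|_ [k km <-]];
  by exists k => //; rewrite uv.
Qed.

(** * Random-walk hulls against Brownian hulls *)

Section HullConvergence.
Context {R : realType} d (T : measurableType d) (P : probability T R)
  (Z : nat -> T -> R * R) d' (T' : measurableType d') (Q : probability T' R)
  (b : R -> T' -> R * R) (S : 'M[R]_2).
Hypotheses (iidZ : iid_seq P Z)
  (Z2 : (\int[P]_w ((enorm (Z 0%N w)) ^+ 2)%:E < +oo)%E)
  (meanZ : forall i, meanv P (Z 0%N) i = 0)
  (bm : std_BM2 Q b) (psdS : psd2 S) (covS : S *m S = covmx P (Z 0%N)).

Local Notation steps := (steps Z).
Local Notation bsteps := (bsteps b S).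
Local Notation sig2 := (sig2 S).

Definition rw_hull n w : set (R * R) := hullpath n (walk (fun i => steps n i w)).
Definition bm_hull w : set (R * R) := hull [set mxapp S (b t w) | t in `[0, 1]].
Definition bm_grid m w : set (R * R) := hullpath m (walk (fun i => bsteps m i w)).

Let mZ i : measurable_fun setT (Z i). Proof. by case: iidZ. Qed.

Let msteps n i : measurable_fun setT (steps n i).
Proof. by apply: measurable_scalep. Qed.

Let mbsteps n i : measurable_fun setT (bsteps n i).
Proof. exact: bm_increment_measurable bm _ _. Qed.

Lemma rw_hull_K20 n w : K20 (rw_hull n w).
Proof. exact: hullpath_K20 (walk0 _). Qed.

Lemma bm_grid_K20 m w : K20 (bm_grid m w).
Proof. exact: hullpath_K20 (walk0 _). Qed.

Lemma bm_hull_K20 w : K20 (bm_hull w).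
Proof.
have [b0 cb _ _] := bm.
apply: K20_hull; last first.
  by exists 0; rewrite /= ?in_itv/= ?lexx ?ler01// (BM0 bm) mxapp0.
have -> : [set mxapp S (b t w) | t in `[0, 1]] =
    mxapp S @` [set b t w | t in `[0, 1]].
  by rewrite image_comp.
apply: continuous_compact; first by apply: continuous_subspaceT; exact: continuous_mxapp.
by apply: continuous_compact; [exact: cb|exact: segment_compact].
Qed.

Lemma walk_bsteps n k w : (0 < n)%N ->
  walk (fun i => bsteps n i w) k = mxapp S (b (k%:R / n%:R) w).
Proof.
move=> n0; have := @bsum_bsteps _ _ _ b S n 0 k w (leq0n k).
by rewrite mul0r (BM0 bm) subr0 => <-; rewrite walkE /bsum big_mkord.
Qed.

Lemma rhoH_bm_grid w (e : R) : 0 < e -> \forall m \near \oo, rhoH (bm_grid m w) (bm_hull w) <= e.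
Proof.
move=> e0; have [_ cb _ _] := bm.
have K0 : 0 < mxnorm S + 1 by rewrite ltr_wpDl ?mxnorm_ge0.
have e1 : 0 < e / (mxnorm S + 1) by rewrite divr_gt0.
have := path_modulus (cb w) e1; move=> [N _ hN]; exists N.+1 => // m /= Nm.
have m0 : (0 < m)%N by exact: leq_ltn_trans Nm.
have mm : 0 < m%:R :> R by rewrite ltr0n.
have close (s t : R) : 0 <= s <= 1 -> 0 <= t <= 1 -> `|s - t| <= m%:R^-1 ->
    enorm (mxapp S (b s w) - mxapp S (b t w)) <= e.
  move=> s01 t01 st; have := hN m (ltnW Nm) s t s01 t01 st => h.
  rewrite -mxappB (le_trans (enorm_mxapp _ _))//.
  rewrite (le_trans (ler_wpM2l (mxnorm_ge0 S) h))// mulrCA ler_piMr ?(ltW e0)//.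
  by rewrite ler_pdivrMr// mul1r lerDl.
have grid01 k : (k <= m)%N -> 0 <= (k%:R / m%:R : R) <= 1.
  by move=> km; rewrite divr_ge0//= ler_pdivrMr// mul1r ler_nat.
apply: rhoH_hull; first exact: ltW.
- by exists (walk (fun i => bsteps m i w) 0), 0%N.
- by exists (mxapp S (b 0 w)), 0 => //=; rewrite in_itv/= lexx ler01.
- move=> _ [k km <-]; rewrite walk_bsteps//.
  exists (mxapp S (b (k%:R / m%:R) w)); last by rewrite subrr enorm0 ltW.
  by exists (k%:R / m%:R) => //=; rewrite in_itv/=; exact: grid01.
- move=> _ [t /= t01 <-]; rewrite in_itv/= in t01; have /andP[t0 t1] := t01.
  pose k := Num.trunc (t * m%:R).
  have tm0 : 0 <= t * m%:R by rewrite mulr_ge0.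
  have /andP[k1 k2] := truncn_itv tm0; rewrite -/k in k1 k2.
  have km : (k <= m)%N.
    by rewrite -(ler_nat R) (le_trans k1)// ler_piMl.
  exists (walk (fun i => bsteps m i w) k); first by exists k.
  rewrite walk_bsteps//; apply: close => //; first exact: grid01.
  rewrite distrC ger0_norm; last by rewrite subr_ge0 ler_pdivrMr.
  rewrite lerBlDl -[X in _ + X]div1r -mulrDl ler_pdivlMr//.
  by rewrite natr1 ltW.
Qed.

Lemma cvg_bm_grid f w : bdd_cont_K20 f -> f (bm_grid m w) @[m --> \oo] --> f (bm_hull w).
Proof.
move=> [_ cf]; apply/cvgrPdist_lt => e e0.
have [del del0 h] := cf _ (bm_hull_K20 w) e e0.
have d2 : 0 < del / 2 by rewrite divr_gt0.
apply: filterS (rhoH_bm_grid w d2) => m hm; apply: h; first exact: bm_grid_K20.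
by rewrite rhoH_sym (le_lt_trans hm)// ltr_pdivrMr// ltr_pMr// ltr1n.
Qed.

Lemma measurable_rw_hull f n : bdd_cont_K20 f ->
  measurable_fun setT (fun w => f (rw_hull n w)).
Proof. by move=> cf; exact: measurable_hullpath. Qed.

Lemma measurable_bm_grid f m : bdd_cont_K20 f ->
  measurable_fun setT (fun w => f (bm_grid m w)).
Proof. by move=> cf; exact: measurable_hullpath. Qed.

(** Continuity of each path makes [f] of the full hull a pointwise limit of functions of finitely
    many path values. *)
Lemma measurable_bm_hull f : bdd_cont_K20 f ->
  measurable_fun setT (fun w => f (bm_hull w)).
Proof.
move=> cf; apply: (measurable_fun_cvg (h := fun m w => f (bm_grid m w))).
  by move=> m; exact: measurable_bm_grid.
by move=> w _; exact: cvg_bm_grid.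
Qed.

Section Lipschitz.
Variables (f : set (R * R) -> R) (M L : R).
Hypotheses (M0 : 0 <= M) (L0 : 0 <= L) (fML : lip_K20 M L f).

Let fM A : K20 A -> `|f A| <= M. Proof. by case: fML => + _; apply. Qed.
Let fL A B : K20 A -> K20 B -> `|f A - f B| <= L * rhoH A B.
Proof. by case: fML => _; apply. Qed.
Let cf : bdd_cont_K20 f. Proof. exact: lip_bdd_cont L0 fML. Qed.

Let blk (m n j : nat) w := bsum (steps n) (cut m n j) (cut m n j.+1) w.
(** Cut at the times [cut m n j / n], so that it consists of as many steps as [blk m n j], with the
    same covariances. *)
Let bblk (m n j : nat) w := bsum (bsteps n) (cut m n j) (cut m n j.+1) w.

Lemma walk_blk d0 (T0 : measurableType d0) (X : nat -> T0 -> R * R) m n k w :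
  walk (fun j => bsum X (cut m n j) (cut m n j.+1) w) k =
  walk (fun i => X i w) (cut m n k).
Proof.
rewrite !walkE -(big_mkord xpredT (fun i => X i w)).
rewrite -[RHS]/(bsum X 0 (cut m n k) w).
elim: k => [|k ih]; first by rewrite big_ord0 cut0 bsumnn.
rewrite big_ord_recr/= ih -bsum_cat//.
exact: cut_homo.
Qed.

Lemma fdd_hull m : (0 < m)%N ->
  (\int[P]_w f (hullpath m (walk (fun j => blk m n j w))) -
   \int[Q]_w f (hullpath m (walk (fun j => bblk m n j w)))) @[n --> \oo] --> 0.
Proof.
move=> m0.
have mU n j : measurable_fun setT (blk m n j).
  exact: measurable_bsum (indepn_steps iidZ n) _ _.
have mV n j : measurable_fun setT (bblk m n j).
  by apply: measurable_sump => i; exact: mbsteps.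
apply: (@fdd_cvg R _ _ P _ _ Q m (blk m) (bblk m) sig2 M L
  (fun u => f (hullpath m (walk u)))) => //.
- move=> n phi n0 mphi phi1.
  apply: (bsum_prod (indepn_steps iidZ n)) => //; first exact: cut_homo.
  exact: cut_le.
- move=> n phi n0 mphi phi1.
  apply: (bsum_prod (indepn_bsteps S bm n0)) => //; first exact: cut_homo.
  exact: cut_le.
- move=> Phi sPhi j jm.
  have [err err0 h] := block_clt iidZ Z2 meanZ bm psdS covS sPhi.
  apply/norm_cvg0P; apply: (@squeeze_cvgr _ _ _ _ (cst 0) _ _ _ _ _ err0); last exact: cvg_cst.
  near=> n; rewrite normr_ge0/=; apply: h.
  + by near: n; exact: nbhs_infty_gt.
  + exact: cut_homo.
  + exact: cut_le.
- move=> n j n0 jm.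
  have cl : (cut m n j <= cut m n j.+1)%N by exact: cut_homo.
  have cn : (cut m n j.+1 <= n)%N by exact: cut_le.
  have sle i : \int[P]_w (enorm (steps n i w) ^+ 2) <= n%:R^-1 * sig2.
    by rewrite (stepsE iidZ Z2 meanZ psdS covS i n0).
  have [i2 _ _ e2] := bsum_moments (indepn_steps iidZ n)
    (fun i _ => steps_sq iidZ Z2 meanZ psdS covS i n0)
    (fun i _ => (steps_mean iidZ Z2 meanZ psdS covS i n0).1)
    (fun i _ => (steps_mean iidZ Z2 meanZ psdS covS i n0).2)
    (fun i _ => sle i) cl cn.
  split => //; apply: (le_trans e2).
  rewrite mulrA ler_piMl ?sig2_ge0// ler_pdivrMr ?ltr0n// mul1r ler_nat.
  by rewrite (leq_trans (leq_subr _ _)).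
- move=> n j n0 jm.
  have cl : (cut m n j <= cut m n j.+1)%N by exact: cut_homo.
  have cn : (cut m n j.+1 <= n)%N by exact: cut_le.
  have sle i : (i < n)%N -> \int[Q]_w (enorm (bsteps n i w) ^+ 2) <= n%:R^-1 * sig2.
    by move=> il; rewrite (bstepsE S bm il).
  have [i2 _ _ e2] := bsum_moments (indepn_bsteps S bm n0)
    (@bsteps_sq _ _ _ _ _ S bm n)
    (fun i il => (bsteps_mean S bm il).1)
    (fun i il => (bsteps_mean S bm il).2)
    sle cl cn.
  split => //; apply: (le_trans e2).
  rewrite mulrA ler_piMl ?sig2_ge0// ler_pdivrMr ?ltr0n// mul1r ler_nat.
  by rewrite (leq_trans (leq_subr _ _)).
- exact: sig2_ge0.
- by move=> u; apply: fM; exact: hullpath_K20 (walk0 _).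
- move=> u v; apply: (le_trans (fL (hullpath_K20 _ (walk0 _)) (hullpath_K20 _ (walk0 _)))).
  by rewrite ler_wpM2l// rhoH_walk.
- by move=> n; exact: measurable_hullpath.
- by move=> n; exact: measurable_hullpath.
Unshelve. all: by end_near. Qed.

(** The times [cut m n k / n] lie within [1 / n] of [k / m]; continuity of the path and dominated
    convergence remove the dependence on [n]. *)
Lemma bm_blocks_cvg m : (0 < m)%N ->
  (\int[Q]_w f (hullpath m (walk (fun j => bblk m n j w)))) @[n --> \oo] -->
   \int[Q]_w f (bm_grid m w).
Proof.
move=> m0; apply: (Ex_dct (g := cst M)).
- move=> n; apply: measurable_hullpath => // j.
  by apply: measurable_sump => i; exact: mbsteps.
- move=> w; apply/cvgrPdist_le => e e0; have [_ cb _ _] := bm.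
  pose D := L * (mxnorm S + 1) + 1.
  have mx0 := mxnorm_ge0 S.
  have D0 : 0 < D by rewrite /D ltr_pwDr// mulr_ge0//; lra.
  have e1 : 0 < e / D by rewrite divr_gt0.
  have [N _ hN] := path_modulus (cb w) e1.
  exists N.+1 => // n /= Nn.
  have n0 : (0 < n)%N by exact: leq_ltn_trans Nn.
  have nn : 0 < n%:R :> R by rewrite ltr0n.
  have mm : 0 < m%:R :> R by rewrite ltr0n.
  apply: (le_trans (fL (bm_grid_K20 m w) (hullpath_K20 m (walk0 _)))).
  apply: (@le_trans _ _ (L * (mxnorm S * (e / D)))); last first.
    rewrite mulrA mulrCA ler_piMr ?(ltW e0)// ler_pdivrMr// mul1r /D.
    by rewrite [X in _ <= X + _]mulrDr mulr1 -addrA lerDl addr_ge0.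
  rewrite ler_wpM2l//; apply: rhoH_hullpath; first by rewrite mulr_ge0// ltW.
  move=> k km; rewrite walk_blk !walk_bsteps// -mxappB.
  apply: (le_trans (enorm_mxapp _ _)); rewrite ler_wpM2l//.
  apply: (hN n (ltnW Nn)).
  + by rewrite divr_ge0//= ler_pdivrMr// mul1r ler_nat.
  + by rewrite divr_ge0//= ler_pdivrMr// mul1r ler_nat cut_le.
  + by rewrite distrC; exact: cut_dist.
- by move=> n w; apply: fM; exact: hullpath_K20 (walk0 _).
- exact: intg_cst.
Qed.

Lemma bm_grid_Ex_cvg :
  (\int[Q]_w f (bm_grid m w)) @[m --> \oo] --> \int[Q]_w f (bm_hull w).
Proof.
apply: (Ex_dct (g := cst M)).
- by move=> m; exact: measurable_bm_grid.
- by move=> w; exact: cvg_bm_grid.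
- by move=> m w; apply: fM; exact: bm_grid_K20.
- exact: intg_cst.
Qed.

Let bad a m n j := \bigcup_(i in [set i | (i < (cut m n j.+1 - cut m n j).+1)%N])
  [set w | 2 * a < enorm (bsum (steps n) (cut m n j) (cut m n j + i) w)].

Let mbad a m n j : measurable (bad a m n j).
Proof.
apply: bigcup_measurable => i _.
rewrite -[X in measurable X]setTI -preimage_itvoy.
exact: (measurableT_comp measurable_enorm (measurable_bsum (indepn_steps iidZ n)
  (cut m n j) (cut m n j + i))).
Qed.

(** Off the bad events each vertex lies within [2 * a] of the vertex that starts its block, and [f]
    is [L]-Lipschitz. On them the crude bound [2 * M] is charged to an indicator. *)
Lemma rw_hull_blocks a m n : 0 < a -> (0 < m)%N ->
  `|\int[P]_w f (rw_hull n w) - \int[P]_w f (hullpath m (walk (fun j => blk m n j w)))|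
  <= L * (2 * a) + 2 * M * \sum_(j < m) fine (P (bad a m n j)).
Proof.
move=> a0 m0.
have kB w : K20 (hullpath m (walk (fun j => blk m n j w))) by exact: hullpath_K20 (walk0 _).
have mB : measurable_fun setT (fun w => f (hullpath m (walk (fun j => blk m n j w)))).
  apply: measurable_hullpath => // j.
  exact: measurable_bsum (indepn_steps iidZ n) _ _.
have i1 : intg P (fun w => f (rw_hull n w)).
  apply: (@intg_bdd _ _ _ _ _ M); first exact: measurable_rw_hull.
  by move=> w; apply: fM; exact: rw_hull_K20.
have i2 : intg P (fun w => f (hullpath m (walk (fun j => blk m n j w)))).
  by apply: (@intg_bdd _ _ _ _ _ M) => // w; exact: fM.
have ib (j : 'I_m) : intg P (\1_(bad a m n j) : T -> R) by apply: intg_indic; exact: mbad.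
have iS := @intg_sum _ _ _ P _ (index_enum 'I_m) _ ib.
have iR := intgD (intg_cst P (L * (2 * a))) (intgZ (2 * M) iS).
rewrite -(ExB i1 i2).
apply: (@le_trans _ _ (\int[P]_w (cst (L * (2 * a)) w +
    2 * M * \sum_(j < m) \1_(bad a m n j) w))); last first.
  rewrite (ExD (intg_cst _ _) (intgZ _ iS)) Ex_cst lerD2l (ExZ _ iS) (Ex_sum _ ib).
  rewrite ler_wpM2l ?mulr_ge0//; apply: ler_sum => j _.
  by rewrite Ex_indic//; exact: mbad.
apply: (Ex_norm_le (intgB i1 i2) iR) => w /=.
have S0 : 0 <= \sum_(j < m) \1_(bad a m n j) w :> R by apply: sumr_ge0 => j _.
have [[j wj]|nbad] := pselect (exists j : 'I_m, bad a m n j w).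
  apply: (@le_trans _ _ (2 * M)).
    rewrite (le_trans (ler_normB _ _))// mulr_natl mulr2n lerD// fM//.
    exact: rw_hull_K20.
  apply: (@le_trans _ _ (2 * M * \sum_(j < m) \1_(bad a m n j) w)); last first.
    by rewrite lerDr !mulr_ge0// ltW.
  rewrite ler_peMr ?mulr_ge0// (bigD1 j)//= indicE mem_set// lerDl.
  by apply: sumr_ge0 => i _.
apply: (@le_trans _ _ (L * (2 * a))); last by rewrite lerDl !mulr_ge0.
apply: (le_trans (fL (rw_hull_K20 n w) (kB w))).
rewrite ler_wpM2l//.
rewrite (@hullpathS _ m _ (walk (fun i => steps n i w) \o cut m n)); last first.
  by move=> k km; rewrite walk_blk.
apply: rhoH_hullpath_sub; first by rewrite mulr_ge0// ltW.
  by move=> j jm; exact: cut_le.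
move=> k kn; have [j jm /andP[jk kj]] := cut_cover m0 kn.
exists j; first exact: ltnW.
rewrite leNgt; apply/negP => h; apply: nbad; exists (Ordinal jm).
(* The successor in [bad] includes the right end of the block, matching the closed range in
   [cut_cover]. *)
exists (k - cut m n j)%N => /=; first by rewrite ltnS leq_sub2r.
rewrite subnKC//.
have := @bsum_cat R T (steps n) 0 (cut m n j) k w (leq0n _) jk.
move: h; rewrite !walkE -!(big_mkord xpredT (fun i => steps n i w)).
by rewrite -!/(bsum (steps n) 0 _ w) => h e; rewrite e addrAC subrr add0r in h.
Qed.

Lemma lip_cvg : (\int[P]_w f (rw_hull n w)) @[n --> \oo] --> \int[Q]_w f (bm_hull w).
Proof.
suff main (e : R) : 0 < e -> \forall n \near \oo,
    `|\int[Q]_w f (bm_hull w) - \int[P]_w f (rw_hull n w)| < e.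
  by apply/cvgrPdist_lt.
move=> e0; have L1 : 0 < L + 1 by rewrite ltr_wpDl.
(* Five errors of at most [e / 8] will be added: the Lipschitz and the bad part of the walk's
   discretisation, the block comparison, the shift of the Brownian cut times, and the Brownian
   discretisation. *)
pose a := e / (16 * (L + 1)).
have a0 : 0 < a by rewrite divr_gt0// mulr_gt0.
have La : L * (2 * a) <= e / 8.
  rewrite /a (_ : _ * _ = e / 8 * (L / (L + 1))); last by field; rewrite gt_eqF.
  by rewrite ler_piMr ?divr_ge0 ?(ltW e0)// ler_pdivrMr// mul1r lerDl.
have [K K0 [m0 osc]] := oscillation iidZ Z2 meanZ bm psdS covS a0.
have e8 : 0 < e / 8 by rewrite divr_gt0.
have MK : 0 < 2 * M * K + 1 by rewrite ltr_pwDr// !mulr_ge0.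
have [N1 _ hN1] : \forall m \near \oo, m%:R^-1 < e / 8 / (2 * M * K + 1).
  by apply: near_invn_lt; rewrite divr_gt0.
have [N2 _ hN2] : \forall m \near \oo,
    `|\int[Q]_w f (bm_hull w) - \int[Q]_w f (bm_grid m w)| < e / 8.
  by move/cvgrPdist_lt : bm_grid_Ex_cvg; apply.
(* [m] is fixed before [n], since the thresholds on [n] in [h3], [h4] and [h5] depend on it. *)
pose m := (maxn m0 (maxn N1 N2)).+1.
have mpos : (0 < m)%N by [].
have m0m : (m0 <= m)%N by apply: ltnW; rewrite ltnS leq_maxl.
have N1m : (N1 <= m)%N by apply: ltnW; rewrite ltnS (leq_trans (leq_maxl N1 N2))// leq_maxr.
have N2m : (N2 <= m)%N by apply: ltnW; rewrite ltnS (leq_trans (leq_maxr N1 N2))// leq_maxr.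
have h2 := hN2 m N2m.
have MKm : 2 * M * (K / m%:R) <= e / 8.
  have := hN1 m N1m; rewrite /= ltr_pdivlMr// => /ltW h.
  apply: le_trans h; rewrite mulrA mulrC ler_pM2l ?invr_gt0//; lra.
have h3 := osc m m0m mpos.
have h4 : \forall n \near \oo,
    `|\int[P]_w f (hullpath m (walk (fun j => blk m n j w))) -
      \int[Q]_w f (hullpath m (walk (fun j => bblk m n j w)))| < e / 8.
  have /cvgrPdist_lt/(_ _ e8) := fdd_hull mpos.
  by apply: filterS => n; rewrite sub0r normrN.
have h5 : \forall n \near \oo, `|\int[Q]_w f (bm_grid m w) -
      \int[Q]_w f (hullpath m (walk (fun j => bblk m n j w)))| < e / 8.
  by move/cvgrPdist_lt : (bm_blocks_cvg mpos); apply.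
near=> n.
have g3 : \sum_(j < m) fine (P (bad a m n j)) <= K / m%:R by near: n; exact: h3.
have g4 : `|\int[P]_w f (hullpath m (walk (fun j => blk m n j w))) -
      \int[Q]_w f (hullpath m (walk (fun j => bblk m n j w)))| < e / 8.
  by near: n; exact: h4.
have g5 : `|\int[Q]_w f (bm_grid m w) -
      \int[Q]_w f (hullpath m (walk (fun j => bblk m n j w)))| < e / 8.
  by near: n; exact: h5.
have h1 := rw_hull_blocks n a0 mpos.
have h6 : 2 * M * \sum_(j < m) fine (P (bad a m n j)) <= e / 8.
  by rewrite (le_trans _ MKm)// ler_wpM2l ?mulr_ge0.
move: h1 h2 g4 g5; rewrite !ltr_norml ler_norml.
move=> /andP[? ?] /andP[? ?] /andP[? ?] /andP[? ?].
by apply/andP; split; lra.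
Unshelve. all: by end_near. Qed.

End Lipschitz.

Section BoundedContinuous.
Variable f : set (R * R) -> R.
Hypothesis cf : bdd_cont_K20 f.

(* One half of the portmanteau argument: [f] is the increasing limit of its
   Lipschitz envelopes. *)
Lemma Ex_rw_hull_ge (e : R) : 0 < e ->
  \forall n \near \oo, \int[Q]_w f (bm_hull w) - e <= \int[P]_w f (rw_hull n w).
Proof.
move=> e0; have [[M fM] ctf] := cf.
(* [point] supplies a sample, hence a member of [K20] at which the bound can be read. *)
have M0 : 0 <= M by exact: le_trans (fM _ (bm_hull_K20 point)).
have lipk k := envelope_lip fM k.
have ck k : bdd_cont_K20 (envelope f k) by exact: lip_bdd_cont (lipk k).
have lim : (\int[Q]_w envelope f k (bm_hull w)) @[k --> \oo] --> \int[Q]_w f (bm_hull w).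
  apply: (Ex_dct (g := cst M)).
  - by move=> k; exact: measurable_bm_hull.
  - move=> w; apply: (envelope_cvg fM (bm_hull_K20 w)); exact: ctf (bm_hull_K20 w).
  - by move=> k w; exact: (envelope_bound fM k (bm_hull_K20 w)).
  - exact: intg_cst.
have e2 : 0 < e / 2 by rewrite divr_gt0.
have [k _ hk] : \forall k \near \oo,
    `|\int[Q]_w f (bm_hull w) - \int[Q]_w envelope f k (bm_hull w)| < e / 2.
  by move/cvgrPdist_lt : lim; apply.
have := hk k (leqnn k); rewrite /= ltr_norml => /andP[_ h1].
have /cvgrPdist_lt/(_ _ e2) := lip_cvg M0 (ler0n R k) (lipk k).
apply: filterS => n; rewrite ltr_norml => /andP[_ h2].
have h3 : \int[P]_w envelope f k (rw_hull n w) <= \int[P]_w f (rw_hull n w).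
  apply: Ex_le.
  - apply: (@intg_bdd _ _ _ _ _ M); first exact: measurable_rw_hull.
    by move=> w; exact: (envelope_bound fM k (rw_hull_K20 n w)).
  - apply: (@intg_bdd _ _ _ _ _ M); first exact: measurable_rw_hull.
    by move=> w; apply: fM; exact: rw_hull_K20.
  - by move=> w; exact: (envelope_le_f fM k (rw_hull_K20 n w)).
lra.
Qed.

End BoundedContinuous.

Lemma bdd_cont_cvg f : bdd_cont_K20 f ->
  (\int[P]_w f (rw_hull n w)) @[n --> \oo] --> \int[Q]_w f (bm_hull w).
Proof.
move=> cf; have [[M fM] ctf] := cf.
have cNf : bdd_cont_K20 (fun A => - f A).
  split; first by exists M => A kA; rewrite normrN; exact: fM.
  move=> A kA e e0; have [del del0 h] := ctf A kA e e0.
  by exists del => // B kB AB; rewrite -opprD normrN; exact: h.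
suff main (e : R) : 0 < e -> \forall n \near \oo,
    `|\int[Q]_w f (bm_hull w) - \int[P]_w f (rw_hull n w)| <= e.
  by apply/cvgrPdist_le.
move=> e0.
have h1 := Ex_rw_hull_ge cf e0; have h2 := Ex_rw_hull_ge cNf e0.
near=> n.
have g1 : \int[Q]_w f (bm_hull w) - e <= \int[P]_w f (rw_hull n w).
  by near: n; exact: h1.
have g2 : \int[Q]_w (- f (bm_hull w)) - e <= \int[P]_w (- f (rw_hull n w)).
  by near: n; exact: h2.
have ExN d0 (T0 : measurableType d0) (P0 : probability T0 R) (g : T0 -> R) :
    intg P0 g -> \int[P0]_w (- g w) = - \int[P0]_w g w.
  move=> ig; rewrite -mulN1r -ExZ//; apply: eq_Rintegral => w _.
  by rewrite mulN1r.
rewrite !ExN in g2.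
- by rewrite ler_norml; apply/andP; split; lra.
- apply: (@intg_bdd _ _ _ _ _ M); first exact: measurable_rw_hull.
  by move=> w; apply: fM; exact: rw_hull_K20.
- apply: (@intg_bdd _ _ _ _ _ M); first exact: measurable_bm_hull.
  by move=> w; apply: fM; exact: bm_hull_K20.
Unshelve. all: by end_near. Qed.

End HullConvergence.

Unset Implicit Arguments.
Set Strict Implicit.

Theorem theorem2p5 (R : realType)
  (d : measure_display) (T : measurableType d) (P : probability T R)
  (Z : nat -> T -> (R * R)%type)
  (d' : measure_display) (T' : measurableType d') (Q : probability T' R)
  (b : R -> T' -> (R * R)%type) (Sroot : 'M[R]_2) :
  iid_seq P Z ->
  (\int[P]_w ((enorm (Z 0%N w)) ^+ 2)%:E < +oo)%E ->
  (forall i, meanv P (Z 0%N) i = 0) ->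
  std_BM2 Q b ->
  psd2 Sroot -> Sroot *m Sroot = covmx P (Z 0%N) ->
  weak_conv_K20 P
    (fun n w => pscale (Num.sqrt n%:R)^-1 @`
                  hull [set walk (fun k => Z k w) k | k in [set k | (k <= n)%N]])
    Q
    (fun w => mxapp Sroot @` hull [set b t w | t in `[0, 1]]).
Proof.
move=> iidZ Z2 meanZ bm psdS covS.
set X := fun n w => _; set Y := fun w => _.
(* Hulls commute with linear maps, so the scaling moves onto the single steps, and likewise the
   matrix onto the Brownian path. *)
have XE n w : X n w = rw_hull Z n w.
  rewrite /X image_hull; first last.
  - move=> c x; rewrite -[pscale _ (_ *: x)]/(_ *: (c *: x)) -[pscale _ x]/(_ *: x).
    by rewrite !scalerA mulrC.
  - by move=> x y; exact: (scalerDr (Num.sqrt n%:R)^-1 x y).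
  rewrite image_comp; congr hull; apply: eq_imagel => k _ /=.
  by rewrite !walkE; exact: scaler_sumr.
have YE w : Y w = bm_hull b Sroot w.
  rewrite /Y image_hull; first last.
  - exact: mxappZ.
  - exact: mxappD.
  by rewrite image_comp.
have kX n w : K20 (X n w) by rewrite XE; exact: rw_hull_K20.
have kY w : K20 (Y w) by rewrite YE; exact: (bm_hull_K20 _ bm).
split => // f cf.
have mX n : measurable_fun setT (fun w => f (X n w)).
  under eq_fun do rewrite XE; exact: (measurable_rw_hull iidZ _ cf).
have mY : measurable_fun setT (fun w => f (Y w)).
  under eq_fun do rewrite YE; exact: (measurable_bm_hull Sroot bm cf).
have [[M fM] _] := cf.
split => //.
rewrite EFin_Ex; last by apply: (@intg_bdd _ _ _ _ _ M) => // w; exact: fM.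
under eq_fun => n.
  rewrite EFin_Ex; last by apply: (@intg_bdd _ _ _ _ _ M) => // w; exact: fM.
  over.
apply: cvg_EFin; first exact: nearW.
under eq_fun => n do under eq_Rintegral do rewrite XE.
under eq_Rintegral do rewrite YE.
exact: (bdd_cont_cvg iidZ Z2 meanZ bm psdS covS cf).
Qed.
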